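(* Let $N\geq1$, let $U_1,\ldots,U_N$ be finite dimensional $\mathfrak{g}$-modules, $\mathbf{U}=U_1\otimes\cdots\otimes U_N$, and let $V_\ell,V_r$ be finite dimensional semisimple $\mathfrak{k}$-modules. Let $\underline{\lambda}=(\lambda_0,\ldots,\lambda_N)$ with $\lambda_i\in\mathfrak{h}^*$, let $\phi_\ell\in\mathrm{Hom}_{\mathfrak{k}}(M_{\lambda_0-\rho},V_\ell)$, $\phi_r\in\mathrm{Hom}_{\mathfrak{k}}(V_r,\overline{M}_{\lambda_N-\rho})$, and let $$\mathbf{\Psi}=(\Psi_1\otimes\mathrm{id}_{U_2\otimes\cdots\otimes U_N})\cdots(\Psi_{N-1}\otimes\mathrm{id}_{U_N})\Psi_N\in\mathrm{Hom}_{\mathfrak{g}}(M_{\lambda_N-\rho},M_{\lambda_0-\rho}\otimes\mathbf{U})$$ with $\Psi_i\in\mathrm{Hom}_{\mathfrak{g}}(M_{\lambda_i-\rho},M_{\lambda_{i-1}-\rho}\otimes U_i)$. The normalised formal $N$-point spherical function $\mathbf{F}_{\underline{\lambda}}^{\phi_\ell,\mathbf{\Psi},\phi_r}$ satisfies $$\mathcal{D}_i\bigl(\mathbf{F}_{\underline{\lambda}}^{\phi_\ell,\mathbf{\Psi},\phi_r}\bigr)=\Bigl(\frac{(\lambda_i,\lambda_i)}{2}-\frac{(\lambda_{i-1},\lambda_{i-1})}{2}\Bigr)\mathbf{F}_{\underline{\lambda}}^{\phi_\ell,\mathbf{\Psi},\phi_r}\qquad(i=1,\ldots,N)$$ in $(V_\ell\otimes\mathbf{U}\otimes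 V_r^* )[[\xi_{-\alpha_1},\ldots,\xi_{-\alpha_n}]]\xi_{\lambda_N}$. For $\lambda_N\in\mathfrak{h}_{\mathrm{HC}}^*+\rho$ these differential equations are valid as identities of $V_\ell\otimes\mathbf{U}\otimes V_r^*$-valued analytic functions on $A_+$.
   Context: Lie data. $\mathfrak{g}_0$ is a split real semisimple Lie algebra, $\theta_0$ a Cartan involution, $\mathfrak{h}_0$ a split Cartan subalgebra with $\theta_0|_{\mathfrak{h}_0}=-\mathrm{id}$. Dropping the subscript $0$ denotes complexification; $\mathfrak{k}\subset\mathfrak{g}$ is the fixed-point subalgebra of the complex linear extension $\theta$ of $\theta_0$. $(\cdot,\cdot)$ is the restriction of the Killing form to $\mathfrak{h}_0$ (positive definite), with induced form on $\mathfrak{h}_0^*$, extended complex bilinearly to $\mathfrak{h}$, $\mathfrak{h}^*$; $\{x_1,\ldots,x_n\}$ is an orthonormal basis of $\mathfrak{h}_0$. $R$ is the root system, $\alpha_1,\ldots,\alpha_n$ simple roots, $R^+$ positive roots, $\rho=\frac12\sum_{\alpha\in R^+}\alpha$, $\mathfrak{b}=\mathfrak{h}\oplus\bigoplus_{\alpha\in R^+}\mathfrak{g}_\alpha$, $Q_-=\bigoplus_i\mathbb{Z}_{\leq0}\alpha_i$, $\leq$ the dominance order ($\mu\leq\lambda$ iff $\mu-\lambda\in Q_-$). $t_\alpha\in\mathfrak{h}_0$ represents $\alpha$ via the Killing form, and $e_\alpha\in\mathfrak{g}_0\cap\mathfrak{g}_\alpha$ are root vectors with $[e_\alpha,e_{-\alpha}]=t_\alpha$,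 $\theta_0(e_\alpha)=-e_{-\alpha}$; $y_\alpha=e_\alpha-e_{-\alpha}\in\mathfrak{k}$. $G$ is a connected Lie group with Lie algebra $\mathfrak{g}_0$ and finite center, $A\subset G$ the connected subgroup with Lie algebra $\mathfrak{h}_0$; $\xi_\lambda(a)=a^\lambda:=e^{\lambda(\log a)}$, $A_+=\{a\in A: a^\alpha>1\ \forall\alpha\in R^+\}$, $\partial_h$ ($h\in\mathfrak{h}_0$) the derivation $(\partial_hf)(a)=\frac{d}{dt}|_{t=0}f(a\exp(th))$, so $\partial_h\xi_\lambda=\lambda(h)\xi_\lambda$. Functions such as $(1-\xi_{-2\alpha})^{-1}$ are expanded as power series in $\xi_{-\alpha_1},\ldots,\xi_{-\alpha_n}$ at infinity in $A_+$; $V[[\xi_{-\alpha_1},\ldots,\xi_{-\alpha_n}]]\xi_\lambda$ is the space of formal series $\sum_{\gamma\in Q_-}d_\gamma\xi_{\lambda+\gamma}$, $d_\gamma\in V$. $\mathfrak{h}^*_{\mathrm{HC}}=\{\lambda\in\mathfrak{h}^*: (2(\lambda+\rho)+\gamma,\gamma)\neq0\ \forall\gamma\in Q_-\setminus\{0\}\}$. $\delta=\xi_\rho\prod_{\alpha\in R^+}(1-\xi_{-2\alpha})^{1/2}$, viewed as function on $A_+$ or as element of $\mathbb{C}[[\xi_{-\alpha_1},\ldots,\xi_{-\alpha_n}]]\xi_\rho$. Formal $N$-point spherical functions. $M_\lambda=U(\mathfrak{g})\otimes_{U(\mathfrak{b})}\mathbb{C}_\lambda$ is the Verma module of highest weight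 $\lambda$; $\overline{M}_\lambda=\prod_\mu M_\lambda[\mu]$ is the product of its weight spaces with its natural $\mathfrak{g}$-module structure. For $\phi_r\in\mathrm{Hom}_{\mathfrak{k}}(V_r,\overline{M}_\lambda)$, $\phi_r^\mu$ is $\phi_r$ followed by the projection $\overline{M}_\lambda\to M_\lambda[\mu]$. With $\phi_\ell,\mathbf{\Psi},\phi_r$ as in the statement, $$\mathbf{F}_{\underline{\lambda}}^{\phi_\ell,\mathbf{\Psi},\phi_r}=\delta\sum_{\mu\leq\lambda_N-\rho}\bigl((\phi_\ell\otimes\mathrm{id}_{\mathbf{U}})\mathbf{\Psi}\phi_r^\mu\bigr)\xi_\mu\in(V_\ell\otimes\mathbf{U}\otimes V_r^* )[[\xi_{-\alpha_1},\ldots,\xi_{-\alpha_n}]]\xi_{\lambda_N},$$ where $\mathrm{Hom}(V_r,V_\ell\otimes\mathbf{U})\simeq V_\ell\otimes\mathbf{U}\otimes V_r^*$. For $\lambda_N\in\mathfrak{h}^*_{\mathrm{HC}}+\rho$ this series defines an analytic function on $A_+$. Asymptotic boundary KZB operators. Put $E=\sum_{j=1}^n\partial_{x_j}\otimes x_j$, $$r^+=\sum_{\alpha\in R}\frac{y_\alpha\otimes e_\alpha}{1-\xi_{-2\alpha}},\qquad r^-=\sum_{j=1}^nx_j\otimes x_j+\sum_{\alpha\in R}\frac{(e_\alpha+e_{-\alpha})\otimes e_\alpha}{1-\xi_{-2\alpha}},$$ $$\kappa=\sum_{\alpha\in R}\frac{y_\alpha\otimes e_\alpha\otimes1}{1-\xi_{-2\alpha}}+1\otimes\Bigl(\frac12\sum_{j=1}^nx_j^2+\sum_{\alpha\in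 R}\frac{e_\alpha^2}{1-\xi_{-2\alpha}}\Bigr)\otimes1+\sum_{\alpha\in R}\frac{1\otimes e_\alpha\otimes y_\alpha}{\xi_\alpha-\xi_{-\alpha}},$$ and $\mathcal{D}_i=E_i-\sum_{j=1}^{i-1}r^+_{ji}-\kappa_i-\sum_{j=i+1}^Nr^-_{ij}$ ($1\leq i\leq N$), a differential operator with values in $U(\mathfrak{k})\otimes U(\mathfrak{g})^{\otimes N}\otimes U(\mathfrak{k})$; the indices indicate in which tensor factors of $U(\mathfrak{g})^{\otimes N}$ the $U(\mathfrak{g})$-components are placed, and the two $U(\mathfrak{k})$-components of $\kappa_i$ are placed in the outer factors. It acts on $V_\ell\otimes\mathbf{U}\otimes V_r^*$-valued series/functions through the actions on $V_\ell$, $U_1,\ldots,U_N$, $V_r^*$ (dual $\mathfrak{k}$-module). *)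

(* Defs.v *)
From HB Require Import structures.
From mathcomp Require Import all_boot all_order all_algebra.
From mathcomp Require Import all_classical all_reals all_analysis.
From mathcomp Require Import complex freeg finmap.
From mathcomp Require summability.

Set Implicit Arguments.
Unset Strict Implicit.
Unset Printing Implicit Defensive.

Import Order.TTheory GRing.Theory Num.Theory.
Import numFieldNormedType.Exports.

Local Open Scope ring_scope.

(** * Quotient of a module by the submodule generated by a predicate *)

Section ModuleQuotient.
Variables (K : fieldType) (V : lmodType K) (S : V -> Prop).

Inductive in_span : V -> Prop :=
| in_span0 : in_span 0
| in_spanS c x y : S x -> in_span y -> in_span (c *: x + y).

Definition span_pred : {pred V} := fun v => `[< in_span v >].

Lemma in_spanD u v : in_span u -> in_span v -> in_span (u + v).
Proof.
by move=> hu hv; elim: hu => [|c x y Sx _ IH];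
  rewrite ?add0r // -addrA; apply: in_spanS.
Qed.

Lemma in_spanZ c v : in_span v -> in_span (c *: v).
Proof.
elim=> [|d x y Sx _ IH]; first by rewrite scaler0; apply: in_span0.
by rewrite scalerDr scalerA; apply: in_spanS.
Qed.

Lemma in_span_gen v : S v -> in_span v.
Proof.
by move=> Sv; rewrite -[v]scale1r -[_ *: v]addr0; apply: in_spanS => //;
  apply: in_span0.
Qed.

Lemma span_zmod_closed : zmod_closed span_pred.
Proof.
split=> [|u v]; first by apply/asboolP; apply: in_span0.
move=> /asboolP hu /asboolP hv; apply/asboolP; apply: in_spanD => //.
by rewrite -scaleN1r; apply: in_spanZ.
Qed.

HB.instance Definition _ := GRing.isZmodClosed.Build V span_pred span_zmod_closed.

Definition lquot : Type := Quotient.quot span_pred.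
HB.instance Definition _ := GRing.Zmodule.on lquot.

Definition lpi (v : V) : lquot := \pi_(Quotient.quot span_pred)%qT v.
Definition lrep (q : lquot) : V := repr (q : Quotient.quot span_pred).

Lemma lrepK q : lpi (lrep q) = q.
Proof. exact: reprK. Qed.

Lemma lpiP u v : reflect (in_span (u - v)) (lpi u == lpi v).
Proof.
have -> : (lpi u == lpi v) = (u - v \in span_pred).
  by rewrite (Quotient.idealrBE span_pred u v).
exact: asboolP.
Qed.

Lemma lpiD : {morph lpi : u v / u + v}.
Proof. by move=> u v; rewrite /lpi raddfD. Qed.

Definition lquot_scale (c : K) (q : lquot) : lquot := lpi (c *: lrep q).

Lemma lpiZ c v : lpi (c *: v) = lquot_scale c (lpi v).
Proof.
apply/eqP/lpiP; rewrite -scalerBr; apply: in_spanZ; apply/lpiP.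
by rewrite lrepK.
Qed.

Fact lquot_scaleA a b q :
  lquot_scale a (lquot_scale b q) = lquot_scale (a * b) q.
Proof. by rewrite -(lrepK q) -!lpiZ scalerA. Qed.

Fact lquot_scale1 : left_id 1 lquot_scale.
Proof. by move=> q; rewrite -(lrepK q) -lpiZ scale1r. Qed.

Fact lquot_scaleDr : right_distributive lquot_scale +%R.
Proof.
move=> a p q; rewrite -(lrepK p) -(lrepK q) -lpiD -!lpiZ scalerDr.
by rewrite lpiD.
Qed.

Fact lquot_scaleDl q : {morph lquot_scale^~ q : a b / a + b}.
Proof. by move=> a b; rewrite -(lrepK q) -!lpiZ scalerDl lpiD. Qed.

HB.instance Definition _ := GRing.Zmodule_isLmodule.Build K lquot
  lquot_scaleA lquot_scale1 lquot_scaleDr lquot_scaleDl.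

End ModuleQuotient.

(** * Lie algebras *)

Record lieAlgebra (K : fieldType) := LieAlgebra {
  lie_space :> vectType K;
  lie_br : lie_space -> lie_space -> lie_space;
  lie_br_linearl : forall c x y z,
    lie_br (c *: x + y) z = c *: lie_br x z + lie_br y z;
  lie_br_alt : forall x, lie_br x x = 0;
  lie_jacobi : forall x y z,
    lie_br x (lie_br y z) + lie_br y (lie_br z x) + lie_br z (lie_br x y) = 0
}.

Section LieNotions.
Variables (K : fieldType) (L : lieAlgebra K).
Implicit Types (x y : L) (U I : {vspace L}).

Definition lie_ad x : 'End(L) := linfun (lie_br x).

Definition end_trace (f : 'End(L)) : K :=
  \sum_i coord (vbasis {:L}) i (f (vbasis {:L})`_i).

Definition killing x y : K := end_trace (lie_ad x \o lie_ad y)%VF.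

Definition lie_prod U I : {vspace L} :=
  <<[seq lie_br x y | x <- vbasis U, y <- vbasis I]>>%VS.

Definition is_subalgebra U := (lie_prod U U <= U)%VS.
Definition is_ideal I := (lie_prod {:L} I <= I)%VS.

Definition is_solvable U :=
  exists k : nat, iter k (fun W => lie_prod W W) U = 0%VS.
Definition is_nilpotent U :=
  exists k : nat, iter k (fun W => lie_prod U W) U = 0%VS.

Definition is_semisimple := forall I, is_ideal I -> is_solvable I -> I = 0%VS.

Definition is_cartan_subalgebra U :=
  [/\ is_subalgebra U, is_nilpotent U
    & forall x, (forall h, h \in U -> lie_br x h \in U) -> x \in U].

Definition ad_diagonalizable x :=
  exists2 b : (\dim {:L}).-tuple L, basis_of {:L} b
    & forall i : 'I_(\dim {:L}), exists c : K, lie_br x b`_i = c *: b`_i.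

Definition is_split_cartan_subalgebra U :=
  is_cartan_subalgebra U /\ forall h, h \in U -> ad_diagonalizable h.

End LieNotions.

Definition is_cartan_involution (R : realType) (L : lieAlgebra R)
    (theta : 'End(L)) :=
  [/\ forall x y, theta (lie_br x y) = lie_br (theta x) (theta y),
      forall x, theta (theta x) = x
    & forall x, x != 0 -> 0 < - killing x (theta x)].

(** * Complexification: the pair [(x, y)] stands for [x + i y] *)

Section Complexification.
Variable R : realType.
Local Notation C := R[i].

Definition cplx (V : vectType R) : Type := (V * V)%type.

Section Module.
Variable V : vectType R.

HB.instance Definition _ := GRing.Zmodule.on (cplx V).

Definition cplx_scale (c : C) (z : cplx V) : cplx V :=
  (complex.Re c *: z.1 - complex.Im c *: z.2,
   complex.Re c *: z.2 + complex.Im c *: z.1).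

Fact cplx_scaleA a b z : cplx_scale a (cplx_scale b z) = cplx_scale (a * b) z.
Proof.
case: a b z => [a1 a2] [b1 b2] [x y]; congr (_, _); rewrite /=.
  rewrite !scalerBr !scalerDr !scalerA scalerBl scalerDl !opprD.
  by rewrite [X in _ + X = _]addrC addrACA.
rewrite !scalerBr !scalerDr !scalerA scalerBl scalerDl.
by rewrite [X in _ + X = _]addrC addrACA.
Qed.

Fact cplx_scale1 : left_id 1 cplx_scale.
Proof.
by case=> x y; rewrite /cplx_scale /= !scale1r !scale0r subr0 addr0.
Qed.

Fact cplx_scaleDr : right_distributive cplx_scale +%R.
Proof.
move=> [a b] [x y] [x' y']; congr (_, _); rewrite /= !scalerDr.
  by rewrite opprD addrACA.
by rewrite addrACA.
Qed.

Fact cplx_scaleDl z : {morph cplx_scale^~ z : a b / a + b}.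
Proof.
move=> [a b] [a' b']; case: z => x y; congr (_, _); rewrite /= !scalerDl.
  by rewrite opprD addrACA.
by rewrite addrACA.
Qed.

HB.instance Definition _ := GRing.Zmodule_isLmodule.Build C (cplx V)
  cplx_scaleA cplx_scale1 cplx_scaleDr cplx_scaleDl.

Definition cinj (x : V) : cplx V := (x, 0).

Definition cext (f : 'End(V)) (z : cplx V) : cplx V := (f z.1, f z.2).

Definition csub (U : {vspace V}) (z : cplx V) : Prop := z.1 \in U /\ z.2 \in U.

End Module.

Definition cbr (L : lieAlgebra R) (z w : cplx L) : cplx L :=
  (lie_br z.1 w.1 - lie_br z.2 w.2, lie_br z.1 w.2 + lie_br z.2 w.1).

End Complexification.

(** * Split data

    The dual of [h0] (resp. of [h]) is ['rV[R]_n] (resp. ['rV[R[i]]_n]): a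
    functional [mu] is the row of its values [mu(x_1), ..., mu(x_n)] on the
    orthonormal basis, so that the form induced by the Killing form is the
    standard bilinear (not hermitian) one. *)

Section Weights.
Variables (R : realType) (n : nat).
Local Notation C := R[i].

Definition dotw (K : comNzRingType) (lam mu : 'rV[K]_n) : K :=
  \sum_j lam 0 j * mu 0 j.

Definition toC : 'rV[R]_n -> 'rV[C]_n := map_mx (real_complex R).

Section OverLie.
Variables (L : lieAlgebra R) (x : n.-tuple L).

Definition root_space (al : 'rV[R]_n) : {vspace L} :=
  (\bigcap_(j < n) passmx.leigenspace (lie_ad (x`_j)%R) (al 0 j)%R)%VS.

Definition t_vec (al : 'rV[R]_n) : L := \sum_(j < n) al 0 j *: x`_j.

End OverLie.

(** [k] is the exponent of the monomial [xi_(- k_1 alpha_1 - ... - k_n alpha_n)] *)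
Definition expo : Type := {ffun 'I_n -> nat}.

Definition wsum (simple : n.-tuple 'rV[R]_n) (k : expo) : 'rV[R]_n :=
  \sum_(i < n) simple`_i *+ k i.

End Weights.

Record splitData (R : realType) (n : nat) := SplitData {
  sd_g0 :> lieAlgebra R;
  sd_theta : 'End(sd_g0);
  sd_h0 : {vspace sd_g0};
  sd_x : n.-tuple sd_g0;
  sd_roots : seq 'rV[R]_n;
  sd_simple : n.-tuple 'rV[R]_n;
  sd_e : 'rV[R]_n -> sd_g0;
  sd_semisimple : is_semisimple sd_g0;
  sd_thetaP : is_cartan_involution sd_theta;
  sd_h0P : is_split_cartan_subalgebra sd_h0;
  sd_theta_h0 : forall h, h \in sd_h0 -> sd_theta h = - h;
  sd_x_basis : basis_of sd_h0 sd_x;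
  sd_x_orthonormal : forall i j : 'I_n,
    killing sd_x`_i sd_x`_j = (i == j)%:R;
  sd_roots_uniq : uniq sd_roots;
  sd_rootsP : forall al,
    (al \in sd_roots) = (al != 0) && (root_space sd_x al != 0%VS);
  sd_simple_sub : {subset sd_simple <= sd_roots};
  sd_simple_basis : basis_of {:'rV[R]_n} sd_simple;
  sd_simpleP : forall al, al \in sd_roots ->
    exists k : expo n, al = wsum sd_simple k \/ al = - wsum sd_simple k;
  sd_e_root : forall al, al \in sd_roots -> sd_e al \in root_space sd_x al;
  sd_e_br : forall al, al \in sd_roots ->
    lie_br (sd_e al) (sd_e (- al)) = t_vec sd_x al;
  sd_e_theta : forall al, al \in sd_roots ->
    sd_theta (sd_e al) = - sd_e (- al)
}.

Section SplitNotions.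
Variables (R : realType) (n : nat) (D : splitData R n).
Local Notation C := R[i].
Local Notation g := (cplx D).
Local Notation weight := ('rV[C]_n).
Local Notation x_ := (fun j : 'I_n => cinj (sd_x D)`_j : g).
Local Notation e_ := (fun al => cinj (sd_e D al) : g).
Local Notation roots := (sd_roots D).

Definition positive (al : 'rV[R]_n) : bool :=
  `[< exists k : expo n, al = wsum (sd_simple D) k >].

Definition rho : 'rV[R]_n := 2^-1 *: \sum_(al <- roots | positive al) al.

Definition y_vec (al : 'rV[R]_n) : g := e_ al - e_ (- al).

Definition in_g : g -> Prop := fun=> True.
Definition in_h : g -> Prop := csub (sd_h0 D).
Definition in_k : g -> Prop := fun z => cext (sd_theta D) z = z.

Definition evw (lam : weight) (z : g) : C :=
  \sum_(j < n) (coord (sd_x D) j z.1 +i* coord (sd_x D) j z.2)%C * lam 0 j.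

Definition hc_regular (lam : weight) : Prop :=
  forall k : expo n, (exists i, k i <> 0%N) ->
    let ga := - toC (wsum (sd_simple D) k) in
    dotw (2%:R *: (lam + toC rho) + ga) ga <> 0.

(** ** Finite dimensional modules of a subalgebra [s] of [g]

    Only the values of [rep_mx] on [s] matter. *)

Record lieRep (s : g -> Prop) := LieRep {
  rep_dim : nat;
  rep_mx :> g -> 'M[C]_rep_dim;
  rep_linear : forall c z w, s z -> s w ->
    rep_mx (c *: z + w) = c *: rep_mx z + rep_mx w;
  rep_br : forall z w, s z -> s w ->
    rep_mx (cbr z w) = rep_mx z *m rep_mx w - rep_mx w *m rep_mx z
}.

Definition rep_stable s (V : lieRep s) (W : {vspace 'cV[C]_(rep_dim V)}) :=
  forall z v, s z -> v \in W -> V z *m v \in W.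

Definition rep_semisimple s (V : lieRep s) :=
  forall W : {vspace 'cV[C]_(rep_dim V)}, rep_stable W ->
  exists2 W' : {vspace 'cV[C]_(rep_dim V)}, rep_stable W'
    & (W + W')%VS = fullv /\ (W :&: W')%VS = 0%VS.

(** ** Verma modules

    The tensor algebra of [g] is presented as the free module on words in [g]
    modulo multilinearity.  As [C_lam] is one dimensional,
    [U(g) (x)_(U(b)) C_lam] is the quotient of [U(g)] by the left ideal
    generated by [h - lam(h)], [h] in [h], and by the positive root spaces. *)

Local Notation words := {freeg (seq g) / C}.

Inductive verma_rel (lam : weight) : words -> Prop :=
| verma_linear u c z w v :
    verma_rel lam (<< u ++ (c *: z + w)%R :: v >>
                   - (c *: << u ++ z :: v >> + << u ++ w :: v >>))
| verma_bracket u z w v :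
    verma_rel lam (<< u ++ [:: z, w & v] >> - << u ++ [:: w, z & v] >>
                   - << u ++ cbr z w :: v >>)
| verma_cartan u h of in_h h :
    verma_rel lam (<< u ++ [:: h] >> - evw lam h *: << u >>)
| verma_nilp u al z of al \in roots & positive al
    & csub (root_space (sd_x D) al) z :
    verma_rel lam << u ++ [:: z] >>.

Definition verma (lam : weight) : lmodType C := lquot (verma_rel lam).

Definition verma_class lam (w : seq g) : verma lam := lpi (verma_rel lam) << w >>.

Definition wcons (z : g) (P : words) : words :=
  fglift (fun w => << z :: w >> : words) P.

Definition verma_act lam (z : g) (m : verma lam) : verma lam :=
  lpi (verma_rel lam) (wcons z (lrep m)).

Lemma wconsU z c w : wcons z << c *g w >> = c *: << z :: w >>.
Proof. exact: liftU. Qed.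

Fact wcons_is_additive z : additive (wcons z).
Proof. exact: lift_is_additive. Qed.

HB.instance Definition _ z :=
  GRing.isZmodMorphism.Build words words (wcons z) (wcons_is_additive z).

Lemma wconsD z P Q : wcons z (P + Q) = wcons z P + wcons z Q.
Proof. exact: raddfD. Qed.

Lemma wconsN z P : wcons z (- P) = - wcons z P.
Proof. exact: raddfN. Qed.

Lemma wordsZ c k w : c *: (<< k *g w >> : words) = << (c * k) *g w >>.
Proof.
by apply/eqP/freeg_eqP=> v; rewrite coeffU coeff_fgscale coeffU mulrA.
Qed.

Lemma wconsZ z c P : wcons z (c *: P) = c *: wcons z P.
Proof.
rewrite -[P]freeg_sumE scaler_sumr [LHS]raddf_sum [X in _ *: X]raddf_sum.
rewrite scaler_sumr.
apply: eq_bigr => w _ /=.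
by rewrite wordsZ !wconsU scalerA.
Qed.

Lemma wcons1 z w : wcons z << w >> = << z :: w >>.
Proof. by rewrite wconsU scale1r. Qed.

Lemma verma_rel_wcons lam z P : verma_rel lam P -> verma_rel lam (wcons z P).
Proof.
case=> [u c a b v|u a b v|u h hh|u al a hal hp ha];
  rewrite ?(wconsD, wconsN, wconsZ, wcons1) -!cat_cons.
- exact: verma_linear.
- exact: verma_bracket.
- exact: verma_cartan.
- exact: verma_nilp hal hp ha.
Qed.

Lemma verma_actE lam z P :
  verma_act z (lpi (verma_rel lam) P) = lpi (verma_rel lam) (wcons z P).
Proof.
apply/eqP/lpiP; rewrite -wconsN -wconsD.
have : in_span (verma_rel lam) (lrep (lpi (verma_rel lam) P) - P).
  by apply/lpiP; rewrite lrepK.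
elim=> [|c a b ha _ IH]; first by rewrite raddf0; apply: in_span0.
by rewrite wconsD wconsZ; apply: in_spanS => //; apply: verma_rel_wcons.
Qed.

Lemma verma_act_word lam z w :
  verma_act z (verma_class lam w) = verma_class lam (z :: w).
Proof. by rewrite verma_actE wcons1. Qed.

Definition in_wspace lam (mu : weight) (m : verma lam) : Prop :=
  forall h, in_h h -> verma_act h m = evw mu h *: m.

(** ** The completion [prod_mu M_lam[mu]]

    Its elements are the families [m] with [m mu] in [M_lam[mu]]; [g] acts
    through the components of its elements in [g = h + sum_al g_al]. *)

Definition cartan_proj : 'End(D) :=
  daddv_pi (sd_h0 D) (\sum_(al <- roots) root_space (sd_x D) al)%VS.

Definition root_proj (al : 'rV[R]_n) : 'End(D) :=
  daddv_pi (root_space (sd_x D) al)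
    (sd_h0 D + \sum_(be <- roots | be != al) root_space (sd_x D) be)%VS.

Definition compl_act lam (z : g) (m : weight -> verma lam) : weight -> verma lam :=
  fun mu => verma_act (cext cartan_proj z) (m mu)
    + \sum_(al <- roots) verma_act (cext (root_proj al) z) (m (mu - toC al)).

(** ** Spaces of homomorphisms *)

Definition hom_k_from_verma lam (V : lieRep in_k)
    (phi : {linear verma lam -> 'cV[C]_(rep_dim V)}) : Prop :=
  forall z m, in_k z -> phi (verma_act z m) = V z *m phi m.

(** [phi mu] is the component [phi^mu] of a map [V -> prod_mu M_lam[mu]]. *)
Definition hom_k_to_compl lam (V : lieRep in_k)
    (phi : weight -> {linear 'cV[C]_(rep_dim V) -> verma lam}) : Prop :=
  (forall mu v, in_wspace mu (phi mu v)) /\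
  (forall z v mu, in_k z ->
     phi mu (V z *m v) = compl_act z (fun nu => phi nu v) mu).

(** [M (x) C^d] is [{ffun 'I_d -> M}]: [f] stands for [sum_a f a (x) u_a],
    [u_a] the standard basis. *)
Definition hom_g_tensor lam lam' (U : lieRep in_g)
    (Psi : {linear verma lam -> {ffun 'I_(rep_dim U) -> verma lam'}}) : Prop :=
  forall z m a,
    Psi (verma_act z m) a = verma_act z (Psi m a) + \sum_b U z a b *: Psi m b.

End SplitNotions.

Arguments verma {R n} D lam.
Arguments rho {R n} D.
Arguments in_g {R n D} _.
Arguments in_h {R n} D _.
Arguments in_k {R n} D _.

(** * Formal series

    [f : expo n -> V] stands for [sum_k f(k) xi_(lam - k_1 alpha_1 - ... - k_n alpha_n)]
    for a fixed leading exponent [lam]. *)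

Section FormalSeries.
Variables (R : realType) (n : nat) (D : splitData R n).
Local Notation C := R[i].
Local Notation weight := ('rV[C]_n).

Definition fmul (V : lmodType C) (f : expo n -> C) (F : expo n -> V) :
    expo n -> V :=
  fun k => \sum_(p : {dffun forall i : 'I_n, 'I_(k i).+1})
    f [ffun i => p i : nat] *: F [ffun i => (k i - p i)%N].

Definition fone : expo n -> C := fun k => (k == [ffun=> 0%N])%:R.

(** [sum_m u(m) xi_(- m al)] for a positive root [al]; at most one [m]
    contributes to each coefficient, and it is bounded by the height. *)
Definition fseries (al : 'rV[R]_n) (u : nat -> C) : expo n -> C :=
  fun k => \sum_(m < (\sum_i k i).+1 | wsum (sd_simple D) k == al *+ m) u m.

(** [1 / (1 - xi_(- 2 al))]; for [al < 0] it is
    [- xi_(2 al) / (1 - xi_(2 al))]. *)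
Definition fgeom (al : 'rV[R]_n) : expo n -> C :=
  if positive D al then fseries al (fun m => (~~ odd m)%:R)
  else fseries (- al) (fun m => - (~~ odd m && (0 < m)%N)%:R).

(** [1 / (xi_al - xi_(- al)) = xi_(- al) / (1 - xi_(- 2 al))], odd in [al]. *)
Definition fcsch (al : 'rV[R]_n) : expo n -> C :=
  if positive D al then fseries al (fun m => (odd m)%:R)
  else fseries (- al) (fun m => - (odd m)%:R).

(** Coefficient of [t^q] in [(1 - t)^(1/2)]. *)
Definition sqrt_coef (q : nat) : C :=
  (-1) ^+ q * (\prod_(i < q) (2^-1 - i%:R)) / (q`!)%:R.

(** [xi_(- rho) delta]. *)
Definition fdelta : expo n -> C :=
  foldr (fun al f => fmul (V := C^o)
           (fseries al (fun m => if odd m then 0 else sqrt_coef m./2)) f)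
    fone [seq al <- sd_roots D | positive D al].

Definition fderiv (V : lmodType C) (lam : weight) (j : 'I_n)
    (F : expo n -> V) : expo n -> V :=
  fun k => (lam - toC (wsum (sd_simple D) k)) 0 j *: F k.

End FormalSeries.

(** * Functions on [A]

    [G] has finite center, so [exp : h0 -> A] is a diffeomorphism: a point [a]
    of [A] is given by the coordinates ['rV[R]_n] of [log a] in the orthonormal
    basis.  Hence [a exp(t x_j)] is [a + t *: delta_mx 0 j] and [d_(x_j)] is
    the derivative in the direction [delta_mx 0 j]. *)

Section FunctionsOnA.
Variables (R : realType) (n : nat) (D : splitData R n).
Local Notation C := R[i].
Local Notation weight := ('rV[C]_n).
Local Notation A := ('rV[R]_n).

Definition cexp (z : C) : C :=
  (expR (complex.Re z))%:C%C *
  (cos (complex.Im z) +i* sin (complex.Im z))%C.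

Definition xi (lam : weight) (a : A) : C := cexp (dotw lam (toC a)).

Definition A_plus : set A := fun a =>
  forall al, al \in sd_roots D -> positive D al -> 1 < expR (dotw al a).

(** Unconditional, i.e. absolute, convergence. *)
Definition sums_to (I : choiceType) (f : I -> C) (s : C) : Prop :=
  (summability.partial_sum f @ summability.totally --> (s : C^o))%classic.

Definition analytic_at (f : A -> C) (a : A) : Prop :=
  exists c : expo n -> C, exists2 r : R, 0 < r
    & forall t : A, (forall j, `|t 0 j| < r) ->
      sums_to (fun k => c k * (\prod_j t 0 j ^+ k j)%:C%C) (f (a + t)).

Definition partial_A (j : 'I_n) (f : A -> C) (a : A) : C :=
  ('D_(delta_mx 0 j) (fun b => complex.Re (f b)) a
   +i* 'D_(delta_mx 0 j) (fun b => complex.Im (f b)) a)%C.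

End FunctionsOnA.

(** * The asymptotic boundary KZB operators *)

Section KZB.
Variables (R : realType) (n : nat) (D : splitData R n).
Variables (N : nat) (U : 'I_N -> lieRep (@in_g R n D)).
Variables Vl Vr : lieRep (in_k D).
Local Notation C := R[i].
Local Notation g := (cplx D).
Local Notation weight := ('rV[C]_n).
Local Notation x_ j := (cinj (sd_x D)`_j : g).
Local Notation e_ al := (cinj (sd_e D al) : g).
Local Notation y_ al := (y_vec D al).
Local Notation roots := (sd_roots D).

(** Basis of [U_1 (x) ... (x) U_N]. *)
Definition tens_ix : Type := {dffun forall i : 'I_N, 'I_(rep_dim (U i))}.

(** [V_l (x) U (x) V_r^*], with [V_l (x) V_r^* = Hom(V_r, V_l)]. *)
Definition tens : Type :=
  {ffun {dffun forall i : 'I_N, 'I_(rep_dim (U i))} ->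
        'M[C]_(rep_dim Vl, rep_dim Vr)}.

Definition act_l (z : g) (T : tens) : tens := [ffun j => Vl z *m T j].

Definition act_U (i : 'I_N) (z : g) (T : tens) : tens :=
  [ffun j : tens_ix =>
    \sum_(b : 'I_(rep_dim (U i))) U i z (j i) b *: T (finfun (dfwith j i b))].

(** Dual module: [(z f)(v) = - f (z v)]. *)
Definition act_r (z : g) (T : tens) : tens := [ffun j => - (T j *m Vr z)].

Section Operators.

(** The operators act on [tens]-valued functions on [Z]: coefficient families
    ([Z = expo n]) or functions on [A].  [dx j] is [d_(x_j)], [geom al] and
    [csch al] are the multiplications by [1 / (1 - xi_(- 2 al))] and by
    [1 / (xi_al - xi_(- al))]. *)
Variables (Z : Type) (dx : 'I_n -> (Z -> tens) -> Z -> tens).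
Variables geom csch : 'rV[R]_n -> (Z -> tens) -> Z -> tens.

Definition E_op (i : 'I_N) (F : Z -> tens) (z : Z) : tens :=
  \sum_(j < n) act_U i (x_ j) (dx j F z).

Definition r_plus (j i : 'I_N) (F : Z -> tens) (z : Z) : tens :=
  \sum_(al <- roots) act_U j (y_ al) (act_U i (e_ al) (geom al F z)).

Definition r_minus (i j : 'I_N) (F : Z -> tens) (z : Z) : tens :=
  \sum_(k < n) act_U i (x_ k) (act_U j (x_ k) (F z))
  + \sum_(al <- roots)
      act_U i (e_ al + e_ (- al)) (act_U j (e_ al) (geom al F z)).

Definition kappa (i : 'I_N) (F : Z -> tens) (z : Z) : tens :=
  \sum_(al <- roots) act_l (y_ al) (act_U i (e_ al) (geom al F z))
  + (2^-1 *: \sum_(j < n) act_U i (x_ j) (act_U i (x_ j) (F z))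
     + \sum_(al <- roots) act_U i (e_ al) (act_U i (e_ al) (geom al F z)))
  + \sum_(al <- roots) act_U i (e_ al) (act_r (y_ al) (csch al F z)).

Definition kzb (i : 'I_N) (F : Z -> tens) (z : Z) : tens :=
  E_op i F z - \sum_(j < N | (j < i)%N) r_plus j i F z
  - kappa i F z - \sum_(j < N | (i < j)%N) r_minus i j F z.

End Operators.

Definition kzb_formal (lam : weight) : 'I_N -> (expo n -> tens) -> expo n -> tens :=
  kzb (fderiv D lam) (fun al => fmul (fgeom D al)) (fun al => fmul (fcsch D al)).

Definition kzb_on_A : 'I_N -> ('rV[R]_n -> tens) -> 'rV[R]_n -> tens :=
  kzb (fun j F a => [ffun w => \matrix_(p, q) partial_A j (fun b => F b w p q) a])
    (fun al F a => (1 - xi (- toC (al *+ 2)) a)^-1 *: F a)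
    (fun al F a => (xi (toC al) a - xi (- toC al) a)^-1 *: F a).

(** * Formal N-point spherical functions *)

Variable lam : N.+1.-tuple weight.
Local Notation M k := (verma D (lam`_k - toC (rho D))).
Variable phi_l : {linear M 0 -> 'cV[C]_(rep_dim Vl)}.
Variable Psi : forall i : 'I_N, {linear M i.+1 -> {ffun 'I_(rep_dim (U i)) -> M i}}.
Variable phi_r : weight -> {linear 'cV[C]_(rep_dim Vr) -> M N}.

(** [w]-component of
    [(Psi_1 (x) id) ... (Psi_(k-1) (x) id) Psi_k : M_(lam_k - rho) -> M_(lam_0 - rho) (x) U_1 (x) ... (x) U_k]. *)
Fixpoint Psi_comp (w : tens_ix) (k : nat) : (k <= N)%N -> M k -> M 0 :=
  match k with
  | 0%N => fun _ m => m
  | k'.+1 => fun hk m =>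
      Psi_comp w (ltnW hk) (Psi (Ordinal hk) m (w (Ordinal hk)))
  end.

(** Coefficient of [xi_(lam_N - rho - k_1 alpha_1 - ...)]. *)
Definition spherical_coef (k : expo n) : tens :=
  [ffun w => \matrix_(p, q)
    phi_l (Psi_comp w (leqnn N)
      (phi_r (lam`_N - toC (rho D) - toC (wsum (sd_simple D) k))
         (delta_mx q 0))) p 0].

(** Coefficients of the normalised function, an element of
    [(V_l (x) U (x) V_r^* )[[xi]] xi_(lam_N)]. *)
Definition spherical : expo n -> tens := fmul (fdelta D) spherical_coef.

Definition sums_to_spherical (F : 'rV[R]_n -> tens) (a : 'rV[R]_n) : Prop :=
  forall w p q,
    sums_to (fun k => spherical k w p q
                      * xi (lam`_N - toC (wsum (sd_simple D) k)) a) (F a w p q).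

End KZB.

(* Main.v *)
Require Import Defs.
From HB Require Import structures.
From mathcomp Require Import all_boot all_order all_algebra.
From mathcomp Require Import all_classical all_reals all_analysis.
From mathcomp Require Import complex freeg finmap ring lra zify.
From mathcomp Require summability.

Set Implicit Arguments.
Unset Strict Implicit.
Unset Printing Implicit Defensive.

Import Order.TTheory GRing.Theory Num.Theory.
Import numFieldNormedType.Exports.

Local Open Scope ring_scope.

(** The Casimir element acts on [M_(lam - rho)] by [(lam, lam) - (rho, rho)].
    Comparing its insertions on both sides of [Psi_i] expresses
    [(lam_i, lam_i) - (lam_(i-1), lam_(i-1))] times the spherical function
    through insertions of the [x_j] and the [e_(- al)], which the intertwining
    property of the other [Psi_j] moves to the two ends.  There equivariance of
    [phi_l] and [phi_r] under [y_al] gives two relations between the insertions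
    of [e_al] and [e_(- al)]; solving them along the ray [mu + m al] produces the
    series of [1 / (1 - xi_(- 2 al))] and [1 / (xi_al - xi_(- al))], and the
    factor [delta] absorbs the terms linear in [rho].

    For convergence, the Casimir element on [M_(lam_N - rho)] alone bounds
    [|k|^2] times the [k]-th coefficient by [O(|k|)] times a sum of coefficients
    over rays, so the coefficients grow subexponentially in [|k|].  Hence, for
    small [t], the double series obtained by expanding every [xi_(lam_N - k)(a + t)]
    in powers of [t] is absolutely convergent, which gives analyticity and
    termwise differentiation. *)

(** * Linear identities in abelian groups *)

(** Of the Poincare-Birkhoff-Witt theorem only the spanning half is needed: monomials in negative
    root vectors span, so every weight vector outside the cone below the highest weight is zero.
    This is what stops the recursion along a ray. The relation from [phi_l] compares [e_al] and
    [e_(- al)] at one weight, the relation from [phi_r] at weights that differ by [2 al]; neither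
    can be solved alone, and alternating them climbs until the cone is left. The terms linear in
    [rho] come from [[e_al, e_(- al)] = t_al]: pairing [al] with [- al] collects them into [t_al]
    times [1 / (1 - xi_(- 2 al)) - 1 / 2], and summed over the positive roots this is the
    logarithmic derivative of [delta]. In the growth estimate the double insertion of [e_(- al)] and
    [e_al] obeys a recursion of the same kind, whose inhomogeneous terms contain single insertions,
    themselves sums over the ray. Terms bounded by [r^|k|] with [r > 1] add up along a ray to at
    most [r^|k| / (r - 1)], so for large [|k|] the quadratic factor wins whatever [r] is. *)

Inductive zexpr :=
  ZVar of nat | ZAdd of zexpr & zexpr | ZOpp of zexpr | ZZero.

Fixpoint zeval (V : zmodType) (env : seq V) (e : zexpr) : V :=
  match e with
  | ZVar i => env`_i
  | ZAdd a b => zeval env a + zeval env b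
  | ZOpp a => - zeval env a
  | ZZero => 0
  end.

Fixpoint zcoef (e : zexpr) (i : nat) : int :=
  match e with
  | ZVar j => (i == j)%:R
  | ZAdd a b => zcoef a i + zcoef b i
  | ZOpp a => - zcoef a i
  | ZZero => 0
  end.

Fixpoint zbound (n : nat) (e : zexpr) : bool :=
  match e with
  | ZVar j => (j < n)%N
  | ZAdd a b => zbound n a && zbound n b
  | ZOpp a => zbound n a
  | ZZero => true
  end.

Lemma zevalE (V : zmodType) (env : seq V) e : zbound (size env) e ->
  zeval env e = \sum_(i < size env) env`_i *~ zcoef e i.
Proof.
elim: e => [j|a IHa b IHb|a IHa|] /=.
- move=> lt_j; rewrite (bigD1 (Ordinal lt_j)) //= eqxx mulr1z big1 ?addr0 //.
  by move=> i; rewrite -val_eqE /= => /negPf->; rewrite mulr0z.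
- move=> /andP[/IHa-> /IHb->]; rewrite -big_split; apply: eq_bigr => i _.
  by rewrite mulrzDr.
- by move=> /IHa->; rewrite -sumrN; apply: eq_bigr => i _; rewrite mulrNz.
- by move=> _; rewrite big1 // => i _; rewrite mulr0z.
Qed.

Lemma zmod_correct (V : zmodType) (env : seq V) n a b :
  size env = n ->
  [&& zbound n a, zbound n b & all (fun i => zcoef a i == zcoef b i) (iota 0 n)] ->
  zeval env a = zeval env b.
Proof.
move=> <- /and3P[ha hb /allP h]; rewrite !zevalE //; apply: eq_bigr => i _.
by rewrite (eqP (h i _)) // mem_iota /=.
Qed.

Ltac zmod_same conv x y :=
  lazymatch x with
  | y => true
  | _ => lazymatch conv with
         | true => match constr:(Set) with
                   | _ => let _ := match constr:(Set) with _ => unify x y end in true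
                   | _ => false
                   end
         | false => false
         end
  end.

Ltac zmod_mem conv x env :=
  lazymatch env with
  | nil => false
  | ?y :: ?t => let b := zmod_same conv x y in
                lazymatch b with true => true | false => zmod_mem conv x t end
  end.

Ltac zmod_index conv x env :=
  lazymatch env with
  | ?y :: ?t => let b := zmod_same conv x y in
                lazymatch b with
                | true => constr:(0%N)
                | false => let i := zmod_index conv x t in constr:(i.+1)
                end
  end.

Ltac zmod_atoms conv env t :=
  lazymatch t with
  | ?a + ?b => let env := zmod_atoms conv env a in zmod_atoms conv env b
  | - ?a => zmod_atoms conv env a
  | 0 => env
  | ?x => let b := zmod_mem conv x env in
          lazymatch b with true => env | false => constr:(x :: env) end
  end.

Ltac zmod_quote conv env t :=
  lazymatch t with
  | ?a + ?b => let a := zmod_quote conv env a in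
               let b := zmod_quote conv env b in constr:(ZAdd a b)
  | - ?a => let a := zmod_quote conv env a in constr:(ZOpp a)
  | 0 => constr:(ZZero)
  | ?x => let i := zmod_index conv x env in constr:(ZVar i)
  end.

Ltac zmod_with conv :=
  lazymatch goal with
  | |- @eq ?V ?a ?b =>
    let env := zmod_atoms conv (@nil V) a in
    let env := zmod_atoms conv env b in
    let qa := zmod_quote conv env a in
    let qb := zmod_quote conv env b in
    refine (@zmod_correct _ env _ qa qb erefl _); vm_compute; reflexivity
  end.

(* Atoms are compared syntactically first, and up to conversion if that fails. *)
Ltac zmod := first [zmod_with false | zmod_with true].

(* These avoid a search for the linear structures of the source and target,
   which is very slow on the tensor spaces below. *)
Section LinearFun.
Variables (K : pzRingType) (V W : lmodType K) (f : V -> W) (lf : linear f).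

Lemma linfD u v : f (u + v) = f u + f v.
Proof. by rewrite -[u in LHS]scale1r lf scale1r. Qed.

Lemma linf0 : f 0 = 0.
Proof. by apply: (addrI (f 0)); rewrite -linfD !addr0. Qed.

Lemma linfZ c u : f (c *: u) = c *: f u.
Proof. by rewrite -[c *: u]addr0 lf linf0 addr0. Qed.

Lemma linfN u : f (- u) = - f u.
Proof. by rewrite -[- u]scaleN1r linfZ scaleN1r. Qed.

Lemma linfB u v : f (u - v) = f u - f v.
Proof. by rewrite linfD linfN. Qed.

Lemma linf_sum I (s : seq I) P (F : I -> V) :
  f (\sum_(i <- s | P i) F i) = \sum_(i <- s | P i) f (F i).
Proof. by elim/big_rec2: _ => [|i a b _ <-]; rewrite ?linf0 // linfD. Qed.

End LinearFun.

(** * Right linearity of the bracket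

    The record [lieAlgebra] only asks for linearity in the left argument and
    [lie_br x x = 0]; antisymmetry does not follow from its axioms alone, but
    it does once there are no solvable ideals.  The trilinearity of
    [[x, [y, z]]] comes from the Jacobi identity, and then
    [[p, q] + [q, p]] spans a solvable ideal. *)

Section RightLinearity.
Variables (R : realType) (L : lieAlgebra R).
Implicit Types (x y z w p q : L) (t : R).
Local Notation "[ x , y ]" := (lie_br x y) (at level 0).

Lemma lie_brDl x y z : [x + y, z] = [x, z] + [y, z].
Proof. by rewrite -[x in LHS]scale1r lie_br_linearl scale1r. Qed.

Lemma lie_br0l z : [0, z] = 0.
Proof. by apply: (addrI [0, z]); rewrite -lie_brDl !addr0. Qed.

Lemma lie_brZl t x z : [t *: x, z] = t *: [x, z].
Proof. by rewrite -[t *: x]addr0 lie_br_linearl lie_br0l addr0. Qed.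

Lemma lie_brNl x z : [- x, z] = - [x, z].
Proof. by rewrite -scaleN1r lie_brZl scaleN1r. Qed.

Lemma lie_br0r x : [x, 0] = 0.
Proof.
have := lie_jacobi x x x; rewrite lie_br_alt -!mulr2n -mulrSr => /eqP.
by rewrite -scaler_nat scaler_eq0 pnatr_eq0 => /eqP.
Qed.

Lemma eq_opp_eq0 (v : L) : v = - v -> v = 0.
Proof.
move=> h; have /eqP : 2%:R *: v = 0 by rewrite scaler_nat mulr2n {1}h addNr.
by rewrite scaler_eq0 pnatr_eq0 => /eqP.
Qed.

(** The transpositions (1 2) and (1 3) are conjugate in the symmetric group, so they cannot act on a
    nonzero [e] by opposite signs. *)
Lemma sym_antisym_eq0 (e : L -> L -> L -> L) :
  (forall x y z, e x y z = e y x z) -> (forall x y z, e x y z = - e z y x) ->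
  forall x y z, e x y z = 0.
Proof.
move=> s a x y z; apply: eq_opp_eq0.
by rewrite {1}a s a opprK s a s.
Qed.

Let F x y z := [x, [y, z]].

Let FJ x y z : F x y z = - F y z x - F z x y.
Proof.
have := lie_jacobi x y z; rewrite -/(F x y z) -/(F y z x) -/(F z x y) => h.
rewrite -[LHS]addr0 -[0]oppr0 -h; zmod.
Qed.

Let FDl a b y z : F (a + b) y z = F a y z + F b y z. Proof. exact: lie_brDl. Qed.
Let FNl a y z : F (- a) y z = - F a y z. Proof. exact: lie_brNl. Qed.

(** The Jacobi identity rewrites the defect of additivity [e] so that its last argument occupies a
    linear slot. It is symmetric in the first two arguments and vanishes when the first and the last
    agree; antisymmetry in these two follows, and [sym_antisym_eq0] applies. *)
Lemma lie_br2Dm y z z' x : [y, [z + z', x]] = [y, [z, x]] + [y, [z', x]].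
Proof.
pose e z z' x := F y (z + z') x - F y z x - F y z' x.
have eE a b c : e a b c = F c y a + F c y b - F c y (a + b).
  by rewrite /e !(FJ y) FDl; zmod.
suff : e z z' x = 0.
  by rewrite /e -/(F y _ _) -/(F y z x) => h; rewrite -[RHS]addr0 -h /F; zmod.
have exx u v : e u v u = 0.
  by rewrite /e /F lie_brDl lie_br_alt lie_br0r add0r subr0 subrr.
have eC u v w : e u v w = e v u w.
  by rewrite /e (addrC u v); zmod.
apply: sym_antisym_eq0 => // a b c.
have eBx u v p q : e u v (p - q) = e u v p - e u v q.
  by rewrite !eE !FDl !FNl; zmod.
(* The summand [c - a] of the first argument disappears against the equal last argument, because
   [[u + x, x] = [u, x]]. *)
have : e (a + (c - a)) b (c - a) = e a b (c - a).
  have -> : e (a + (c - a)) b (c - a) =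
    F y (a + b + (c - a)) (c - a) - F y (a + (c - a)) (c - a) - F y b (c - a).
    by congr (F _ _ _ - _ - _); zmod.
  by rewrite /e /F !(lie_brDl _ (c - a) (c - a)) lie_br_alt !addr0.
rewrite addrCA subrr addr0 !eBx !exx => h.
by rewrite -[LHS]subr0 -h; zmod.
Qed.

Let FDm y z z' x : F y (z + z') x = F y z x + F y z' x.
Proof. exact: lie_br2Dm. Qed.

Let FDr x y z z' : F x y (z + z') = F x y z + F x y z'.
Proof. by rewrite !(FJ x) FDm FDl; zmod. Qed.

Let Fxx x y : F x y y = 0. Proof. by rewrite /F lie_br_alt lie_br0r. Qed.

Let FC x y z : F x y z = - F x z y.
Proof.
have := Fxx x (y + z); rewrite FDm !FDr !Fxx => h.
by rewrite -[LHS]subr0 -h; zmod.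
Qed.

(** The same sign argument for the defect of homogeneity: antisymmetric in the last two arguments by
    polarisation, symmetric in the outer two by the Jacobi identity. *)
Lemma lie_br2Zm t y z x : [y, [t *: z, x]] = t *: [y, [z, x]].
Proof.
pose b y z x := F y (t *: z) x - t *: F y z x.
suff : b y z x = 0 by move/eqP; rewrite subr_eq0 => /eqP.
have FZl a u v : F (t *: a) u v = t *: F a u v by exact: lie_brZl.
have bC u v w : b u v w = - b u w v.
  have bDx p q r : b u p (q + r) = b u p q + b u p r.
    by rewrite /b !FDr scalerDr; zmod.
  have bDz p q r : b u (p + q) r = b u p r + b u q r.
    by rewrite /b scalerDr !FDm scalerDr; zmod.
  have bxx p : b u p p = 0 by rewrite /b Fxx scaler0 /F lie_brZl lie_br_alt scaler0 lie_br0r subr0.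
  have := bxx (v + w); rewrite bDx !bDz !bxx => h.
  by rewrite -[LHS]subr0 -h; zmod.
have bS u v w : b u v w = b w v u.
  by rewrite /b !(FJ u) FZl (FC w u) (FC w u v) !scalerDr !scalerN; zmod.
have h (p q r : L) : b p q r = 0.
  apply: (sym_antisym_eq0 (e := fun p q r => b p r q)) => {p q r} p q r.
    exact: bS.
  by rewrite (bS p) (bC q) (bS q).
exact: h.
Qed.

Hypothesis ssL : is_semisimple L.

(** Homogeneity on the right is not yet available, so the multiples of [v] need a hypothesis of
    their own. *)
Let solvable_line v : (forall x, [x, v] = 0) ->
  (forall s : R, forall x, [x, s *: v] = 0) -> v = 0.
Proof.
move=> hv hsv; apply/eqP; rewrite -memv0.
have prod0 (U : {vspace L}) : lie_prod U <[v]> = 0%VS.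
  apply/eqP; rewrite -subv0; apply/span_subvP => _ /allpairsP[[a b] [_ /= hb ->]].
  have /vlineP[s ->] : b \in <[v]>%VS by exact: vbasis_mem.
  by rewrite hsv mem0v.
rewrite -(ssL (I := <[v]>%VS)) ?memv_line //.
  by rewrite /is_ideal prod0 sub0v.
by exists 1%N; rewrite /= prod0.
Qed.

(** Only double brackets with [[p, q] + [q, p]] are known to vanish. The absence of solvable ideals
    is therefore used twice: on the lines spanned by the single brackets with it, then on its own
    line. *)
Lemma lie_br_antisym p q : [p, q] = - [q, p].
Proof.
have rad (e : L) : (forall x w, F x w e = 0) -> forall w, [w, e] = 0.
  move=> he w; apply: solvable_line => [x|s x]; first exact: he.
  by rewrite -lie_brZl; exact: he.
have h0 x w : F x w ([p, q] + [q, p]) = 0.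
  rewrite FDr /F -/(F w q p) FC /F; set c := [w, _].
  have -> : [x, - c] = - [x, c].
    by rewrite /c -lie_brNl -scaleN1r lie_br2Zm scaleN1r.
  by rewrite subrr.
have hs (s : R) x w : F x w (s *: ([p, q] + [q, p])) = 0.
  by rewrite FC /F lie_br2Zm -/(F _ _ _) FC h0 oppr0 scaler0 oppr0.
have /solvable_line h : forall x, [x, [p, q] + [q, p]] = 0 by apply: rad.
apply/eqP; rewrite -subr_eq0 opprK h // => s x; apply: rad => {}x w.
exact: hs.
Qed.

Lemma lie_brDr x y z : [x, y + z] = [x, y] + [x, z].
Proof. by rewrite !(lie_br_antisym x) lie_brDl; zmod. Qed.

Lemma lie_brZr t x y : [x, t *: y] = t *: [x, y].
Proof. by rewrite !(lie_br_antisym x) lie_brZl scalerN. Qed.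

Lemma lie_brNr x y : [x, - y] = - [x, y].
Proof. by rewrite -scaleN1r lie_brZr scaleN1r. Qed.

Lemma lie_brBr x y z : [x, y - z] = [x, y] - [x, z].
Proof. by rewrite lie_brDr lie_brNr. Qed.

Lemma lie_br_br x y z : [[x, y], z] = [x, [y, z]] - [y, [x, z]].
Proof.
have h := lie_jacobi x y z; rewrite (lie_br_antisym x z) lie_brNr.
by rewrite -[LHS]addr0 -h (lie_br_antisym z [x, y]); zmod.
Qed.

Lemma lie_adE x y : lie_ad x y = [x, y].
Proof.
have lin : linear_for *:%R (lie_br x) by move=> t u v; rewrite lie_brDr lie_brZr.
pose f : {linear L -> L} :=
  HB.pack (lie_br x) (GRing.isLinear.Build R L L *:%R (lie_br x) lin).
exact: (lfunE f y).
Qed.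

End RightLinearity.

(** * Structure of split semisimple Lie algebras *)

Section Killing.
Variables (R : realType) (L : lieAlgebra R) (ssL : is_semisimple L).
Implicit Types (x y z : L) (t : R).
Local Notation "[ x , y ]" := (lie_br x y) (at level 0).
Local Notation b := (vbasis {:L}).

Lemma lie_br_suml I (s : seq I) P (F : I -> L) z :
  [\sum_(i <- s | P i) F i, z] = \sum_(i <- s | P i) [F i, z].
Proof.
by elim/big_rec2: _ => [|i u v _ <-]; rewrite ?lie_br0l // lie_brDl.
Qed.

Lemma lie_br_sumr I (s : seq I) P (F : I -> L) z :
  [z, \sum_(i <- s | P i) F i] = \sum_(i <- s | P i) [z, F i].
Proof.
by elim/big_rec2: _ => [|i u v _ <-]; rewrite ?lie_br0r // lie_brDr.
Qed.

Lemma end_traceC (f g : 'End(L)) : end_trace (f \o g)%VF = end_trace (g \o f)%VF.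
Proof.
have tE (u v : 'End(L)) : end_trace (u \o v)%VF =
    \sum_(i < \dim {:L}) \sum_(j < \dim {:L}) coord b j (v b`_i) * coord b i (u b`_j).
  apply: eq_bigr => i _; rewrite comp_lfunE.
  rewrite {1}(coord_vbasis (memvf (v b`_i))) linear_sum linear_sum.
  by apply: eq_bigr => j _; rewrite !linearZ.
rewrite !tE exchange_big; apply: eq_bigr => i _; apply: eq_bigr => j _.
by rewrite mulrC.
Qed.

Lemma end_traceD (f g : 'End(L)) : end_trace (f + g) = end_trace f + end_trace g.
Proof.
by rewrite /end_trace -big_split; apply: eq_bigr => i _; rewrite add_lfunE linearD.
Qed.

Lemma end_traceZ t (f : 'End(L)) : end_trace (t *: f) = t * end_trace f.
Proof.
by rewrite /end_trace mulr_sumr; apply: eq_bigr => i _; rewrite scale_lfunE linearZ.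
Qed.

Lemma killingC x y : killing x y = killing y x.
Proof. exact: end_traceC. Qed.

Lemma killingDl x y z : killing (x + y) z = killing x z + killing y z.
Proof.
rewrite /killing -end_traceD; congr end_trace; apply/lfunP => v.
by rewrite add_lfunE !comp_lfunE !lie_adE // lie_brDl.
Qed.

Lemma killingZl t x z : killing (t *: x) z = t * killing x z.
Proof.
rewrite /killing -end_traceZ; congr end_trace; apply/lfunP => v.
by rewrite scale_lfunE !comp_lfunE !lie_adE // lie_brZl.
Qed.

Lemma killingZr t x z : killing z (t *: x) = t * killing z x.
Proof. by rewrite killingC killingZl killingC. Qed.

Lemma killing0l z : killing 0 z = 0.
Proof. by rewrite -(scale0r (0 : L)) killingZl mul0r. Qed.

Lemma killing_suml I (s : seq I) P (F : I -> L) z :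
  killing (\sum_(i <- s | P i) F i) z = \sum_(i <- s | P i) killing (F i) z.
Proof.
elim/big_rec2: _ => [|i u v _ <-]; last by rewrite killingDl.
by rewrite killing0l.
Qed.

Lemma killing_inv x y z : killing [x, y] z = killing x [y, z].
Proof.
have tN (f : 'End(L)) : end_trace (- f) = - end_trace f.
  by rewrite -scaleN1r end_traceZ mulN1r.
have -> : killing [x, y] z = end_trace (lie_ad x \o (lie_ad y \o lie_ad z))%VF
    - end_trace (lie_ad y \o (lie_ad x \o lie_ad z))%VF.
  rewrite -tN -end_traceD; congr end_trace; apply/lfunP => v.
  by rewrite add_lfunE opp_lfunE !comp_lfunE !lie_adE // lie_br_br.
rewrite [X in _ - X]end_traceC -tN -end_traceD; congr end_trace.
apply/lfunP => v; rewrite add_lfunE opp_lfunE !comp_lfunE !lie_adE //.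
by rewrite lie_br_br // lie_brBr.
Qed.

End Killing.

(** * Root space decomposition of the split data *)

Section SplitStructure.
Variables (R : realType) (n : nat) (D : splitData R n).
Implicit Types (y z : D) (al be : 'rV[R]_n) (t : R).
Local Notation "[ x , y ]" := (lie_br x y) (at level 0).
Local Notation x_ j := ((sd_x D)`_j).
Local Notation e_ al := (sd_e D al).
Local Notation roots := (sd_roots D).
Local Notation rsp al := (root_space (sd_x D) al).
Let ss : is_semisimple D := @sd_semisimple R n D.

Lemma root_spaceP al z :
  reflect (forall j : 'I_n, [x_ j, z] = al 0 j *: z) (z \in rsp al).
Proof.
apply: (iffP idP) => [h j|h].
  have : z \in lker (lie_ad (x_ j) - al 0 j *: \1%VF).
    by apply: subvP h; apply/subv_bigcapP: j (erefl true); exact: subvv.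
  rewrite memv_ker add_lfunE opp_lfunE scale_lfunE id_lfunE lie_adE //.
  by rewrite subr_eq0 => /eqP.
suff: (<[z]> <= rsp al)%VS by rewrite -memvE.
apply/subv_bigcapP => j _; rewrite -memvE memv_ker add_lfunE opp_lfunE.
by rewrite scale_lfunE id_lfunE lie_adE // h subrr.
Qed.

Lemma mem_x (j : 'I_n) : x_ j \in sd_h0 D.
Proof.
by apply: (basis_mem (sd_x_basis D)); apply: mem_nth; rewrite size_tuple.
Qed.

Lemma h0_coord h : h \in sd_h0 D -> h = \sum_(j < n) coord (sd_x D) j h *: x_ j.
Proof. exact: (coord_basis (sd_x_basis D)). Qed.

Lemma mem_lie_prod (U W : {vspace D}) y z :
  y \in U -> z \in W -> [y, z] \in lie_prod U W.
Proof.
move=> /coord_vbasis-> /coord_vbasis->; set u := vbasis U; set w := vbasis W.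
rewrite lie_br_suml.
apply: rpred_sum => i _; rewrite lie_br_sumr //.
apply: rpred_sum => j _; rewrite lie_brZl lie_brZr // !rpredZ // memv_span //.
by apply/allpairsP; exists (u`_i, w`_j); split; rewrite // mem_nth ?size_tuple.
Qed.

(** On the Cartan subalgebra [ad h] is nilpotent because the subalgebra is, and diagonalizable
    because the subalgebra is split; hence it is zero there. *)
Lemma h0_abelian h h' : h \in sd_h0 D -> h' \in sd_h0 D -> [h, h'] = 0.
Proof.
move=> hh hh'; have [[_ [k kE] _] dg] := sd_h0P D.
have [b bb cb] := dg h hh.
have : iter k (lie_br h) h' = 0.
  apply/eqP; rewrite -memv0 -kE; elim: k {kE} => //= k IH.
  exact: mem_lie_prod.
have [c cE] := choice cb => {cb}.
have adE m v : iter m (lie_br h) v =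
    \sum_(i < \dim {:D}) (coord b i v * c i ^+ m) *: b`_i.
  elim: m => [|m IH] /=.
    rewrite {1}(coord_basis bb (memvf v)).
    by apply: eq_bigr => i _; rewrite expr0 mulr1.
  rewrite IH lie_br_sumr //.
  by apply: eq_bigr => i _; rewrite lie_brZr // cE scalerA exprSr mulrA.
rewrite adE => h0; rewrite -[LHS]/(iter 1 (lie_br h) h') adE.
have /freeP fb := basis_free bb.
apply: big1 => i _; have := fb _ h0 i.
by move/eqP; rewrite mulf_eq0 expf_eq0 => /orP[/eqP->|/andP[_ /eqP->]];
  rewrite ?mul0r ?mulr0 scale0r.
Qed.

(* Grouping an eigenbasis by eigenvalues splits any [ad h]-stable subspace:
   applying [f - c0] to the sum removes one eigenvalue at a time. *)
Lemma eigen_components (V : vectType R) (f : 'End(V)) (W : {vspace V})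
    (cs : seq R) (v : R -> V) : uniq cs ->
  (forall w, w \in W -> f w \in W) -> (forall c, f (v c) = c *: v c) ->
  \sum_(c <- cs) v c \in W -> forall c, c \in cs -> v c \in W.
Proof.
move=> + Wf; elim: cs v => [//|c0 cs IH] v /= /andP[c0cs ucs] fv.
rewrite big_cons => sW.
have tailW c : c \in cs -> v c \in W.
  move=> ccs; have c0c : c - c0 != 0.
    by rewrite subr_eq0; apply: contraNneq c0cs => <-.
  rewrite -[v c](scalerK c0c) rpredZ //.
  apply: (IH (fun c => (c - c0) *: v c)) ucs _ _ _ ccs => [d|].
    by rewrite linearZ /= fv !scalerA mulrC.
  have -> : \sum_(d <- cs) (d - c0) *: v d =
      f (v c0 + \sum_(d <- cs) v d) - c0 *: (v c0 + \sum_(d <- cs) v d).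
    rewrite linearD /= fv scalerDr opprD addrACA subrr add0r linear_sum /=.
    rewrite scaler_sumr -sumrB; apply: eq_bigr => d _.
    by rewrite fv scalerBl.
  by rewrite rpredB ?rpredZ // Wf.
move=> c; rewrite inE => /predU1P[->|/tailW//].
have -> : v c0 = v c0 + \sum_(d <- cs) v d - \sum_(d <- cs) v d by rewrite addrK.
by rewrite rpredB // big_seq rpred_sum.
Qed.

Lemma diagonalizable_split h (W : {vspace D}) : ad_diagonalizable h ->
  (forall w, w \in W -> [h, w] \in W) -> forall w, w \in W ->
  exists cs : seq R, exists2 v : R -> D,
    w = \sum_(c <- cs) v c & forall c, [h, v c] = c *: v c /\ (c \in cs -> v c \in W).
Proof.
move=> [b bb cb] Wh w wW; have [c cE] := choice cb => {cb}.
pose cs := undup [seq c i | i <- enum 'I_(\dim {:D})].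
pose v d := \sum_(i < \dim {:D} | c i == d) coord b i w *: b`_i.
have vE d : lie_ad h (v d) = d *: v d.
  rewrite linear_sum scaler_sumr; apply: eq_bigr => i /eqP <-.
  by rewrite linearZ /= lie_adE // cE !scalerA mulrC.
have wE : w = \sum_(d <- cs) v d.
  rewrite /v (exchange_big_dep xpredT) //= {1}(coord_basis bb (memvf w)).
  apply: eq_bigr => i _; rewrite big_mkcond (bigD1_seq (c i)) /= ?undup_uniq //.
    by rewrite eqxx big1 ?addr0 // => d; rewrite eq_sym => /negPf->.
  by rewrite mem_undup map_f // mem_enum.
exists cs; exists v => // d; rewrite -vE lie_adE //; split => // dcs.
apply: (@eigen_components _ (lie_ad h) W cs v) => //; rewrite ?undup_uniq -?wE //.
by move=> u uW; rewrite lie_adE // Wh.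
Qed.

(** Induction on the number of basis vectors already diagonalised: the joint eigenspace [W] of the
    first [k] is stable under the next one, which commutes with them. *)
Lemma joint_eigen_split (k : nat) (z : D) : (k <= n)%N ->
  exists s : seq D, z = \sum_(y <- s) y /\
    forall y, y \in s -> exists al : 'rV[R]_n,
      forall j : 'I_n, (j < k)%N -> [x_ j, y] = al 0 j *: y.
Proof.
elim: k z => [|k IH] z lt_k.
  by exists [:: z]; rewrite big_seq1; split=> // y _; exists 0.
have [s [-> hs]] := IH z (ltnW lt_k).
elim: s hs => [|y s IHs] hs; first by exists [::]; rewrite big_nil.
have [s' [sE hs']] : exists s' : seq D, \sum_(y <- s) y = \sum_(y <- s') y /\
    forall y, y \in s' -> exists al : 'rV[R]_n,
      forall j : 'I_n, (j < k.+1)%N -> [x_ j, y] = al 0 j *: y.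
  by apply: IHs => u us; apply: hs; rewrite inE us orbT.
have [al alE] := hs y (mem_head _ _).
pose W := (\bigcap_(j < n | (j < k)%N) lker (lie_ad (x_ j) - (al 0 j)%R *: \1%VF))%VS.
have WP w : reflect (forall j : 'I_n, (j < k)%N -> [x_ j, w] = al 0 j *: w) (w \in W).
  apply: (iffP idP) => [wW j ltj|hw].
    have : w \in lker (lie_ad (x_ j) - al 0 j *: \1%VF).
      by apply: subvP wW; apply: (bigcapv_inf j).
    rewrite memv_ker add_lfunE opp_lfunE scale_lfunE id_lfunE lie_adE //.
    by rewrite subr_eq0 => /eqP.
  suff: (<[w]> <= W)%VS by rewrite -memvE.
  apply/subv_bigcapP => j ltj; rewrite -memvE memv_ker add_lfunE opp_lfunE.
  by rewrite scale_lfunE id_lfunE lie_adE // hw // subrr.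
pose jk := Ordinal lt_k.
have dg : ad_diagonalizable (x_ jk) by case: (sd_h0P D) => _; apply; exact: mem_x.
have stW w : w \in W -> [x_ jk, w] \in W.
  move=> /WP hw; apply/WP => j ltj.
  have := lie_br_br ss (x_ j) (x_ jk) w.
  rewrite (h0_abelian (mem_x j) (mem_x jk)) lie_br0l (hw j ltj) lie_brZr // => /esym/eqP.
  by rewrite subr_eq0 => /eqP.
have [cs [v yE hv]] := diagonalizable_split dg stW (introT (WP y) alE).
exists ([seq v c | c <- cs] ++ s'); rewrite big_cons sE big_cat /= big_map -yE.
split=> // u; rewrite mem_cat => /orP[/mapP[c ccs ->]|/hs'//].
have [hc /(_ ccs)/WP hW] := hv c.
exists (\row_j (if j == jk then c else al 0 j)) => j; rewrite mxE ltnS leq_eqVlt.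
case: (eqVneq j jk) => [-> //|nj /predU1P[E|/hW//]].
by case/eqP: nj; apply: val_inj.
Qed.

Lemma joint_eigen_sum (z : D) : exists s : seq D, z = \sum_(y <- s) y /\
  forall y, y \in s -> exists al : 'rV[R]_n, y \in rsp al.
Proof.
have [s [zE hs]] := joint_eigen_split z (leqnn n); exists s; split=> // y ys.
by have [al h] := hs y ys; exists al; apply/root_spaceP => j; exact: h.
Qed.

(** Elements of weight zero normalise the Cartan subalgebra, which is its own normaliser. *)
Lemma root_space0 z : (z \in rsp 0) = (z \in sd_h0 D).
Proof.
apply/root_spaceP/idP => [h|hz j]; last by rewrite mxE scale0r h0_abelian ?mem_x.
have [[_ _ self] _] := sd_h0P D; apply: self => y yh.
rewrite lie_br_antisym // memvN (h0_coord yh) lie_br_suml rpred_sum // => j _.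
by rewrite lie_brZl h mxE scale0r scaler0 mem0v.
Qed.

Lemma mem_root al z : z \in rsp al -> z != 0 -> (al == 0) || (al \in roots).
Proof.
move=> zal z0; case: eqVneq => //= al0; rewrite sd_rootsP al0 /=.
by apply: contraNneq z0 => E; move: zal; rewrite E memv0.
Qed.

Lemma lie_root_space al be y z :
  y \in rsp al -> z \in rsp be -> [y, z] \in rsp (al + be).
Proof.
move=> /root_spaceP hy /root_spaceP hz; apply/root_spaceP => j.
have := lie_br_br ss (x_ j) y z; rewrite hy hz lie_brZl lie_brZr // => h.
by rewrite mxE scalerDl h; zmod.
Qed.

Lemma killing_root_orth al be y z :
  y \in rsp al -> z \in rsp be -> al + be != 0 -> killing y z = 0.
Proof.
move=> /root_spaceP hy /root_spaceP hz ne.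
have [j nj] := rV0Pn _ ne.
have : killing [y, x_ j] z = killing y [x_ j, z] by exact: killing_inv.
rewrite lie_br_antisym // hy hz -scaleNr killingZl // killingZr // => /eqP.
rewrite -subr_eq0 -mulrBl mulf_eq0 -opprD oppr_eq0 => /orP[|/eqP//].
by move: nj; rewrite mxE => /negPf->.
Qed.

Lemma killing_x (i j : 'I_n) : killing (x_ i) (x_ j) = (i == j)%:R.
Proof. exact: sd_x_orthonormal. Qed.

Lemma h0_killing h : h \in sd_h0 D -> h = \sum_(j < n) killing h (x_ j) *: x_ j.
Proof.
move=> /h0_coord E; rewrite {1}E; apply: eq_bigr => j _; congr (_ *: _).
rewrite {2}E killing_suml // (bigD1 j) //= killingZl // killing_x eqxx mulr1.
by rewrite big1 ?addr0 // => i ij; rewrite killingZl // killing_x (negPf ij) mulr0.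
Qed.

Lemma root_neq0 al : al \in roots -> al != 0.
Proof. by rewrite sd_rootsP => /andP[]. Qed.

Lemma theta_root_space al z : z \in rsp al -> sd_theta D z \in rsp (- al).
Proof.
move=> /root_spaceP h; apply/root_spaceP => j.
have [tbr tK _] := sd_thetaP D.
have : sd_theta D [x_ j, z] = al 0 j *: sd_theta D z by rewrite h linearZ.
rewrite tbr sd_theta_h0 ?mem_x // lie_brNl mxE scaleNr => <-.
by rewrite opprK.
Qed.

Lemma root_opp al : al \in roots -> - al \in roots.
Proof.
rewrite !sd_rootsP oppr_eq0 => /andP[-> /= h].
apply: contraNneq h => E; apply/eqP/vspaceP => z; rewrite memv0.
apply/idP/eqP => [/theta_root_space|->]; last exact: mem0v.
rewrite E memv0 => /eqP tz; have [_ tK _] := sd_thetaP D.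
by rewrite -(tK z) tz linear0.
Qed.

Lemma mem_e al : al \in roots -> e_ al \in rsp al. Proof. exact: sd_e_root. Qed.

Lemma killing_t_vec al (j : 'I_n) : killing (t_vec (sd_x D) al) (x_ j) = al 0 j.
Proof.
rewrite killing_suml // (bigD1 j) //= killingZl // killing_x eqxx mulr1.
by rewrite big1 ?addr0 // => i ij; rewrite killingZl // killing_x (negPf ij) mulr0.
Qed.

(* [[z, y]] lies in [h0], where it is determined by its Killing products. *)
Lemma lie_opp_root_spaces al z y : z \in rsp al -> y \in rsp (- al) ->
  [z, y] = killing z y *: t_vec (sd_x D) al.
Proof.
move=> zal yal; have := lie_root_space zal yal; rewrite subrr root_space0.
move=> /h0_killing->; rewrite /t_vec scaler_sumr; apply: eq_bigr => j _.
rewrite killing_inv // lie_br_antisym // (root_spaceP _ _ yal) mxE -scaleNr opprK.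
by rewrite killingZr // scalerA mulrC.
Qed.

Lemma killing_e al : al \in roots -> killing (e_ al) (e_ (- al)) = 1.
Proof.
move=> ral; have := lie_opp_root_spaces (mem_e ral) (mem_e (root_opp ral)).
rewrite sd_e_br // => h; have [j nj] := rV0Pn _ (root_neq0 ral).
have := killing_t_vec al j; rewrite h killingZl // killing_t_vec => /eqP.
by rewrite -subr_eq0 -{2}[al 0 j]mul1r -mulrBl mulf_eq0 (negPf nj) orbF subr_eq0 => /eqP.
Qed.

Lemma br_t_vec al be z : z \in rsp be ->
  [t_vec (sd_x D) al, z] = dotw al be *: z.
Proof.
move=> /root_spaceP h; rewrite lie_br_suml scaler_suml.
by apply: eq_bigr => j _; rewrite lie_brZl h scalerA.
Qed.

Lemma dotw_gt0 al : al != 0 -> 0 < dotw al al.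
Proof.
move=> al0; rewrite lt_neqAle sumr_ge0 ?andbT; last by move=> j _; rewrite -expr2 sqr_ge0.
apply: contraNneq al0 => /esym/eqP; rewrite psumr_eq0; last first.
  by move=> j _; rewrite -expr2 sqr_ge0.
move=> /allP h; apply/eqP/rowP => j; have := h j (mem_index_enum _).
by rewrite /= -expr2 sqrf_eq0 mxE => /eqP.
Qed.

(* If [z] is orthogonal to [e_(- al)] then [ad e_(- al)] kills it, and the
   [sl_2]-computation shows that no [(ad e_al)^m z] vanishes unless [z = 0];
   but there are only finitely many roots. *)
Lemma root_space_dim1 al z : al \in roots -> z \in rsp al ->
  z = killing z (e_ (- al)) *: e_ al.
Proof.
move=> ral zal; apply/eqP; rewrite -subr_eq0; apply/eqP.
set w := z - _; have wal : w \in rsp al.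
  by rewrite rpredB ?rpredZ ?mem_e.
have wk : killing w (e_ (- al)) = 0.
  by rewrite /w killingDl // -scaleNr killingZl // killing_e // mulr1 subrr.
apply: contraTeq isT => w0; exfalso.
pose u m := iter m (lie_br (e_ al)) w.
have uS m : u m \in rsp (al *+ m.+1).
  by elim: m => [|m IH]; rewrite ?mulr1n // mulrS lie_root_space ?mem_e.
(* Up to sign, the scalar by which [ad e_(- al)] takes [u m] back to the previous vector; every
   summand is a positive multiple of [dotw al al], so it never vanishes for positive [m]. *)
pose cc m : R := \sum_(i < m) dotw al (al *+ i.+1).
have lower m : [e_ (- al), u m.+1] = - cc m.+1 *: u m.
  elim: m => [|m IH].
    have h := lie_br_br ss (e_ (- al)) (e_ al) w.
    have e0 : [e_ (- al), w] = 0.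
      by rewrite lie_br_antisym // (lie_opp_root_spaces wal) ?mem_e ?root_opp // wk scale0r oppr0.
    move: h; rewrite e0 lie_br0r // subr0 /= => <-.
    rewrite (lie_br_antisym ss (e_ (- al))) sd_e_br // lie_brNl (br_t_vec _ wal).
    by rewrite /cc big_ord1 mulr1n scaleNr.
  have h := lie_br_br ss (e_ (- al)) (e_ al) (u m.+1).
  have -> : [e_ (- al), u m.+2] = [[e_ (- al), e_ al], u m.+1] + [e_ al, [e_ (- al), u m.+1]].
    by rewrite h subrK.
  rewrite IH lie_brZr // -[X in _ + _ *: X]/(u m.+1).
  rewrite (lie_br_antisym ss (e_ (- al))) sd_e_br // lie_brNl (br_t_vec _ (uS m.+1)).
  rewrite -scaleNr -scalerDl; congr (_ *: _).
  by rewrite [in RHS]/cc big_ord_recr /= opprD addrC.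
have dM (k : nat) : dotw al (al *+ k) = dotw al al *+ k.
  by rewrite /dotw -sumrMnl; apply: eq_bigr => j _; rewrite mulmxnE mulrnAr.
have un0 m : u m != 0.
  elim: m => // m IH; apply/negP => /eqP E; have := lower m; rewrite E lie_br0r.
  move/esym/eqP; rewrite scaler_eq0 (negPf IH) orbF oppr_eq0 => /eqP h.
  suff: 0 < cc m.+1 by rewrite h ltxx.
  rewrite /cc big_ord_recl ltr_pwDl //.
    by rewrite mulr1n dotw_gt0 // root_neq0.
  apply: sumr_ge0 => i _; rewrite dM mulrn_wge0 // ltW // dotw_gt0 //.
  exact: root_neq0.
have rm m : al *+ m.+1 \in roots.
  have := mem_root (uS m) (un0 m); rewrite -scaler_nat scaler_eq0 pnatr_eq0 /=.
  by rewrite (negPf (root_neq0 ral)).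
have : (size [seq (al *+ m.+1)%R | m <- iota 0 (size roots).+1] <= size roots)%N.
  apply: uniq_leq_size; last by move=> be /mapP[m _ ->].
  rewrite map_inj_uniq ?iota_uniq // => m m'.
  rewrite -(scaler_nat m.+1 al) -(scaler_nat m'.+1 al) => /eqP.
  rewrite -subr_eq0 -scalerBl scaler_eq0 (negPf (root_neq0 ral)) orbF.
  by rewrite subr_eq0 eqr_nat => /eqP[].
by rewrite size_map size_iota ltnn.
Qed.

Lemma split_decomp z : z = \sum_(j < n) killing z (x_ j) *: x_ j
   + \sum_(al <- roots) killing z (e_ (- al)) *: e_ al.
Proof.
have [s [-> hs]] := joint_eigen_sum z.
rewrite big_seq.
elim/big_rec: _ => [|y w ys IH].
  by rewrite !big1 ?addr0 // => *; rewrite killing0l // scale0r.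
rewrite {1}IH; under [X in _ = X + _]eq_bigr do rewrite killingDl // scalerDl.
under [X in _ = _ + X]eq_bigr do rewrite killingDl // scalerDl.
rewrite !big_split /= [RHS]addrACA; congr (_ + _).
have [al yal] := hs y ys; case: (eqVneq y 0) => [->|y0].
  by rewrite !big1 ?addr0 // => *; rewrite killing0l // scale0r.
case: (eqVneq al 0) (mem_root yal y0) => [al0 _|al0 /= ral].
  have yh : y \in sd_h0 D by rewrite -root_space0 -al0.
  rewrite -h0_killing // big1_seq ?addr0 // => be /= rbe.
  rewrite (killing_root_orth yal (mem_e (root_opp rbe))) ?scale0r //.
  by rewrite al0 add0r oppr_eq0 root_neq0.
rewrite (bigD1_seq al) ?sd_roots_uniq //= -root_space_dim1 //.
rewrite !big1_seq ?addr0 ?add0r //.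
  move=> be /andP[bal rbe].
  rewrite (killing_root_orth yal (mem_e (root_opp rbe))) ?scale0r //.
  by rewrite subr_eq0 eq_sym.
move=> j _; rewrite (@killing_root_orth al 0 y) ?scale0r ?addr0 //.
by rewrite root_space0 mem_x.
Qed.

End SplitStructure.

(** * Verma modules *)

Section Complexified.
Variables (R : realType) (n : nat) (D : splitData R n).
Local Notation C := R[i].
Local Notation g := (cplx D).
Let ss : is_semisimple D := @sd_semisimple R n D.
Implicit Types (x y : D) (z w u : g).

Lemma cinjD x y : cinj (x + y) = cinj x + cinj y :> g.
Proof. by rewrite /cinj; congr (_, _); rewrite /= addr0. Qed.

Lemma cinjZ (t : R) x : cinj (t *: x) = t%:C%C *: (cinj x : g).
Proof.
by congr (_, _); rewrite /= ?scale0r ?scaler0 ?subr0 ?addr0.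
Qed.

Lemma cinjN x : cinj (- x) = - cinj x :> g.
Proof. by rewrite -scaleN1r cinjZ rmorphN1 scaleN1r. Qed.

Lemma cinjB x y : cinj (x - y) = cinj x - cinj y :> g.
Proof. by rewrite cinjD cinjN. Qed.

Lemma cinj_sum I (s : seq I) P (F : I -> D) :
  cinj (\sum_(i <- s | P i) F i) = \sum_(i <- s | P i) cinj (F i) :> g.
Proof. by elim/big_rec2: _ => [//|i a b _ <-]; rewrite cinjD. Qed.

Lemma cplxE z : z = cinj z.1 + 'i%C *: cinj z.2.
Proof.
case: z => x y; congr (_, _); rewrite /= ?scale0r ?scaler0 ?scale1r.
  by rewrite subr0 addr0.
by rewrite !add0r.
Qed.

Lemma cbr_cinj x y : cbr (cinj x) (cinj y) = cinj (lie_br x y) :> g.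
Proof. by rewrite /cbr /= !lie_br0l !lie_br0r subr0 addr0. Qed.

End Complexified.

Section VermaAction.
Variables (R : realType) (n : nat) (D : splitData R n).
Local Notation C := R[i].
Local Notation g := (cplx D).
Local Notation roots := (sd_roots D).
Local Notation x_ j := (cinj (sd_x D)`_j : g).
Local Notation e_ al := (cinj (sd_e D al) : g).
Variable lam : 'rV[C]_n.
Local Notation M := (verma D lam).
Local Notation cls := (@verma_class R n D lam).
Implicit Types (z w : g) (m : M) (c : C).
Let ss : is_semisimple D := @sd_semisimple R n D.

Lemma lpi_is_linear : linear (lpi (@verma_rel R n D lam)).
Proof. by move=> c u v; rewrite lpiD lpiZ. Qed.

HB.instance Definition _ := GRing.isLinear.Build C _ _ *:%R
  (lpi (@verma_rel R n D lam)) lpi_is_linear.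

Lemma verma_ind (Q : M -> Prop) : Q 0 ->
  (forall c (s : seq g) m, Q m -> Q (c *: cls s + m)) -> forall m, Q m.
Proof.
move=> Q0 QS m; rewrite -(lrepK m) -[lrep m]freeg_sumE linear_sum.
elim: (dom _) => [|w s IH]; first by rewrite big_nil.
rewrite big_cons; move: (coeff _ _) => c.
rewrite -[c]mulr1 -wordsZ linearZ; exact: QS.
Qed.

Lemma verma_act_is_linear z : linear (@verma_act R n D lam z).
Proof.
move=> c m m'; rewrite -(lrepK m) -(lrepK m') -linearP !verma_actE -linearP.
by rewrite wconsD wconsZ.
Qed.

HB.instance Definition _ z := GRing.isLinear.Build C M M *:%R
  (@verma_act R n D lam z) (verma_act_is_linear z).

Lemma lpi_eq (a b : {freeg (seq g) / C}) :
  verma_rel lam (a - b) -> lpi (verma_rel lam) a = lpi (verma_rel lam) b.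
Proof. by move=> h; apply/eqP/lpiP; apply: in_span_gen. Qed.

Lemma verma_act_linearl c z w m :
  verma_act (c *: z + w) m = c *: verma_act z m + verma_act w m.
Proof.
elim/verma_ind: m => [|d u m IH]; first by rewrite !linear0 ?scaler0 addr0.
rewrite !linearP /= !verma_act_word IH.
have -> : cls ((c *: z + w) :: u) = c *: cls (z :: u) + cls (w :: u).
  rewrite /verma_class -linearP; apply: lpi_eq.
  exact: (verma_linear lam [::]).
by rewrite !scalerDr !scalerA [d * c]mulrC; zmod.
Qed.

Lemma verma_act0l m : verma_act 0 m = 0.
Proof.
have := verma_act_linearl 1 0 0 m; rewrite !scale1r addr0.
by rewrite -[LHS]addr0 => /addrI <-.
Qed.

Lemma verma_actDl z w m : verma_act (z + w) m = verma_act z m + verma_act w m.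
Proof. by rewrite -[z in LHS]scale1r verma_act_linearl scale1r. Qed.

Lemma verma_actZl c z m : verma_act (c *: z) m = c *: verma_act z m.
Proof. by rewrite -[c *: z]addr0 verma_act_linearl verma_act0l addr0. Qed.

Lemma verma_actNl z m : verma_act (- z) m = - verma_act z m.
Proof. by rewrite -[- z]scaleN1r verma_actZl scaleN1r. Qed.

Lemma verma_actBl z w m : verma_act (z - w) m = verma_act z m - verma_act w m.
Proof. by rewrite verma_actDl verma_actNl. Qed.

Lemma verma_act_suml I (s : seq I) P (F : I -> g) m :
  verma_act (\sum_(i <- s | P i) F i) m = \sum_(i <- s | P i) verma_act (F i) m.
Proof.
by elim/big_rec2: _ => [|i a b _ <-]; rewrite ?verma_act0l // verma_actDl.
Qed.

Lemma verma_act_br z w m :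
  verma_act (cbr z w) m = verma_act z (verma_act w m) - verma_act w (verma_act z m).
Proof.
elim/verma_ind: m => [|d u m IH]; first by rewrite !linear0 ?subr0 ?addr0.
rewrite !linearP /= !verma_act_word IH.
have -> : cls (cbr z w :: u) = cls [:: z, w & u] - cls [:: w, z & u].
  rewrite /verma_class -linearB; apply/esym; apply: lpi_eq.
  exact: (verma_bracket lam [::]).
by rewrite scalerBr scalerN; zmod.
Qed.

Lemma verma_act_swap z w m :
  verma_act z (verma_act w m) = verma_act w (verma_act z m) + verma_act (cbr z w) m.
Proof. by rewrite verma_act_br addrC subrK. Qed.

Lemma verma_cls0 (h : g) : in_h D h -> verma_act h (cls [::]) = evw lam h *: cls [::].
Proof.
move=> hh; rewrite verma_act_word /verma_class -linearZ; apply: lpi_eq.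
exact: (verma_cartan lam [::] hh).
Qed.

Lemma verma_cls_pos al : al \in roots -> positive D al ->
  verma_act (e_ al) (cls [::]) = 0.
Proof.
move=> ral pal; rewrite verma_act_word /verma_class.
transitivity (lpi (@verma_rel R n D lam) 0); last exact: linear0.
apply: lpi_eq; rewrite subr0.
apply: (verma_nilp lam [::] ral pal); split; rewrite ?mem0v //=.
exact: mem_e.
Qed.

Lemma verma_cls_ind (Q : M -> Prop) : Q 0 -> Q (cls [::]) ->
  (forall c m m', Q m -> Q m' -> Q (c *: m + m')) ->
  (forall z m, Q m -> Q (verma_act z m)) -> forall m, Q m.
Proof.
move=> Q0 Q1 QS Qact; apply: verma_ind => // c s m; apply: QS.
by elim: s => // z s IH; rewrite -verma_act_word; apply: Qact.
Qed.

End VermaAction.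

(** * Positive roots and weights *)

Section Roots.
Variables (R : realType) (n : nat) (D : splitData R n).
Local Notation C := R[i].
Local Notation roots := (sd_roots D).
Local Notation ws := (wsum (sd_simple D)).
Implicit Types (al be : 'rV[R]_n) (k l : expo n).

Definition eadd k l : expo n := [ffun i => (k i + l i)%N].
Definition edeg k : nat := (\sum_i k i)%N.

Lemma wsumD k l : ws (eadd k l) = ws k + ws l.
Proof. by rewrite /wsum -big_split; apply: eq_bigr => i _; rewrite ffunE mulrnDr. Qed.

Lemma edegD k l : edeg (eadd k l) = (edeg k + edeg l)%N.
Proof. by rewrite /edeg -big_split; apply: eq_bigr => i _; rewrite ffunE. Qed.

Lemma wsum_inj : injective ws.
Proof.
move=> k l; rewrite /wsum => h; apply/ffunP => i.
have /freeP fr := basis_free (sd_simple_basis D).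
have /fr/(_ i)/eqP : \sum_(i < n) ((k i)%:R - (l i)%:R) *: (sd_simple D)`_i = 0.
  under eq_bigr do rewrite scalerBl !scaler_nat.
  by rewrite sumrB h subrr.
by rewrite subr_eq0 eqr_nat => /eqP.
Qed.

Lemma wsum0 : ws [ffun=> 0%N] = 0.
Proof. by apply: big1 => i _; rewrite ffunE mulr0n. Qed.

Lemma wsum_eq0 k : ws k = 0 -> k = [ffun=> 0%N].
Proof. by rewrite -wsum0 => /wsum_inj. Qed.

Lemma positiveP al : reflect (exists k, al = ws k) (positive D al).
Proof. exact: asboolP. Qed.

Lemma positiveN al : al \in roots -> positive D (- al) = ~~ positive D al.
Proof.
move=> ral; apply/positiveP/negP => [[k kE] /positiveP[l lE]|h].
  have /wsum_eq0 E : ws (eadd k l) = 0 by rewrite wsumD -kE -lE addNr.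
  have l0 : l = [ffun=> 0%N].
    apply/ffunP => i; have := congr1 (fun f : expo n => f i) E.
    by rewrite !ffunE => /eqP; rewrite addn_eq0 => /andP[_ /eqP].
  by move: (root_neq0 ral); rewrite lE l0 wsum0 eqxx.
have [k [kE|kE]] := sd_simpleP ral; last by exists k; rewrite kE opprK.
by case: h; apply/positiveP; exists k.
Qed.

Lemma sum_roots_opp (V : zmodType) (F : 'rV[R]_n -> V) :
  \sum_(al <- roots) F al = \sum_(al <- roots) F (- al).
Proof.
rewrite -[RHS](big_map (@GRing.opp _) xpredT F); apply: perm_big.
apply: uniq_perm; first exact: sd_roots_uniq.
  by rewrite map_inj_uniq ?sd_roots_uniq //; exact: oppr_inj.
move=> al; apply/idP/mapP => [ral|[be rbe ->]]; last exact: root_opp.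
by exists (- al); rewrite ?opprK ?root_opp.
Qed.

Lemma sum_roots_pos (V : zmodType) (F : 'rV[R]_n -> V) :
  \sum_(al <- roots) F al = \sum_(al <- roots | positive D al) (F al + F (- al)).
Proof.
rewrite (bigID (positive D)) big_split /=; congr (_ + _).
rewrite big_mkcond sum_roots_opp -big_mkcond /= [LHS]big_seq_cond [RHS]big_seq_cond.
apply: eq_bigl => al; case ral : (al \in roots) => //=.
by rewrite positiveN // negbK.
Qed.

Lemma toCD al be : toC (al + be) = toC al + toC be. Proof. exact: map_mxD. Qed.
Lemma toCN al : toC (- al) = - toC al. Proof. exact: map_mxN. Qed.
Lemma toC0 : toC (0 : 'rV[R]_n) = 0. Proof. exact: map_mx0. Qed.
Lemma toCMn al m : toC (al *+ m) = toC al *+ m.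
Proof. by elim: m => [|m IH]; rewrite ?mulr0n ?toC0 // !mulrS toCD IH. Qed.
Lemma toCE al j : toC al 0 j = (al 0 j)%:C%C. Proof. exact: mxE. Qed.

Lemma toC_inj : injective (@toC R n).
Proof.
move=> al be /rowP h; apply/rowP => j; have := h j; rewrite !toCE.
exact: (fmorph_inj (real_complex R)).
Qed.

Lemma dotwC (K : comNzRingType) (a b : 'rV[K]_n) : dotw a b = dotw b a.
Proof. by apply: eq_bigr => j _; rewrite mulrC. Qed.

Lemma dotwDl (K : comNzRingType) (a b c : 'rV[K]_n) :
  dotw (a + b) c = dotw a c + dotw b c.
Proof. by rewrite -big_split; apply: eq_bigr => j _; rewrite mxE mulrDl. Qed.

Lemma dotwZl (K : comNzRingType) t (a c : 'rV[K]_n) :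
  dotw (t *: a) c = t * dotw a c.
Proof. by rewrite /dotw mulr_sumr; apply: eq_bigr => j _; rewrite mxE mulrA. Qed.

Lemma dotwNl (K : comNzRingType) (a c : 'rV[K]_n) : dotw (- a) c = - dotw a c.
Proof. by rewrite -scaleN1r dotwZl mulN1r. Qed.

Lemma dotwBl (K : comNzRingType) (a b c : 'rV[K]_n) :
  dotw (a - b) c = dotw a c - dotw b c.
Proof. by rewrite dotwDl dotwNl. Qed.

Lemma dotwDr (K : comNzRingType) (a b c : 'rV[K]_n) :
  dotw c (a + b) = dotw c a + dotw c b.
Proof. by rewrite dotwC dotwDl !(dotwC c). Qed.

Lemma dotwZr (K : comNzRingType) t (a c : 'rV[K]_n) :
  dotw c (t *: a) = t * dotw c a.
Proof. by rewrite dotwC dotwZl dotwC. Qed.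

Lemma dotwNr (K : comNzRingType) (a c : 'rV[K]_n) : dotw c (- a) = - dotw c a.
Proof. by rewrite dotwC dotwNl dotwC. Qed.

Lemma dotwBr (K : comNzRingType) (a b c : 'rV[K]_n) :
  dotw c (a - b) = dotw c a - dotw c b.
Proof. by rewrite dotwDr dotwNr. Qed.

Lemma dotw_sumr (K : comNzRingType) I (s : seq I) P (F : I -> 'rV[K]_n) c :
  dotw c (\sum_(i <- s | P i) F i) = \sum_(i <- s | P i) dotw c (F i).
Proof.
elim/big_rec2: _ => [|i u v _ <-]; last by rewrite dotwDr.
by rewrite /dotw big1 // => j _; rewrite mxE mulr0.
Qed.

Lemma toC_rho : toC (rho D) *+ 2 = \sum_(al <- roots | positive D al) toC al.
Proof.
rewrite -toCMn /rho -scaler_nat scalerA divff ?pnatr_eq0 // scale1r.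
by rewrite (big_morph _ toCD toC0).
Qed.

End Roots.

(** * The Casimir element *)

Section Casimir.
Variables (R : realType) (n : nat) (D : splitData R n).
Local Notation C := R[i].
Local Notation g := (cplx D).
Local Notation roots := (sd_roots D).
Local Notation x_ j := (cinj (sd_x D)`_j : g).
Local Notation e_ al := (cinj (sd_e D al) : g).
Variable lam : 'rV[C]_n.
Local Notation M := (verma D lam).
Local Notation v0 := (@verma_class R n D lam [::]).
Local Notation act := (@verma_act R n D lam).
Let ss : is_semisimple D := @sd_semisimple R n D.

Definition casimir (m : M) : M :=
  \sum_(j < n) act (x_ j) (act (x_ j) m)
  + \sum_(al <- roots) act (e_ (- al)) (act (e_ al) m).

Lemma casimir_is_linear : linear casimir.
Proof.
move=> c m m'; rewrite /casimir scalerDr !scaler_sumr addrACA -!big_split /=.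
by congr (_ + _); apply: eq_bigr => i _; rewrite !verma_act_is_linear.
Qed.

HB.instance Definition _ := GRing.isLinear.Build C M M *:%R casimir
  casimir_is_linear.

(** Dual bases for the Killing form, in a single list, so that the Cartan part and the roots are
    treated together when commuting with [ad y]. *)
Let dual_pairs : seq (D * D) :=
  [seq ((sd_x D)`_j, (sd_x D)`_j) | j : 'I_n <- index_enum 'I_n]
  ++ [seq (sd_e D (- al), sd_e D al) | al <- roots].

Let casimirE m : casimir m =
  \sum_(p <- dual_pairs) act (cinj p.1) (act (cinj p.2) m).
Proof. by rewrite big_cat /= !big_map. Qed.

Let dual_pairs1 (u : D) : u = \sum_(p <- dual_pairs) killing u p.1 *: p.2.
Proof. by rewrite big_cat /= !big_map /= -split_decomp. Qed.

Let dual_pairs2 (u : D) : u = \sum_(p <- dual_pairs) killing u p.2 *: p.1.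
Proof.
rewrite big_cat /= !big_map /= (sum_roots_opp D).
by under [X in _ + X]eq_bigr do rewrite opprK; rewrite -split_decomp.
Qed.

(* The actions of [ad y] on the two tensor factors of the dual bases cancel
   by invariance of the Killing form. *)
Lemma casimir_comm_real (y : D) (m : M) :
  act (cinj y) (casimir m) = casimir (act (cinj y) m).
Proof.
pose T (u v : D) := act (cinj u) (act (cinj v) m).
have TsZl (F : D * D -> R) v (f : D * D -> D) :
    T (\sum_(p <- dual_pairs) F p *: f p) v = \sum_(p <- dual_pairs) (F p)%:C%C *: T (f p) v.
  by rewrite /T cinj_sum verma_act_suml; apply: eq_bigr => p _; rewrite cinjZ verma_actZl.
have TsZr (F : D * D -> R) v (f : D * D -> D) :
    T v (\sum_(p <- dual_pairs) F p *: f p) = \sum_(p <- dual_pairs) (F p)%:C%C *: T v (f p).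
  rewrite /T cinj_sum verma_act_suml linear_sum; apply: eq_bigr => p _.
  by rewrite cinjZ verma_actZl linearZ.
have E (p : D * D) : act (cinj y) (act (cinj p.1) (act (cinj p.2) m)) =
    act (cinj p.1) (act (cinj p.2) (act (cinj y) m))
    + (T (lie_br y p.1) p.2 + T p.1 (lie_br y p.2)).
  rewrite verma_act_swap cbr_cinj [act (cinj y) (act (cinj p.2) m)]verma_act_swap.
  by rewrite cbr_cinj linearD /T /=; zmod.
rewrite !casimirE linear_sum (eq_bigr _ (fun p _ => E p)) big_split /=.
rewrite -[RHS]addr0; congr (_ + _); rewrite big_split /=.
rewrite (eq_bigr (fun p => \sum_(q <- dual_pairs)
   (killing (lie_br y p.1) q.2)%:C%C *: T q.1 p.2)); last first.
  by move=> p _; rewrite {1}(dual_pairs2 (lie_br y p.1)) TsZl.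
rewrite [X in _ + X](eq_bigr (fun p => \sum_(q <- dual_pairs)
   (killing (lie_br y p.2) q.1)%:C%C *: T p.1 q.2)); last first.
  by move=> p _; rewrite {1}(dual_pairs1 (lie_br y p.2)) TsZr.
rewrite [X in _ + X]exchange_big -big_split /= big1 // => p _.
rewrite -big_split big1 //= => q _; rewrite -scalerDl -rmorphD /=.
rewrite (_ : killing _ _ + _ = 0) ?scale0r //.
rewrite (lie_br_antisym ss y q.2) -scaleN1r killingZl // killing_inv // killingC.
by rewrite mulN1r subrr.
Qed.

Lemma casimir_comm (z : g) (m : M) : act z (casimir m) = casimir (act z m).
Proof.
rewrite [z in LHS]cplxE [z in RHS]cplxE !verma_actDl !verma_actZl.
by rewrite !casimir_comm_real addrC -casimir_is_linear addrC.
Qed.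

Lemma evw_x (mu : 'rV[C]_n) (j : 'I_n) : evw mu (x_ j) = mu 0 j.
Proof.
rewrite /evw (bigD1 j) //= linear0.
rewrite (coord_free _ _ (basis_free (sd_x_basis D))) eqxx.
rewrite big1 ?addr0; first by rewrite [X in X * _](_ : _ = 1) ?mul1r.
move=> i ij; rewrite linear0 (coord_free _ _ (basis_free (sd_x_basis D))).
by rewrite eq_sym (negPf ij) /= [X in X * _](_ : _ = 0) ?mul0r.
Qed.

Lemma verma_x_v0 (j : 'I_n) : act (x_ j) v0 = lam 0 j *: v0.
Proof.
by rewrite verma_cls0 ?evw_x //; split; rewrite /= ?mem_x ?mem0v.
Qed.

Lemma act_t_vec (al : 'rV[R]_n) m :
  act (cinj (t_vec (sd_x D) al)) m = \sum_(j < n) toC al 0 j *: act (x_ j) m.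
Proof.
rewrite cinj_sum verma_act_suml; apply: eq_bigr => j _.
by rewrite cinjZ verma_actZl toCE.
Qed.

(** The Casimir element commutes with the action and the highest weight vector generates, so one
    value decides. There a positive root contributes [e_al e_(- al) v0 = t_al v0], and these
    contributions add up to the [rho] term. *)
Lemma casimir_verma m :
  casimir m = (dotw lam lam + 2%:R * dotw lam (toC (rho D))) *: m.
Proof.
elim/verma_cls_ind: m => [||c m m' IH IH'|z m IH].
- by rewrite (linear0 casimir) scaler0.
- rewrite /casimir scalerDl; congr (_ + _).
    rewrite scaler_suml; apply: eq_bigr => j _.
    by rewrite verma_x_v0 linearZ /= verma_x_v0 scalerA.
  rewrite (sum_roots_pos D) mulr_natl mulr2n -dotwDr -mulr2n toC_rho dotw_sumr.
  rewrite scaler_suml big_seq_cond [RHS]big_seq_cond.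
  apply: eq_bigr => al /andP[ral pal]; rewrite verma_cls_pos // linear0 add0r opprK.
  rewrite verma_act_swap verma_cls_pos // linear0 add0r cbr_cinj sd_e_br //.
  rewrite act_t_vec /dotw scaler_suml; apply: eq_bigr => j _.
  by rewrite verma_x_v0 scalerA mulrC.
- by rewrite casimir_is_linear IH IH' scalerDr !scalerA [_ * c]mulrC.
- by rewrite -casimir_comm IH linearZ.
Qed.

End Casimir.

(** * Weights of Verma modules and the action on the completion *)

Section VermaWeights.
Variables (R : realType) (n : nat) (D : splitData R n).
Local Notation C := R[i].
Local Notation g := (cplx D).
Local Notation roots := (sd_roots D).
Local Notation ws := (wsum (sd_simple D)).
Local Notation x_ j := (cinj (sd_x D)`_j : g).
Local Notation e_ al := (cinj (sd_e D al) : g).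
Variable lam : 'rV[C]_n.
Local Notation M := (verma D lam).
Local Notation v0 := (@verma_class R n D lam [::]).
Local Notation act := (@verma_act R n D lam).
Let ss : is_semisimple D := @sd_semisimple R n D.

Lemma cplx_split_ind (P : g -> Prop) :
  (forall c z w, P z -> P w -> P (c *: z + w)) -> P 0 ->
  (forall j : 'I_n, P (x_ j)) -> (forall al, al \in roots -> P (e_ al)) ->
  forall z, P z.
Proof.
move=> PZD P0 Px Pe.
have PD z w : P z -> P w -> P (z + w).
  by move=> hz hw; rewrite -[z]scale1r; apply: PZD.
have PZ c z : P z -> P (c *: z).
  by move=> hz; rewrite -[c *: z]addr0; apply: PZD.
have Pr (y : D) : P (cinj y).
  rewrite (split_decomp y) cinjD; apply: PD; rewrite cinj_sum.
    by elim/big_rec: _ => // j w _ hw; rewrite cinjZ; apply: PZD.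
  rewrite big_seq; elim/big_rec: _ => // al w ral hw; rewrite cinjZ.
  by apply: PZD => //; apply: Pe.
by move=> z; rewrite (cplxE z); apply: PD => //; apply: PZ.
Qed.

(** The root vectors come in any order: locating the weights requires only that these monomials
    span. *)
Inductive neg_mono : M -> Prop :=
| neg_mono0 : neg_mono v0
| neg_monoS be m of be \in roots & positive D be & neg_mono m :
    neg_mono (act (e_ (- be)) m).

Inductive neg_span : M -> Prop :=
| neg_span0 : neg_span 0
| neg_spanS c m m' of neg_mono m & neg_span m' : neg_span (c *: m + m').

Lemma neg_spanZD c m m' : neg_span m -> neg_span m' -> neg_span (c *: m + m').
Proof.
move=> hm hm'; elim: hm => [|d a b ha _ IH]; first by rewrite scaler0 add0r.
by rewrite scalerDr scalerA -addrA; apply: neg_spanS.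
Qed.

Lemma neg_span_act be m : be \in roots -> positive D be ->
  neg_span m -> neg_span (act (e_ (- be)) m).
Proof.
move=> rbe pbe; elim=> [|d a b ha _ IH]; first by rewrite linear0; apply: neg_span0.
by rewrite linearP; apply: neg_spanS => //; apply: neg_monoS.
Qed.

Lemma neg_mono_span m : neg_mono m -> neg_span m.
Proof.
by move=> hm; rewrite -[m]addr0 -[m]scale1r; apply: neg_spanS => //; apply: neg_span0.
Qed.

(* Commuting [z] past negative root vectors strictly shortens the remainder. *)
Lemma neg_mono_act m z : neg_mono m -> neg_span (act z m).
Proof.
move=> hm; elim: hm z => {m} [|be m rbe pbe hm IH] z; last first.
  rewrite verma_act_swap -[X in X + _]scale1r.
  by apply: neg_spanZD => //; apply: neg_span_act.
elim/cplx_split_ind: z => [c z w hz hw||j|al ral].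
- by rewrite verma_act_linearl; apply: neg_spanZD.
- by rewrite verma_act0l; apply: neg_span0.
- rewrite verma_x_v0 -[_ *: _]addr0; apply: neg_spanS; [exact: neg_mono0|].
  exact: neg_span0.
- have [pal|npal] := boolP (positive D al).
    by rewrite verma_cls_pos //; apply: neg_span0.
  rewrite -[al]opprK; apply/neg_mono_span/neg_monoS; last exact: neg_mono0.
    exact: root_opp.
  by rewrite positiveN.
Qed.

Lemma verma_neg_span m : neg_span m.
Proof.
elim/verma_cls_ind: m => [||c m m' hm hm'|z m hm].
- exact: neg_span0.
- exact/neg_mono_span/neg_mono0.
- exact: neg_spanZD.
- elim: hm => [|c a b ha _ IH]; first by rewrite linear0; apply: neg_span0.
  by rewrite linearP; apply: neg_spanZD => //; apply: neg_mono_act.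
Qed.

Lemma act_x_e (j : 'I_n) al m : al \in roots ->
  act (x_ j) (act (e_ al) m) = act (e_ al) (act (x_ j) m) + toC al 0 j *: act (e_ al) m.
Proof.
move=> ral; rewrite verma_act_swap cbr_cinj; congr (_ + _).
by rewrite (root_spaceP _ _ (mem_e ral)) cinjZ verma_actZl toCE.
Qed.

Lemma neg_mono_weight m : neg_mono m -> exists k : expo n,
  forall j : 'I_n, act (x_ j) m = (lam - toC (ws k)) 0 j *: m.
Proof.
elim=> {m} [|be m rbe /positiveP[l lE] _ [k IH]].
  by exists [ffun=> 0%N] => j; rewrite verma_x_v0 wsum0 toC0 subr0.
exists (eadd k l) => j; rewrite act_x_e ?root_opp // IH linearZ /= -scalerDl.
by congr (_ *: _); rewrite wsumD -lE !toCD toCN !mxE; ring.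
Qed.

Lemma act_x_comm (i j : 'I_n) m : act (x_ i) (act (x_ j) m) = act (x_ j) (act (x_ i) m).
Proof. by rewrite verma_act_swap cbr_cinj h0_abelian ?mem_x // verma_act0l addr0. Qed.

(* A vector of weight [mu] that is a sum of vectors of other weights [nu] is
   killed by a product of operators [x_j - nu_j] with [nu_j != mu_j]. *)
Lemma wspace_support (mu : 'rV[C]_n) (m : M) : in_wspace mu m ->
  (forall k, mu <> lam - toC (ws k)) -> m = 0.
Proof.
move=> mw nmu.
pose op (p : 'I_n * C) (m : M) := act (x_ p.1) m - p.2 *: m.
have opD p a b : op p (a + b) = op p a + op p b.
  by rewrite /op linearD scalerDr /=; zmod.
have opZ p c a : op p (c *: a) = c *: op p a.
  by rewrite /op linearZ /= scalerBr !scalerA [c * _]mulrC.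
have opC p q a : op p (op q a) = op q (op p a).
  have actB z a' b : act z (a' - b) = act z a' - act z b by exact: linearB.
  have actZ z c a' : act z (c *: a') = c *: act z a' by exact: linearZ.
  rewrite /op !actB !actZ act_x_comm !scalerBr !scalerA (mulrC q.2).
  by zmod.
pose ops s a := foldr op a s.
have ops_op s p a : ops s (op p a) = op p (ops s a).
  by elim: s => //= q s ->; rewrite opC.
have opsC s t a : ops s (ops t a) = ops t (ops s a).
  by elim: s => //= q s ->; rewrite ops_op.
have opsZD s c a b : ops s (c *: a + b) = c *: ops s a + ops s b.
  by elim: s => //= q s ->; rewrite opD opZ.
have op0 p : op p 0 = 0 by rewrite /op linear0 scaler0 subr0.
have [s /allP hs s0] : exists2 s, all (fun p => p.2 != mu 0 p.1) s & ops s m = 0.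
  elim: (verma_neg_span m) => [|c a b ha _ [s hs s0]]; first by exists [::].
  have [k kE] := neg_mono_weight ha.
  have /rV0Pn [j] : mu - (lam - toC (ws k)) != 0.
    by rewrite subr_eq0; apply/eqP; exact: nmu.
  rewrite !mxE subr_eq0 => nj; exists ((j, (lam - toC (ws k)) 0 j) :: s).
    by rewrite /= hs andbT eq_sym !mxE.
  rewrite -[ops (_ :: _) _]/(op _ (ops s _)) -ops_op opD opZ.
  have -> : op (j, (lam - toC (ws k)) 0 j) a = 0 by rewrite /op /= kE subrr.
  by rewrite scaler0 add0r ops_op s0 op0.
have E : ops s m = (\prod_(p <- s) (mu 0 p.1 - p.2)) *: m.
  elim: s {hs s0} => [|p s IH]; first by rewrite big_nil scale1r.
  rewrite /= -/(ops s m) IH big_cons opZ /op mw; last by split; rewrite /= ?mem_x ?mem0v.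
  rewrite -scalerBl scalerA mulrC; by rewrite evw_x.
move: s0; rewrite E => /eqP; rewrite scaler_eq0 => /orP[|/eqP//].
rewrite prodf_seq_eq0 => /hasP[p /hs]; rewrite subr_eq0 eq_sym => /negPf->.
by [].
Qed.

Lemma act_x_wspace (mu : 'rV[C]_n) (m : M) (j : 'I_n) :
  in_wspace mu m -> act (x_ j) m = mu 0 j *: m.
Proof. by move=> h; rewrite h ?evw_x //; split; rewrite /= ?mem_x ?mem0v. Qed.

Lemma daddv_pi_out (V : vectType R) (U W : {vspace V}) v :
  (U :&: W = 0)%VS -> v \in W -> daddv_pi U W v = 0.
Proof.
move=> UW vW; have WU : (W :&: U = 0)%VS by rewrite capvC.
have vUW : v \in (U + W)%VS by apply: subvP vW; apply: addvSr.
have := daddv_pi_add UW vUW; rewrite (daddv_pi_id WU vW).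
by move=> h; apply: (addIr v); rewrite add0r.
Qed.

Lemma memv_sum_seq_ind (V : vectType R) (I : eqType) (s : seq I) (P : pred I)
    (U : I -> {vspace V}) (Q : V -> Prop) :
  Q 0 -> (forall u v, Q u -> Q v -> Q (u + v)) ->
  (forall i, i \in s -> P i -> forall v, v \in U i -> Q v) ->
  forall v, v \in (\sum_(i <- s | P i) U i)%VS -> Q v.
Proof.
move=> Q0 QD; elim: s => [|i s IH] QU v.
  by rewrite big_nil memv0 => /eqP->.
have IH' := IH (fun i si => QU i (mem_behead (s := _ :: s) si)).
rewrite big_cons; case: ifP => [Pi|_ /IH'//].
by move=> /memv_addP[u uU [w /IH' hw ->]]; apply: QD => //; apply: QU uU => //; exact: mem_head.
Qed.

Lemma memv_sum_seq (V : vectType R) (I : eqType) (s : seq I) (P : pred I)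
    (U : I -> {vspace V}) i v :
  i \in s -> P i -> v \in U i -> v \in (\sum_(i <- s | P i) U i)%VS.
Proof.
move=> si Pi vU; elim: s si => // k s IH; rewrite inE big_cons => /predU1P[<-|/IH h].
  by rewrite Pi -[v]addr0 memv_add ?mem0v.
by case: ifP => // _; rewrite -[v]add0r memv_add ?mem0v.
Qed.

(** Root vectors are orthogonal to the Cartan subalgebra, on which the Killing form is
    nondegenerate. *)
Lemma cap_h0_roots : (sd_h0 D :&: \sum_(al <- roots) root_space (sd_x D) al = 0)%VS.
Proof.
apply/eqP; rewrite -subv0; apply/subvP => z; rewrite memv_cap => /andP[zh zs].
rewrite memv0 (h0_killing zh) big1 // => j _; apply/eqP; rewrite scaler_eq0.
apply/orP; left; apply/eqP; move: z zs {zh}; apply: memv_sum_seq_ind => //.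
- by rewrite killing0l.
- by move=> u v hu hv; rewrite killingDl // hu hv addr0.
- move=> al ral _ v val; apply: (killing_root_orth val (be := 0)).
    by rewrite root_space0 mem_x.
  by rewrite addr0 (root_neq0 ral).
Qed.

Lemma cap_root_rest al : al \in roots ->
  (root_space (sd_x D) al :&: (sd_h0 D
     + \sum_(be <- roots | be != al) root_space (sd_x D) be) = 0)%VS.
Proof.
move=> ral; apply/eqP; rewrite -subv0; apply/subvP => z; rewrite memv_cap.
move=> /andP[zal /memv_addP[h hh [w ws zE]]].
rewrite memv0 (root_space_dim1 ral zal) zE killingDl //.
have -> : killing h (sd_e D (- al)) = 0.
  rewrite (@killing_root_orth _ _ D 0 (- al)) ?mem_e ?root_opp ?root_space0 //.
  by rewrite add0r oppr_eq0 (root_neq0 ral).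
rewrite add0r; have -> : killing w (sd_e D (- al)) = 0; last by rewrite scale0r.
move: w ws {zE}; apply: memv_sum_seq_ind => //.
- by rewrite killing0l.
- by move=> u v hu hv; rewrite killingDl // hu hv addr0.
- move=> be rbe bal v vbe; apply: (killing_root_orth vbe (be := - al)).
    by rewrite mem_e ?root_opp.
  by rewrite subr_eq0.
Qed.

Lemma cartan_proj_e al : al \in roots -> cartan_proj D (sd_e D al) = 0.
Proof.
by move=> ral; apply: daddv_pi_out cap_h0_roots _; apply: memv_sum_seq (mem_e ral).
Qed.

Lemma root_proj_e al be : al \in roots -> be \in roots ->
  root_proj D be (sd_e D al) = (be == al)%:R *: sd_e D al.
Proof.
move=> ral rbe; case: eqVneq => [->|nab]; rewrite ?scale1r ?scale0r.
  by apply: daddv_pi_id (cap_root_rest ral) _; exact: mem_e.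
apply: daddv_pi_out (cap_root_rest rbe) _; rewrite -[sd_e D al]add0r.
rewrite memv_add ?mem0v //; apply: memv_sum_seq (mem_e ral) => //.
by rewrite eq_sym.
Qed.

Lemma y_vec_in_k al : al \in roots -> in_k D (y_vec D al).
Proof.
move=> ral; rewrite /in_k /y_vec -cinjB /cext /= linear0; congr (_, _); rewrite linearB /=.
by rewrite !sd_e_theta ?root_opp // opprK opprK addrC.
Qed.

Lemma compl_act_y al (m : 'rV[C]_n -> M) mu : al \in roots ->
  compl_act (y_vec D al) m mu =
  act (e_ al) (m (mu - toC al)) - act (e_ (- al)) (m (mu + toC al)).
Proof.
move=> ral; rewrite /compl_act /y_vec -cinjB.
have cE (f : 'End(D)) y : cext f (cinj y) = cinj (f y) by rewrite /cext /= linear0.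
rewrite cE linearB /= !cartan_proj_e ?root_opp // subrr verma_act0l add0r.
have bZ (b : bool) (y : D) : cinj (b%:R *: y) = b%:R *: cinj y :> g.
  by case: b; rewrite ?scale1r ?scale0r.
have pe be : be \in roots -> act (cext (root_proj D be) (cinj (sd_e D al - sd_e D (- al))))
    (m (mu - toC be)) = (be == al)%:R *: act (e_ al) (m (mu - toC al))
      - (be == - al)%:R *: act (e_ (- al)) (m (mu + toC al)).
  move=> rbe; rewrite cE linearB /= !root_proj_e ?root_opp // cinjB verma_actBl.
  rewrite !bZ !verma_actZl; congr (_ - _).
    by case: eqVneq => [->|_]; rewrite ?scale0r.
  by case: eqVneq => [->|_]; rewrite ?scale0r // toCN opprK.
rewrite (eq_big_seq _ pe) sumrB; congr (_ - _).
  rewrite (bigD1_seq al) ?sd_roots_uniq //= eqxx scale1r big1 ?addr0 // => be /negPf->.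
  by rewrite scale0r.
rewrite (bigD1_seq (- al)) ?sd_roots_uniq ?root_opp //= eqxx scale1r.
by rewrite big1 ?addr0 // => be /negPf->; rewrite scale0r.
Qed.

End VermaWeights.

Section VermaLinear.
Variables (R : realType) (n : nat) (D : splitData R n) (lam : 'rV[R[i]]_n).

Lemma verma_actDr (z : cplx D) (m m' : verma D lam) :
  verma_act z (m + m') = verma_act z m + verma_act z m'.
Proof. by rewrite -[m in LHS]scale1r verma_act_is_linear scale1r. Qed.

Lemma verma_act_scale (z : cplx D) c (m : verma D lam) :
  verma_act z (c *: m) = c *: verma_act z m.
Proof. exact: linearZ. Qed.

Lemma verma_act_sumZ (z : cplx D) I (s : seq I) (c : I -> R[i]) (F : I -> verma D lam) :
  verma_act z (\sum_(b <- s) c b *: F b) = \sum_(b <- s) c b *: verma_act z (F b).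
Proof.
elim/big_rec2: _ => [|b u v _ <-]; last by rewrite verma_act_is_linear.
by apply: (addrI (verma_act z 0)); rewrite -verma_actDr !addr0.
Qed.

End VermaLinear.

(** * Tensor actions *)

Section TensorActions.
Variables (R : realType) (n : nat) (D : splitData R n).
Variables (N : nat) (U : 'I_N -> lieRep (@in_g R n D)).
Variables Vl Vr : lieRep (in_k D).
Local Notation C := R[i].
Local Notation g := (cplx D).
Local Notation TT := (tens U Vl Vr).
Local Notation ix := (tens_ix U).
Implicit Types (w : ix) (T : TT) (z y : g).

Definition upd w (i : 'I_N) (b : 'I_(rep_dim (U i))) : ix := finfun (dfwith w i b).

Lemma upd_in w i b : upd w b i = b :> 'I_(rep_dim (U i)).
Proof. by rewrite /upd ffunE dfwithin. Qed.

Lemma upd_out w i (b : 'I_(rep_dim (U i))) j : i != j -> upd w b j = w j.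
Proof. by move=> h; rewrite /upd ffunE dfwithout. Qed.

Lemma upd_upd w i (b c : 'I_(rep_dim (U i))) : upd (upd w b) c = upd w c.
Proof.
apply/ffunP => j; have [<-|ij] := eqVneq i j; first by rewrite !upd_in.
by rewrite !upd_out.
Qed.

Lemma updC w i j (b : 'I_(rep_dim (U i))) (c : 'I_(rep_dim (U j))) : i != j ->
  upd (upd w b) c = upd (upd w c) b.
Proof.
move=> ij; apply/ffunP => k; have [<-|jk] := eqVneq j k.
  by rewrite upd_in upd_out ?upd_in // eq_sym.
have [kE|ik] := eqVneq i k; first by rewrite -kE upd_out ?upd_in // kE.
by rewrite !upd_out.
Qed.

Lemma act_UE i z T w :
  act_U i z T w = \sum_b U i z (w i) b *: T (upd w b).
Proof. by rewrite ffunE. Qed.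

Lemma act_lE z T w : act_l z T w = Vl z *m T w. Proof. by rewrite ffunE. Qed.

Lemma act_U_is_linear i z : linear (@act_U R n D N U Vl Vr i z).
Proof.
move=> c T T'; apply/ffunP => w; rewrite !(act_UE, ffunE) scaler_sumr -big_split.
by apply: eq_bigr => b _; rewrite !ffunE scalerDr !scalerA mulrC.
Qed.

Lemma act_l_is_linear z : linear (@act_l R n D N U Vl Vr z).
Proof.
by move=> c T T'; apply/ffunP => w; rewrite !ffunE mulmxDr scalemxAr.
Qed.

Lemma act_r_is_linear z : linear (@act_r R n D N U Vl Vr z).
Proof.
move=> c T T'; apply/ffunP => w; rewrite !ffunE mulmxDl -scalemxAl opprD.
by rewrite scalerN.
Qed.

Lemma act_r0 z : act_r z (0 : TT) = 0.
Proof. exact: linf0 (act_r_is_linear z). Qed.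

Lemma act_U_linearl i c z y T :
  act_U i (c *: z + y) T = c *: act_U i z T + act_U i y T.
Proof.
apply/ffunP => w; rewrite !(act_UE, ffunE) scaler_sumr -big_split.
by apply: eq_bigr => b _; rewrite rep_linear // !mxE scalerDl scalerA.
Qed.

Lemma act_UDl i z y T : act_U i (z + y) T = act_U i z T + act_U i y T.
Proof. by rewrite -[z in LHS]scale1r act_U_linearl scale1r. Qed.

Lemma act_U0l i T : act_U i 0 T = 0.
Proof. by apply: (addrI (act_U i 0 T)); rewrite -act_UDl !addr0. Qed.

Lemma act_UZl i c z T : act_U i (c *: z) T = c *: act_U i z T.
Proof. by rewrite -[c *: z]addr0 act_U_linearl act_U0l addr0. Qed.

Lemma act_UNl i z T : act_U i (- z) T = - act_U i z T.
Proof. by rewrite -[- z]scaleN1r act_UZl scaleN1r. Qed.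

Lemma act_UBl i z y T : act_U i (z - y) T = act_U i z T - act_U i y T.
Proof. by rewrite act_UDl act_UNl. Qed.

Lemma act_U_suml i I (s : seq I) P (F : I -> g) T :
  act_U i (\sum_(k <- s | P k) F k) T = \sum_(k <- s | P k) act_U i (F k) T.
Proof.
by elim/big_rec2: _ => [|k a b _ <-]; rewrite ?act_U0l // act_UDl.
Qed.

Lemma act_UU i z y T w : act_U i z (act_U i y T) w =
  \sum_b (U i z *m U i y) (w i) b *: T (upd w b).
Proof.
rewrite act_UE; under eq_bigr do rewrite act_UE scaler_sumr.
rewrite exchange_big; apply: eq_bigr => b _; rewrite mxE scaler_suml.
by apply: eq_bigr => c _; rewrite upd_in upd_upd scalerA.
Qed.

Lemma act_U_cbr i z y T :
  act_U i (cbr z y) T = act_U i z (act_U i y T) - act_U i y (act_U i z T).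
Proof.
have subE (T1 T2 : TT) w : (T1 - T2) w = T1 w - T2 w by rewrite !ffunE.
apply/ffunP => w; rewrite subE [LHS]act_UE (rep_br (U i)) // !act_UU.
by rewrite -sumrB; apply: eq_bigr => b _; rewrite !mxE scalerBl.
Qed.

Lemma act_U_comm i j z y T : i != j ->
  act_U i z (act_U j y T) = act_U j y (act_U i z T).
Proof.
move=> ij; apply/ffunP => w; rewrite !act_UE.
under eq_bigr do rewrite act_UE scaler_sumr upd_out //.
under [RHS]eq_bigr do rewrite act_UE scaler_sumr upd_out 1?eq_sym //.
rewrite exchange_big; apply: eq_bigr => b _; apply: eq_bigr => c _.
by rewrite !scalerA mulrC (updC _ _ _ ij).
Qed.

Lemma act_lU i z y T : act_l z (act_U i y T) = act_U i y (act_l z T).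
Proof.
apply/ffunP => w; rewrite act_lE !act_UE mulmx_sumr; apply: eq_bigr => b _.
by rewrite act_lE scalemxAr.
Qed.

End TensorActions.

(** * Spherical functions with an operator inserted *)

Section Insertion.
Variables (R : realType) (n : nat) (D : splitData R n).
Variables (N : nat) (U : 'I_N -> lieRep (@in_g R n D)).
Variables Vl Vr : lieRep (in_k D).
Local Notation C := R[i].
Local Notation g := (cplx D).
Local Notation roots := (sd_roots D).
Local Notation x_ j := (cinj (sd_x D)`_j : g).
Local Notation e_ al := (cinj (sd_e D al) : g).
Variable lam : N.+1.-tuple 'rV[C]_n.
Local Notation M k := (verma D (lam`_k - toC (rho D))).
Variable phi_l : {linear M 0%N -> 'cV[C]_(rep_dim Vl)}.
Hypothesis phi_lP : hom_k_from_verma phi_l.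
Variable Psi : forall i : 'I_N, {linear M i.+1 -> {ffun 'I_(rep_dim (U i)) -> M i}}.
Hypothesis PsiP : forall i, hom_g_tensor (Psi i).
Local Notation ix := (tens_ix U).
Local Notation TT := (tens U Vl Vr).

(** The operator is a family over all levels that is the identity except at the chosen one. The
    level is thus selected by a boolean test and no cast between the modules of levels [k] and [i]
    occurs. *)
Fixpoint Psi_ins (A : forall k : nat, M k -> M k) (w : ix) (k : nat) :
    (k <= N)%N -> M k -> M 0%N :=
  match k with
  | 0%N => fun _ m => A 0%N m
  | k'.+1 => fun hk m =>
      Psi_ins A w (ltnW hk) (Psi (Ordinal hk) (A k'.+1 m) (w (Ordinal hk)))
  end.

Definition no_ins k (m : M k) : M k := m.
Definition ins i (z : g) k (m : M k) : M k := if k == i then verma_act z m else m.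
Definition ins2 i (z y : g) k (m : M k) : M k :=
  if k == i then verma_act z (verma_act y m) else m.

Lemma Psi_ins_linear A w k (hk : (k <= N)%N) :
  (forall k, linear (A k)) -> linear (Psi_ins A w hk).
Proof.
move=> lA; elim: k hk => [|k IH] hk c m m' /=; first exact: lA.
by rewrite lA linearP !ffunE IH.
Qed.

Lemma Psi_ins_ext A B w k (hk : (k <= N)%N) m :
  (forall j (m : M j), (j <= k)%N -> A j m = B j m) ->
  Psi_ins A w hk m = Psi_ins B w hk m.
Proof.
elim: k hk m => [|k IH] hk m AB /=; rewrite AB // IH // => j m' jk.
by apply: AB; apply: leqW.
Qed.

Lemma Psi_no_ins w k (hk : (k <= N)%N) m :
  Psi_ins no_ins w hk m = Psi_comp Psi w hk m.
Proof. by elim: k hk m => [//|k IH] hk m /=; rewrite IH. Qed.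

Lemma Psi_ins_upd A w i (b : 'I_(rep_dim (U i))) k (hk : (k <= N)%N) m :
  (k <= i)%N -> Psi_ins A (upd w b) hk m = Psi_ins A w hk m.
Proof.
elim: k hk m => [//|k IH] hk m ki /=; rewrite IH ?(ltnW ki) //.
by rewrite upd_out // -val_eqE /= gtn_eqF.
Qed.

(* Families of maps [M k -> M 0] that are transported by [Psi] above level [i]
   are determined by their members at level [i]. *)
Definition transported (P : ix -> forall k, (k <= N)%N -> M k -> M 0%N) (i : nat) :=
  forall w k (hk : (k.+1 <= N)%N) m, (i <= k)%N ->
    P w k.+1 hk m = P w k (ltnW hk) (Psi (Ordinal hk) m (w (Ordinal hk))).

Lemma transported_eq P Q i : transported P i -> transported Q i ->
  (forall w (hi : (i <= N)%N) m, P w i hi m = Q w i hi m) ->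
  forall w k (hk : (k <= N)%N) m, (i <= k)%N -> P w k hk m = Q w k hk m.
Proof.
move=> tP tQ PQ w; elim=> [|k IH] hk m ik.
  by move: ik hk m; rewrite leqn0 => /eqP {}i0; move: tP tQ PQ; rewrite i0.
move: ik; rewrite leq_eqVlt => /predU1P[E|ik]; last by rewrite tP ?tQ // IH.
by move: tP tQ PQ; rewrite E => _ _; apply.
Qed.

Lemma transported_ins A i :
  (forall k (m : M k), (i < k)%N -> A k m = m) -> transported (Psi_ins A) i.
Proof. by move=> hA w k hk m ik /=; rewrite hA. Qed.

Lemma transported_add P Q i : transported P i -> transported Q i ->
  transported (fun w k hk m => P w k hk m + Q w k hk m) i.
Proof. by move=> tP tQ w k hk m ik; rewrite tP ?tQ. Qed.

Lemma transported_act_U P (i : 'I_N) z : transported P i.+1 ->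
  transported (fun w k hk m => \sum_b U i z (w i) b *: P (upd w b) k hk m) i.+1.
Proof.
move=> tP w k hk m ik; apply: eq_bigr => b _; rewrite tP //.
by rewrite upd_out // -val_eqE /= ltn_eqF.
Qed.

Lemma Psi_ins_none A w k (hk : (k <= N)%N) m :
  (forall j (m : M j), (j <= k)%N -> A j m = m) ->
  Psi_ins A w hk m = Psi_comp Psi w hk m.
Proof. by move=> hA; rewrite -Psi_no_ins; apply: Psi_ins_ext. Qed.

Lemma insE i z (m : M i) : ins i z m = verma_act z m.
Proof. by rewrite /ins eqxx. Qed.

Lemma ins_id i z k (m : M k) : k != i -> ins i z m = m.
Proof. by rewrite /ins => /negPf->. Qed.

Lemma ins2E i z y (m : M i) : ins2 i z y m = verma_act z (verma_act y m).
Proof. by rewrite /ins2 eqxx. Qed.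

Lemma ins2_id i z y k (m : M k) : k != i -> ins2 i z y m = m.
Proof. by rewrite /ins2 => /negPf->. Qed.

Lemma transported_Psi_ins i j z : (j <= i)%N -> transported (Psi_ins (ins j z)) i.
Proof.
move=> ji; apply: transported_ins => k m ik; apply: ins_id.
by rewrite gtn_eqF // (leq_ltn_trans ji).
Qed.

Lemma transported_Psi_ins2 i j z y : (j <= i)%N -> transported (Psi_ins (ins2 j z y)) i.
Proof.
move=> ji; apply: transported_ins => k m ik; apply: ins2_id.
by rewrite gtn_eqF // (leq_ltn_trans ji).
Qed.

Lemma transported_Psi_comp i : transported (Psi_comp Psi) i. Proof. by []. Qed.

Lemma Psi_comp_linear w k (hk : (k <= N)%N) : linear (Psi_comp Psi w hk).
Proof.
by move=> c m m'; rewrite -!Psi_no_ins; apply: Psi_ins_linear.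
Qed.

Lemma Psi_ins_sum A w k (hk : (k <= N)%N) I (s : seq I) (c : I -> C) (F : I -> M k) :
  (forall k, linear (A k)) ->
  Psi_ins A w hk (\sum_(b <- s) c b *: F b) = \sum_(b <- s) c b *: Psi_ins A w hk (F b).
Proof.
move=> lA; have lP := Psi_ins_linear w hk lA.
have P0 : Psi_ins A w hk 0 = 0.
  have := lP 1 0 0; rewrite !scale1r addr0 -[X in X = _]addr0.
  by move/addrI => <-.
by elim/big_rec2: _ => [|b u v _ <-]; rewrite ?lP.
Qed.

Lemma Psi_comp_sum w k (hk : (k <= N)%N) I (s : seq I) (c : I -> C) (F : I -> M k) :
  Psi_comp Psi w hk (\sum_(b <- s) c b *: F b)
  = \sum_(b <- s) c b *: Psi_comp Psi w hk (F b).
Proof.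
by rewrite -Psi_no_ins Psi_ins_sum //; apply: eq_bigr => b _; rewrite Psi_no_ins.
Qed.

Lemma Psi_comp_add w k (hk : (k <= N)%N) (a b : M k) :
  Psi_comp Psi w hk (a + b) = Psi_comp Psi w hk a + Psi_comp Psi w hk b.
Proof. by rewrite -[a in LHS]scale1r Psi_comp_linear scale1r. Qed.

Lemma Psi_comp_upd i (hi : (i < N)%N) w (b : 'I_(rep_dim (U (Ordinal hi))))
    (hk : (i <= N)%N) m : Psi_comp Psi (upd w b) hk m = Psi_comp Psi w hk m.
Proof. by rewrite -!Psi_no_ins Psi_ins_upd. Qed.

Lemma Psi_act i (hi : (i < N)%N) z (m : M i.+1) a :
  Psi (Ordinal hi) (verma_act z m) a = verma_act z (Psi (Ordinal hi) m a)
    + \sum_b U (Ordinal hi) z a b *: Psi (Ordinal hi) m b.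
Proof. exact: (PsiP (i := Ordinal hi)). Qed.

Lemma ins_low i z w (hk : (i <= N)%N) (m : M i) :
  Psi_ins (ins i.+1 z) w hk m = Psi_comp Psi w hk m.
Proof. by apply: Psi_ins_none => j m' ji; rewrite ins_id // ltn_eqF. Qed.

Lemma ins2_low i z y w (hk : (i <= N)%N) (m : M i) :
  Psi_ins (ins2 i.+1 z y) w hk m = Psi_comp Psi w hk m.
Proof. by apply: Psi_ins_none => j m' ji; rewrite ins2_id // ltn_eqF. Qed.

Lemma Psi_ins_at i z w (hk : (i <= N)%N) (m : M i) :
  Psi_ins (ins i z) w hk m = Psi_comp Psi w hk (verma_act z m).
Proof.
by case: i hk m => [|i] hk m /=; rewrite insE // ins_low.
Qed.

Lemma Psi_ins2_at i z y w (hk : (i <= N)%N) (m : M i) :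
  Psi_ins (ins2 i z y) w hk m = Psi_comp Psi w hk (verma_act z (verma_act y m)).
Proof.
by case: i hk m => [|i] hk m /=; rewrite ins2E // ins2_low.
Qed.

Lemma ins_above i z w (hk : (i.+1 <= N)%N) (m : M i.+1) :
  Psi_ins (ins i z) w hk m
  = Psi_ins (ins i z) w (ltnW hk) (Psi (Ordinal hk) m (w (Ordinal hk))).
Proof. by rewrite /= ins_id // gtn_eqF. Qed.

Lemma ins2_above i z y w (hk : (i.+1 <= N)%N) (m : M i.+1) :
  Psi_ins (ins2 i z y) w hk m
  = Psi_ins (ins2 i z y) w (ltnW hk) (Psi (Ordinal hk) m (w (Ordinal hk))).
Proof. by rewrite /= ins2_id // gtn_eqF. Qed.

(** It suffices to compare both sides at level [i.+1], where the intertwining property of [Psi]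
    distributes [z] over the Verma module of level [i] and the tensor factor between the two
    levels. *)
Lemma ins_step_nat i (hi : (i < N)%N) z w k (hk : (k <= N)%N) m : (i < k)%N ->
  Psi_ins (ins i.+1 z) w hk m = Psi_ins (ins i z) w hk m
    + \sum_b U (Ordinal hi) z (w (Ordinal hi)) b *: Psi_comp Psi (upd w b) hk m.
Proof.
apply: (@transported_eq (Psi_ins (ins i.+1 z)) (fun w k hk m =>
  Psi_ins (ins i z) w hk m
  + \sum_b U (Ordinal hi) z (w (Ordinal hi)) b *: Psi_comp Psi (upd w b) hk m) i.+1).
- exact: transported_Psi_ins.
- by apply: transported_add; [exact: transported_Psi_ins|exact: (@transported_act_U _ (Ordinal hi))].
move=> {hk m}{}w hi' m; have -> : hi' = hi by exact: bool_irrelevance.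
rewrite Psi_ins_at ins_above /= Psi_act Psi_comp_add Psi_ins_at Psi_comp_sum; congr (_ + _).
by apply: eq_bigr => b _; rewrite Psi_comp_upd upd_in.
Qed.

(** The four terms are those of the coproduct of [z y]. *)
Lemma ins2_step_nat i (hi : (i < N)%N) z y w k (hk : (k <= N)%N) m : (i < k)%N ->
  Psi_ins (ins2 i.+1 z y) w hk m = Psi_ins (ins2 i z y) w hk m
    + (\sum_b U (Ordinal hi) z (w (Ordinal hi)) b *: Psi_ins (ins i y) (upd w b) hk m
    + (\sum_b U (Ordinal hi) y (w (Ordinal hi)) b *: Psi_ins (ins i z) (upd w b) hk m
    + \sum_b U (Ordinal hi) z (w (Ordinal hi)) b *:
       \sum_c U (Ordinal hi) y (upd w b (Ordinal hi)) c *: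
          Psi_comp Psi (upd (upd w b) c) hk m)).
Proof.
pose P0 : ix -> forall k, (k <= N)%N -> M k -> M 0%N := Psi_comp Psi.
pose P1 (w : ix) k (hk : (k <= N)%N) m :=
  \sum_c U (Ordinal hi) y (w (Ordinal hi)) c *: P0 (upd w c) k hk m.
pose Q (w : ix) k (hk : (k <= N)%N) m := Psi_ins (ins2 i z y) w hk m
    + (\sum_b U (Ordinal hi) z (w (Ordinal hi)) b *: Psi_ins (ins i y) (upd w b) hk m
    + (\sum_b U (Ordinal hi) y (w (Ordinal hi)) b *: Psi_ins (ins i z) (upd w b) hk m
    + \sum_b U (Ordinal hi) z (w (Ordinal hi)) b *: P1 (upd w b) k hk m)).
apply: (@transported_eq (Psi_ins (ins2 i.+1 z y)) Q i.+1).
- exact: transported_Psi_ins2.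
- apply: transported_add; first exact: transported_Psi_ins2.
  apply: transported_add; first by apply: (@transported_act_U _ (Ordinal hi)); exact: transported_Psi_ins.
  apply: transported_add; first by apply: (@transported_act_U _ (Ordinal hi)); exact: transported_Psi_ins.
  do 2 apply: (@transported_act_U _ (Ordinal hi)); exact: transported_Psi_comp.
move=> {hk m}{}w hi' m; have -> : hi' = hi by exact: bool_irrelevance.
rewrite Psi_ins2_at /Q ins2_above /= !Psi_act Psi_ins2_at.
rewrite verma_actDr !Psi_comp_add -!addrA; congr (_ + _).
rewrite verma_act_sumZ !Psi_comp_sum [RHS]addrCA; congr (_ + _).
  apply: eq_bigr => b _; rewrite ins_id ?gtn_eqF //.
  by rewrite upd_in Psi_ins_upd // Psi_ins_at.
have E (a : C) b : a *: Psi_comp Psi w (ltnW hi) (Psi (Ordinal hi) (verma_act y m) b)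
    = a *: Psi_comp Psi w (ltnW hi) (verma_act y (Psi (Ordinal hi) m b))
    + a *: Psi_comp Psi w (ltnW hi)
        (\sum_c U (Ordinal hi) y b c *: Psi (Ordinal hi) m c).
  by rewrite Psi_act Psi_comp_add scalerDr.
rewrite (eq_bigr _ (fun b _ => E _ b)).
rewrite big_split /=; congr (_ + _); apply: eq_bigr => b _; congr (_ *: _).
  by rewrite ins_id ?gtn_eqF // upd_in Psi_ins_upd // Psi_ins_at.
rewrite /P1 /P0 /= Psi_comp_sum; apply: eq_bigr => c _.
by rewrite !upd_in !Psi_comp_upd.
Qed.

End Insertion.

(** * Calculus of formal series *)

Section Exponents.
Variable n : nat.
Implicit Types (k l p q r : expo n).

Definition ele p k : bool := [forall i, p i <= k i]%N.
Definition esub k p : expo n := [ffun i => (k i - p i)%N].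
Definition emul (m : nat) l : expo n := [ffun i => (m * l i)%N].
Definition ezero : expo n := [ffun=> 0%N].

(** The summation range of [fmul] moved into the single type [expo n], so that sums belonging to
    different [k] can be reindexed into one another. *)
Definition below k : seq (expo n) :=
  [seq [ffun i => p i : nat] | p : {dffun forall i : 'I_n, 'I_(k i).+1}].

Lemma eleP p k : reflect (forall i, p i <= k i)%N (ele p k).
Proof. exact: forallP. Qed.

Lemma mem_below k p : (p \in below k) = ele p k.
Proof.
apply/mapP/eleP => [[q _ ->] i|h]; first by rewrite ffunE -ltnS.
exists ([ffun i => inord (p i)] : {dffun forall i : 'I_n, 'I_(k i).+1}).
  by rewrite mem_enum.
by apply/ffunP => i; rewrite !ffunE inordK // ltnS.
Qed.

Lemma below_uniq k : uniq (below k).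
Proof.
rewrite map_inj_uniq ?enum_uniq // => p q /ffunP h; apply/ffunP => i.
by apply: val_inj; have := h i; rewrite !ffunE.
Qed.

Lemma ele_trans p q k : ele p q -> ele q k -> ele p k.
Proof. by move=> /eleP a /eleP b; apply/eleP => i; apply: leq_trans (a i) _. Qed.

Lemma ele_addr p q : ele p (eadd p q).
Proof. by apply/eleP => i; rewrite ffunE leq_addr. Qed.

Lemma eaddC p q : eadd p q = eadd q p.
Proof. by apply/ffunP => i; rewrite !ffunE addnC. Qed.

Lemma eaddK p q : esub (eadd p q) p = q.
Proof. by apply/ffunP => i; rewrite !ffunE addKn. Qed.

Lemma esubK p k : ele p k -> eadd p (esub k p) = k.
Proof. by move/eleP => h; apply/ffunP => i; rewrite !ffunE subnKC. Qed.

Lemma esub_add k p q : esub k (eadd p q) = esub (esub k p) q.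
Proof. by apply/ffunP => i; rewrite !ffunE subnDA. Qed.

Lemma ele_esub k p q : ele p k -> ele q (esub k p) = ele (eadd p q) k.
Proof.
move=> /eleP h; apply/eleP/eleP => hq i; have := hq i; rewrite !ffunE.
  by rewrite leq_subRL.
by rewrite -leq_subRL.
Qed.

Lemma ele_edeg p k : ele p k -> (edeg p <= edeg k)%N.
Proof. by move/eleP => h; apply: leq_sum. Qed.

Lemma edeg_sub p k : ele p k -> edeg (esub k p) = (edeg k - edeg p)%N.
Proof. by move=> h; rewrite -{2}(esubK h) edegD addKn. Qed.

Lemma edeg_mul m l : edeg (emul m l) = (m * edeg l)%N.
Proof. by rewrite /edeg big_distrr; apply: eq_bigr => i _; rewrite ffunE. Qed.

Lemma edeg_gt0 l : l != ezero -> (0 < edeg l)%N.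
Proof.
apply: contraNT; rewrite -eqn0Ngt sum_nat_eq0 => /forallP h.
by apply/eqP/ffunP => i; rewrite ffunE; apply/eqP/h.
Qed.

Lemma ele0 k : ele ezero k. Proof. by apply/eleP => i; rewrite ffunE. Qed.
Lemma esub0 k : esub k ezero = k.
Proof. by apply/ffunP => i; rewrite !ffunE subn0. Qed.

End Exponents.

(** * The action of scalar series on module-valued series *)

Section FormalMul.
Variables (R : realType) (n : nat).
Local Notation C := R[i].
Implicit Types (f g : expo n -> C) (k p : expo n).

Lemma fmulE (V : lmodType C) f (F : expo n -> V) k :
  fmul f F k = \sum_(p <- below k) f p *: F (esub k p).
Proof.
rewrite /below big_map /fmul big_enum /=; apply: eq_bigr => p _.
by congr (_ *: F _); apply/ffunP => i; rewrite !ffunE.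
Qed.

Lemma fmul_ext (V : lmodType C) f g (F G : expo n -> V) k :
  (forall p, f p = g p) -> (forall p, F p = G p) -> fmul f F k = fmul g G k.
Proof. by move=> fg FG; rewrite !fmulE; apply: eq_bigr => p _; rewrite fg FG. Qed.

Lemma fmul_linear (V W : lmodType C) (L : V -> W) f (F : expo n -> V) k :
  linear L -> fmul f (fun p => L (F p)) k = L (fmul f F k).
Proof.
move=> lL; rewrite !fmulE (linf_sum lL); apply: eq_bigr => p _.
by rewrite (linfZ lL).
Qed.

Lemma fmulDr (V : lmodType C) f (F G : expo n -> V) k :
  fmul f (fun p => F p + G p) k = fmul f F k + fmul f G k.
Proof. by rewrite !fmulE -big_split; apply: eq_bigr => p _; rewrite scalerDr. Qed.

Lemma fmulZr (V : lmodType C) c f (F : expo n -> V) k :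
  fmul f (fun p => c *: F p) k = c *: fmul f F k.
Proof.
by rewrite !fmulE scaler_sumr; apply: eq_bigr => p _; rewrite !scalerA mulrC.
Qed.

Lemma fmulNr (V : lmodType C) f (F : expo n -> V) k :
  fmul f (fun p => - F p) k = - fmul f F k.
Proof. by rewrite !fmulE -sumrN; apply: eq_bigr => p _; rewrite scalerN. Qed.

Lemma fmulBr (V : lmodType C) f (F G : expo n -> V) k :
  fmul f (fun p => F p - G p) k = fmul f F k - fmul f G k.
Proof. by rewrite fmulDr fmulNr. Qed.

Lemma fmul_sumr (V : lmodType C) f I (s : seq I) P (F : I -> expo n -> V) k :
  fmul f (fun p => \sum_(i <- s | P i) F i p) k = \sum_(i <- s | P i) fmul f (F i) k.
Proof.
rewrite fmulE; under [RHS]eq_bigr do rewrite fmulE.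
by rewrite [RHS]exchange_big; apply: eq_bigr => p _; rewrite scaler_sumr.
Qed.

Lemma fmulDl (V : lmodType C) f g (F : expo n -> V) k :
  fmul (fun p => f p + g p) F k = fmul f F k + fmul g F k.
Proof. by rewrite !fmulE -big_split; apply: eq_bigr => p _; rewrite scalerDl. Qed.

Lemma fmulZl (V : lmodType C) c f (F : expo n -> V) k :
  fmul (fun p => c * f p) F k = c *: fmul f F k.
Proof. by rewrite !fmulE scaler_sumr; apply: eq_bigr => p _; rewrite scalerA. Qed.

Lemma sum_below_sub (V : nmodType) k p (F : expo n -> V) : ele p k ->
  \sum_(q <- below (esub k p)) F q = \sum_(q <- below k | ele (eadd p q) k) F q.
Proof.
move=> pk; rewrite -[RHS]big_filter; apply: perm_big; apply: uniq_perm.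
- exact: below_uniq.
- by rewrite filter_uniq ?below_uniq.
move=> q; rewrite mem_filter !mem_below ele_esub //.
case h : (ele _ _) => //=; apply/esym; apply: ele_trans h.
by rewrite eaddC ele_addr.
Qed.

Lemma fmul_comm (V : lmodType C) f g (F : expo n -> V) k :
  fmul f (fmul g F) k = fmul g (fmul f F) k.
Proof.
have E f' g' : fmul f' (fmul g' F) k = \sum_(p <- below k) \sum_(q <- below k)
    (if ele (eadd p q) k then (f' p * g' q) *: F (esub k (eadd p q)) else 0).
  rewrite fmulE big_seq [RHS]big_seq; apply: eq_bigr => p; rewrite mem_below => pk.
  rewrite fmulE sum_below_sub // -big_mkcond scaler_sumr; apply: eq_bigr => q _.
  by rewrite scalerA esub_add.
rewrite !E exchange_big; apply: eq_bigr => p _; apply: eq_bigr => q _.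
by rewrite eaddC mulrC.
Qed.

Lemma fmul_assoc (V : lmodType C) f g (F : expo n -> V) k :
  fmul (fmul (V := C^o) f g) F k = fmul f (fmul g F) k.
Proof.
transitivity (\sum_(q <- below k) \sum_(p <- below k)
    if ele q p then (f q * g (esub p q)) *: F (esub k p) else 0).
  rewrite exchange_big fmulE big_seq [RHS]big_seq; apply: eq_bigr => p.
  rewrite mem_below => pk; rewrite fmulE scaler_suml -big_mkcond /=.
  rewrite -[RHS]big_filter; apply: perm_big; apply: uniq_perm.
  - exact: below_uniq.
  - by rewrite filter_uniq ?below_uniq.
  move=> q; rewrite mem_filter !mem_below; case h : (ele q p) => //=.
  by apply/esym; apply: ele_trans pk.
rewrite fmulE big_seq [RHS]big_seq; apply: eq_bigr => q; rewrite mem_below => qk.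
rewrite fmulE scaler_sumr -big_mkcond /=.
rewrite [RHS](eq_bigr (fun r => (f q * g (esub (eadd q r) q)) *: F (esub k (eadd q r)))); last first.
  by move=> r _; rewrite eaddK scalerA esub_add.
rewrite -(big_map (eadd q) xpredT (fun p => (f q * g (esub p q)) *: F (esub k p))).
rewrite -[LHS]big_filter; apply: perm_big; apply: uniq_perm.
- by rewrite filter_uniq ?below_uniq.
- rewrite map_inj_uniq ?below_uniq // => a b h; by rewrite -(eaddK q a) h eaddK.
move=> p; rewrite mem_filter mem_below; apply/andP/mapP => [[qp pk]|[r rk ->]].
  exists (esub p q); last by rewrite esubK.
  by rewrite mem_below ele_esub // esubK.
by rewrite ele_addr -ele_esub // -mem_below.
Qed.

Lemma fmul1 (V : lmodType C) (F : expo n -> V) k : fmul (@fone R n) F k = F k.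
Proof.
rewrite fmulE (bigD1_seq (ezero n)) ?below_uniq ?mem_below ?ele0 //=.
rewrite /fone eqxx scale1r esub0 big1 ?addr0 // => p /negPf.
by rewrite /ezero => ->; rewrite scale0r.
Qed.

End FormalMul.

(** * Series along one root and the logarithmic derivative of [delta] *)

Section RootSeries.
Variables (R : realType) (n : nat) (D : splitData R n).
Local Notation C := R[i].
Local Notation roots := (sd_roots D).
Local Notation ws := (wsum (sd_simple D)).
Implicit Types (k p l : expo n) (u v : nat -> C).

Lemma wsum_mul m l : ws (emul m l) = ws l *+ m.
Proof.
rewrite /wsum -sumrMnl; apply: eq_bigr => i _.
by rewrite ffunE mulrnAC -mulrnA mulnC.
Qed.

Lemma positive_expo al : al \in roots -> positive D al ->
  exists2 l, al = ws l & l != ezero n.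
Proof.
move=> ral /positiveP[l lE]; exists l => //; apply: contraNneq (root_neq0 ral) => E.
by rewrite lE E wsum0.
Qed.

Section Ray.
Variables (l : expo n) (l0 : l != ezero n).

Let emul_inj m m' : emul m l = emul m' l -> m = m'.
Proof.
move/(congr1 (@edeg n)); rewrite !edeg_mul => /eqP.
by rewrite eqn_pmul2r ?edeg_gt0 // => /eqP.
Qed.

Let leq_deg m : (m <= edeg (emul m l))%N.
Proof. by rewrite edeg_mul leq_pmulr // edeg_gt0. Qed.

Let wsE p m : (ws p == ws l *+ m) = (p == emul m l).
Proof. by rewrite -wsum_mul (inj_eq (@wsum_inj R n D)). Qed.

Lemma fseries_ray u m : fseries D (ws l) u (emul m l) = u m.
Proof.
rewrite /fseries -/(edeg _) (eq_bigl (fun i : 'I_ _ => (i : nat) == m)).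
  have hm : (m < (edeg (emul m l)).+1)%N by rewrite ltnS leq_deg.
  by rewrite (big_pred1 (Ordinal hm)) // => i; rewrite -val_eqE.
by move=> i; rewrite wsE; apply/eqP/eqP => [/emul_inj/esym|E]; rewrite ?E.
Qed.

Lemma fseries_off u p : (forall m, p <> emul m l) -> fseries D (ws l) u p = 0.
Proof.
by move=> h; apply: big_pred0 => m; rewrite wsE; apply/eqP; apply: h.
Qed.

Lemma fseries_ext u v p : u =1 v -> fseries D (ws l) u p = fseries D (ws l) v p.
Proof. by move=> uv; apply: eq_bigr => m _; apply: uv. Qed.

Lemma fmul_fseries (V : lmodType C) u (F : expo n -> V) k :
  fmul (fseries D (ws l) u) F k =
  \sum_(m < (edeg k).+1 | ele (emul m l) k) u m *: F (esub k (emul m l)).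
Proof.
rewrite fmulE.
transitivity (\sum_(p <- below k) \sum_(m < (edeg k).+1 | p == emul m l)
    u m *: F (esub k p)).
  rewrite big_seq [RHS]big_seq; apply: eq_bigr => p; rewrite mem_below => pk.
  rewrite -scaler_suml; congr (_ *: _); rewrite /fseries.
  rewrite (eq_bigl (fun m : 'I_ _ => p == emul m l)); last by move=> m; rewrite wsE.
  rewrite (big_ord_widen_cond (edeg k).+1 (fun m => p == emul m l) u); last first.
    by rewrite ltnS ele_edeg.
  apply: eq_bigl => m; case: eqP => //= ->; rewrite ltnS; exact: leq_deg.
rewrite (exchange_big_dep xpredT) //= [RHS]big_mkcond; apply: eq_bigr => m _.
case: ifP => mk.
  rewrite big_mkcond (bigD1_seq (emul m l)) ?below_uniq ?mem_below //= eqxx.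
  by rewrite big1 ?addr0 // => p /negPf->.
rewrite big_seq_cond big1 // => p /andP[]; rewrite mem_below => pk /eqP pE.
by rewrite pE mk in pk.
Qed.

Lemma ele_emul m m' : ele (emul m l) (emul m' l) = (m <= m')%N.
Proof.
apply/idP/idP => [/ele_edeg|h].
  by rewrite !edeg_mul leq_pmul2r // edeg_gt0.
by apply/eleP => i; rewrite !ffunE leq_mul2r h orbT.
Qed.

Lemma esub_emul m m' : esub (emul m' l) (emul m l) = emul (m' - m) l.
Proof. by apply/ffunP => i; rewrite !ffunE mulnBl. Qed.

Lemma fseries_mul u v p :
  fmul (V := C^o) (fseries D (ws l) u) (fseries D (ws l) v) p =
  fseries D (ws l) (fun M => \sum_(m < M.+1) u m * v (M - m)%N) p.
Proof.
rewrite fmul_fseries; have [[M ->]|h] := pselect (exists M, p = emul M l).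
  rewrite fseries_ray (eq_bigl (fun m : 'I_ _ => (m < M.+1)%N)).
    have hM : (M.+1 <= (edeg (emul M l)).+1)%N by rewrite ltnS leq_deg.
    rewrite (big_ord_widen _ (fun m => u m * v (M - m)%N) hM).
    by apply: eq_bigr => m _; rewrite esub_emul fseries_ray.
  by move=> m; rewrite ele_emul ltnS.
rewrite fseries_off; last by move=> m pE; apply: h; exists m.
apply: big1 => m mp; rewrite fseries_off ?scaler0 // => m' E; apply: h.
exists (m + m')%N; apply: etrans (esym (esubK mp)) _; rewrite E.
by apply/ffunP => i; rewrite !ffunE mulnDl.
Qed.

End Ray.

Lemma fgeom_pos al : positive D al ->
  fgeom D al = fseries D al (fun m => (~~ odd m)%:R).
Proof. by rewrite /fgeom => ->. Qed.

Lemma fgeom_neg al : al \in roots -> positive D al ->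
  fgeom D (- al) = fseries D al (fun m => - (~~ odd m && (0 < m)%N)%:R).
Proof. by move=> ral pal; rewrite /fgeom positiveN // pal /= opprK. Qed.

Lemma fcsch_pos al : positive D al ->
  fcsch D al = fseries D al (fun m => (odd m)%:R).
Proof. by rewrite /fcsch => ->. Qed.

Lemma fcsch_neg al : al \in roots -> positive D al ->
  fcsch D (- al) = fseries D al (fun m => - (odd m)%:R).
Proof. by move=> ral pal; rewrite /fcsch positiveN // pal /= opprK. Qed.

(** With [t = xi_(- 2 al)] this is [1 / (1 - t) + 1 / (1 - 1 / t) = 1]: for positive [al] the two
    expansions cancel except for the constant term of the first. *)
Lemma fgeomD (V : lmodType C) al (F : expo n -> V) k : al \in roots ->
  fmul (fgeom D al) F k + fmul (fgeom D (- al)) F k = F k.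
Proof.
wlog pal : al / positive D al.
  move=> wl ral; case: (boolP (positive D al)) => [pal|npal]; first exact: wl.
  by rewrite addrC -{2}[al]opprK wl ?root_opp ?positiveN.
move=> ral; have [l lE l0] := positive_expo ral pal.
rewrite fgeom_pos // fgeom_neg // lE !fmul_fseries // -big_split /=.
rewrite (bigD1 ord0) /=; last by apply/eleP => i; rewrite ffunE.
rewrite big1 ?addr0 => [|m /andP[_ m0]].
  rewrite oppr0 scale0r addr0 scale1r; congr F; apply/ffunP => i.
  by rewrite !ffunE subn0.
have -> : (0 < m)%N by rewrite lt0n.
by rewrite andbT -scalerDl subrr scale0r.
Qed.

(** The coefficients of [(1 - t^2)^(1/2)] as a series in [t = xi_(- al)]. *)
Definition sqrt_series (m : nat) : C := if odd m then 0 else sqrt_coef R m./2.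

(** The differential equation [2 (1 - t) f' = - f] of [f = (1 - t)^(1/2)], coefficient by
    coefficient. *)
Lemma sqrt_coefS q :
  sqrt_coef R q.+1 * q.+1%:R * 2%:R = sqrt_coef R q * q%:R * 2%:R - sqrt_coef R q.
Proof.
have f0 : (q`!)%:R != 0 :> C by rewrite pnatr_eq0 -lt0n fact_gt0.
have q0 : q.+1%:R != 0 :> C by rewrite pnatr_eq0.
have two0 : 2%:R != 0 :> C by rewrite pnatr_eq0.
rewrite /sqrt_coef big_ord_recr /= exprS factS natrM.
move: (\prod_(i < q) _) => P; move: (q`!%:R : C) f0 => f f0.
move: ((-1) ^+ q) => s.
rewrite (_ : q.+1%:R = q%:R + 1) in q0 *; last by rewrite -natr1.
move: (q%:R : C) q0 => Q q0.
by field; rewrite f0 q0.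
Qed.

(** The same equation in the form [- 2 t f' = t f / (1 - t)]. *)
Lemma sum_sqrt_coef q :
  - (sqrt_coef R q * q%:R * 2%:R) = \sum_(r < q) sqrt_coef R r.
Proof.
elim: q => [|q IH]; first by rewrite big_ord0 mulr0 mul0r oppr0.
by rewrite big_ord_recr /= -IH sqrt_coefS opprB addrC.
Qed.

(** For [s = (1 - t^2)^(1/2)] this says [- t s' = s / (1 - t^2) - s], the derivative of one factor
    of [delta]. *)
Lemma sum_even_sqrt M :
  - (sqrt_series M *+ M) =
  \sum_(m < M.+1) (~~ odd m)%:R * sqrt_series (M - m)%N - sqrt_series M.
Proof.
have sub_half a q : (a <= q)%N -> (q.*2 - a.*2)./2 = (q - a)%N.
  by move=> aq; rewrite -doubleB doubleK.
have [oM|eM] := boolP (odd M).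
  have -> : sqrt_series M = 0 by rewrite /sqrt_series oM.
  rewrite mul0rn oppr0 addr0 big1 // => m _.
  case om : (odd m) => /=; rewrite ?mul0r // /sqrt_series oddB ?oM ?om ?mulr0 //.
  by rewrite -ltnS.
have [q ->] : exists q, M = q.*2.
  by exists M./2; rewrite -{1}(odd_double_half M) (negPf eM).
have sE r : sqrt_series r.*2 = sqrt_coef R r by rewrite /sqrt_series odd_double doubleK.
rewrite sE -(mulr_natr _ q.*2) -muln2 natrM mulrA sum_sqrt_coef muln2.
rewrite [X in _ = X - _](reindex_inj rev_ord_inj) /=.
rewrite [X in _ = X - _](eq_bigr (fun m : 'I_q.*2.+1 => (~~ odd m)%:R * sqrt_series m)); last first.
  move=> m _; rewrite subSS subKn -1?ltnS // oddB -1?ltnS // odd_double.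
  by case: (odd m).
have E r : \sum_(m < r.*2.+1) (~~ odd m)%:R * sqrt_series m =
    \sum_(i < r.+1) sqrt_coef R i.
  elim: r => [|r IH]; first by rewrite !big_ord_recl !big_ord0 mul1r (sE 0%N).
  rewrite doubleS big_ord_recr big_ord_recr IH [RHS]big_ord_recr /=.
  by rewrite odd_double /= mul0r mul1r addr0 -doubleS sE.
by rewrite E big_ord_recr addrK.
Qed.

(** Leibniz rule in which the leading exponent [lam] is attributed entirely to [F]. *)
Lemma fderiv_fmul (V : lmodType C) lam (j : 'I_n) (f : expo n -> C) (F : expo n -> V) k :
  fderiv D lam j (fmul f F) k = fmul f (fderiv D lam j F) k
    + fmul (fun p => - toC (ws p) 0 j * f p) F k.
Proof.
rewrite /fderiv !fmulE scaler_sumr -big_split big_seq [RHS]big_seq.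
apply: eq_bigr => p; rewrite mem_below => pk /=.
rewrite !scalerA -scalerDl; congr (_ *: _).
by rewrite -{1}(esubK pk) wsumD toCD !mxE; ring.
Qed.

Lemma fderiv_sqrt_series (V : lmodType C) al (j : 'I_n) (F : expo n -> V) k :
  al \in roots -> positive D al ->
  fmul (fun p => - toC (ws p) 0 j * fseries D al sqrt_series p) F k =
  toC al 0 j *: (fmul (fgeom D al) (fmul (fseries D al sqrt_series) F) k
                 - fmul (fseries D al sqrt_series) F k).
Proof.
move=> ral pal; have [l lE l0] := positive_expo ral pal.
rewrite -fmul_assoc -fmulNr.
have -> : fmul (fseries D al sqrt_series) (fun p => - F p) k
    = fmul (fun p => - 1 * fseries D al sqrt_series p) F k.
  by rewrite fmulNr fmulZl scaleN1r.
rewrite -fmulDl -fmulZl; apply: fmul_ext => // p.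
rewrite fgeom_pos // lE fseries_mul //.
have [[M ->]|h] := pselect (exists M, p = emul M l).
  rewrite !fseries_ray // wsum_mul mulN1r -sum_even_sqrt toCMn mulNr mulrN.
  by rewrite mulrnAr mulrC mulmxnE mulrnAr mulrC.
rewrite !fseries_off // => [|m pE|m pE]; try by apply: h; exists m.
by rewrite mulr0 mulr0 addr0 mulr0.
Qed.

Lemma fdeltaE : fdelta D = foldr (fun al f => fmul (V := C^o)
    (fseries D al sqrt_series) f) (@fone R n) [seq al <- roots | positive D al].
Proof. by []. Qed.

Lemma fderiv_fdelta (V : lmodType C) lam (j : 'I_n) (F : expo n -> V) k :
  fderiv D lam j (fmul (fdelta D) F) k = fmul (fdelta D) (fderiv D lam j F) k
  + \sum_(al <- roots | positive D al) toC al 0 j *: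
      (fmul (fgeom D al) (fmul (fdelta D) F) k - fmul (fdelta D) F k).
Proof.
rewrite fdeltaE -[X in _ = _ + X]big_filter.
have : {subset [seq al <- roots | positive D al] <= [pred al | (al \in roots) && positive D al]}.
  by move=> al; rewrite mem_filter andbC.
elim: [seq _ <- _ | _] k => [|al s IH] k hs.
  by rewrite big_nil addr0 /fderiv !fmul1.
have /andP[ral pal] : (al \in roots) && positive D al by apply: hs; exact: mem_head.
have {}IH k' := IH k' (fun b bs => hs b (mem_behead (s := al :: s) bs)).
rewrite big_cons /=; set f := foldr _ _ s.
set S := fseries D al sqrt_series.
have E (G : expo n -> V) p : fmul (fmul (V := C^o) S f) G p = fmul S (fmul f G) p.
  exact: fmul_assoc.
have fE : fderiv D lam j (fmul (fmul (V := C^o) S f) F) k = fderiv D lam j (fmul S (fmul f F)) k.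
  by rewrite /fderiv E.
rewrite fE fderiv_fmul fderiv_sqrt_series // E.
rewrite (fmul_ext (g := S) k (fun=> erefl) IH) fmulDr -!addrA; congr (_ + _).
rewrite addrC; congr (_ + _).
  by rewrite E; congr (_ *: (_ - _)); apply: fmul_ext.
rewrite fmul_sumr; apply: eq_bigr => be _; rewrite fmulZr fmulBr fmul_comm E.
by congr (_ *: (_ - _)); apply: fmul_ext.
Qed.

End RootSeries.

(** * The operator form of the equations *)

Section OperatorForm.
Variables (R : realType) (n : nat) (D : splitData R n).
Variables (N : nat) (U : 'I_N -> lieRep (@in_g R n D)).
Variables Vl Vr : lieRep (in_k D).
Local Notation C := R[i].
Local Notation g := (cplx D).
Local Notation roots := (sd_roots D).
Local Notation ws := (wsum (sd_simple D)).
Local Notation x_ j := (cinj (sd_x D)`_j : g).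
Local Notation e_ al := (cinj (sd_e D al) : g).
Variable lam : N.+1.-tuple 'rV[C]_n.
Local Notation M k := (verma D (lam`_k - toC (rho D))).
Variable phi_l : {linear M 0%N -> 'cV[C]_(rep_dim Vl)}.
Hypothesis phi_lP : hom_k_from_verma phi_l.
Variable Psi : forall i : 'I_N, {linear M i.+1 -> {ffun 'I_(rep_dim (U i)) -> M i}}.
Hypothesis PsiP : forall i, hom_g_tensor (Psi i).
Local Notation ix := (tens_ix U).
Local Notation TT := (tens U Vl Vr).
Local Notation Vec := ('I_(rep_dim Vr) -> M N).

Definition tens_of (f : ix -> M N -> M 0%N) (v : Vec) : TT :=
  [ffun w : ix => \matrix_(p, q) phi_l (f w (v q)) p 0].

Lemma tens_of_ext f h v : (forall w m, f w m = h w m) -> tens_of f v = tens_of h v.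
Proof. by move=> fh; apply/ffunP => w; rewrite !ffunE; apply/matrixP => p q; rewrite !mxE fh. Qed.

Lemma tens_ofD f h v :
  tens_of (fun w m => f w m + h w m) v = tens_of f v + tens_of h v.
Proof.
by apply/ffunP => w; rewrite !ffunE; apply/matrixP => p q; rewrite !mxE linearD mxE.
Qed.

Lemma tens_of_act i z h v :
  tens_of (fun w m => \sum_b U i z (w i) b *: h (upd w b) m) v = act_U i z (tens_of h v).
Proof.
apply/ffunP => w; rewrite act_UE ffunE; apply/matrixP => p q.
rewrite mxE linear_sum !summxE; apply: eq_bigr => b _.
by rewrite linearZ !mxE ffunE mxE.
Qed.

Definition T (v : Vec) : TT := tens_of (fun w => Psi_comp Psi w (leqnn N)) v.
Definition TI i z (v : Vec) : TT :=
  tens_of (fun w => Psi_ins Psi (@ins _ _ _ _ _ i z) w (leqnn N)) v.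
Definition TI2 i z y (v : Vec) : TT :=
  tens_of (fun w => Psi_ins Psi (@ins2 _ _ _ _ _ i z y) w (leqnn N)) v.

Lemma TI_step (i : 'I_N) z v : TI i.+1 z v = TI i z v + act_U i z (T v).
Proof.
case: i => i hi; rewrite /TI -tens_of_act -tens_ofD; apply: tens_of_ext => w m.
exact: ins_step_nat.
Qed.

Lemma TI2_step (i : 'I_N) z y v : TI2 i.+1 z y v = TI2 i z y v
  + (act_U i z (TI i y v) + (act_U i y (TI i z v) + act_U i z (act_U i y (T v)))).
Proof.
case: i => i hi; rewrite /TI2 -!tens_of_act -!tens_ofD; apply: tens_of_ext => w m.
exact: ins2_step_nat.
Qed.

Lemma T_linear c v v' : T (fun q => c *: v q + v' q) = c *: T v + T v'.
Proof.
apply/ffunP => w; rewrite !ffunE; apply/matrixP => p q.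
by rewrite !mxE Psi_comp_linear linearP !mxE.
Qed.

Lemma T_ext v v' : v =1 v' -> T v = T v'.
Proof.
by move=> h; apply/ffunP => w; rewrite !ffunE; apply/matrixP => p q; rewrite !mxE h.
Qed.

Lemma T0 : T (fun=> 0) = 0.
Proof.
have : T (fun=> 0) = T (fun=> 1 *: 0 + 0).
  by apply: T_ext => q; rewrite scaler0 addr0.
by rewrite T_linear scale1r => h; apply: (addrI (T (fun=> 0))); rewrite -h addr0.
Qed.

Lemma TB v v' : T (fun q => v q - v' q) = T v - T v'.
Proof.
rewrite -(@T_ext (fun q => -1 *: v' q + v q)); last by move=> q; rewrite scaleN1r (addrC (- v' q)).
by rewrite T_linear scaleN1r addrC.
Qed.

Lemma TI_top z v : TI N z v = T (fun q => verma_act z (v q)).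
Proof.
apply/ffunP => w; rewrite !ffunE; apply/matrixP => p q; rewrite !mxE.
by rewrite Psi_ins_at.
Qed.

Lemma Psi_ins0 z w k (hk : (k <= N)%N) m :
  Psi_ins Psi (@ins _ _ _ _ _ 0%N z) w hk m = verma_act z (Psi_comp Psi w hk m).
Proof.
by elim: k hk m => [|k IH] hk m /=; [rewrite insE|rewrite ins_id ?IH].
Qed.

Lemma TI0 z v : in_k D z -> TI 0%N z v = act_l z (T v).
Proof.
move=> hz; apply/ffunP => w; rewrite !ffunE; apply/matrixP => p q; rewrite !mxE.
rewrite Psi_ins0 phi_lP // mxE; apply: eq_bigr => r _; by rewrite mxE.
Qed.

(** Telescopes [TI_step] between level [k] and the top; every tensor factor that is passed
    contributes its own action. *)
Lemma TI_high (k : nat) z v : (k <= N)%N ->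
  T (fun q => verma_act z (v q))
  = TI k z v + \sum_(j < N | (k <= j)%N) act_U j z (T v).
Proof.
rewrite -TI_top => kN; have [m kE] : exists m, (k + m)%N = N by exists (N - k)%N; rewrite subnKC.
elim: m k kE {kN} => [|m IH] k kE.
  have -> : k = N by rewrite -kE addn0.
  by rewrite big_pred0 ?addr0 // => j; rewrite leqNgt ltn_ord.
have kN : (k < N)%N by rewrite -kE -addSnnS leq_addr.
rewrite (IH k.+1) ?addSnnS // (TI_step (Ordinal kN)) -addrA; congr (_ + _).
rewrite [RHS](bigD1 (Ordinal kN)) //=; congr (_ + _).
by apply: eq_bigl => j; rewrite ltn_neqAle andbC -val_eqE eq_sym.
Qed.

Definition k_act z (t : TT) : TT := act_l z t + \sum_(j < N) act_U j z t.

Lemma T_k z v : in_k D z -> T (fun q => verma_act z (v q)) = k_act z (T v).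
Proof.
move=> hz; rewrite (@TI_high 0%N) // TI0 // /k_act; congr (_ + _).
Qed.

(** After transport down to level [k] the paired insertions form the Casimir element of that Verma
    module, which is a scalar. *)
Lemma TI2_casimir k v : (k <= N)%N ->
  \sum_(j < n) TI2 k (x_ j) (x_ j) v + \sum_(al <- roots) TI2 k (e_ (- al)) (e_ al) v
  = (dotw lam`_k lam`_k - dotw (toC (rho D)) (toC (rho D))) *: T v.
Proof.
move=> kN.
pose P (w : ix) k' (hk : (k' <= N)%N) m : M 0%N :=
  \sum_(j < n) Psi_ins Psi (@ins2 _ _ _ _ _ k (x_ j) (x_ j)) w hk m
  + \sum_(al <- roots) Psi_ins Psi (@ins2 _ _ _ _ _ k (e_ (- al)) (e_ al)) w hk m.
pose c : C := dotw lam`_k lam`_k - dotw (toC (rho D)) (toC (rho D)).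
pose Q (w : ix) k' (hk : (k' <= N)%N) m : M 0%N := c *: Psi_comp Psi w hk m.
have PQ w m : P w N (leqnn N) m = Q w N (leqnn N) m.
  apply: (@transported_eq _ _ _ _ _ _ Psi P Q k) => //.
  - move=> {}w k' hk {}m kk'; rewrite /P; congr (_ + _); apply: eq_bigr => i _.
      by apply: (@transported_Psi_ins2 _ _ _ _ _ _ Psi k k).
    by apply: (@transported_Psi_ins2 _ _ _ _ _ _ Psi k k).
  - move=> {}w hi {}m; rewrite /Q.
    have -> : P w k hi m =
        \sum_(j < n) Psi_comp Psi w hi (verma_act (x_ j) (verma_act (x_ j) m))
        + \sum_(al <- roots)
            Psi_comp Psi w hi (verma_act (e_ (- al)) (verma_act (e_ al) m)).
      by congr (_ + _); apply: eq_bigr => i _; exact: Psi_ins2_at.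
    have Psum I (s : seq I) (F : I -> M k) :
        \sum_(i <- s) Psi_comp Psi w hi (F i) = Psi_comp Psi w hi (\sum_(i <- s) F i).
      have := Psi_comp_sum Psi w hi s (fun=> 1) F.
      under eq_bigr do rewrite scale1r.
      by under [RHS]eq_bigr do rewrite scale1r.
    rewrite !Psum -Psi_comp_add -/(casimir m) casimir_verma.
    have -> : dotw (lam`_k - toC (rho D)) (lam`_k - toC (rho D))
      + 2%:R * dotw (lam`_k - toC (rho D)) (toC (rho D)) = c.
      by rewrite /c !(dotwBl, dotwBr) (dotwC (toC (rho D)) lam`_k); ring.
    have := Psi_comp_linear Psi w hi c m 0.
    have -> : Psi_comp Psi w hi 0 = 0.
      have := Psum bool [::] (fun=> 0); by rewrite !big_nil.
    by rewrite !addr0.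
apply/ffunP => w; apply/matrixP => p q.
have sumE I (s : seq I) (F : I -> TT) : (\sum_(i <- s) F i) w p q = \sum_(i <- s) F i w p q.
  by elim/big_rec2: _ => [|i a b _ <-]; rewrite !ffunE !mxE.
have addE (a b : TT) : (a + b) w p q = a w p q + b w p q by rewrite ffunE mxE.
have TI2E z y : TI2 k z y v w p q
    = phi_l (Psi_ins Psi (@ins2 _ _ _ _ _ k z y) w (leqnn N) (v q)) p 0.
  by rewrite ffunE mxE.
rewrite addE !sumE.
rewrite (eq_bigr _ (fun (j : 'I_n) _ => TI2E (x_ j) (x_ j))).
rewrite [X in _ + X](eq_bigr _ (fun al _ => TI2E (e_ (- al)) (e_ al))).
have h := congr1 (fun m => phi_l m p 0) (PQ w (v q)).
rewrite /P /Q linearD !linear_sum linearZ !mxE !summxE in h.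
by rewrite !ffunE !mxE; exact: h.
Qed.

End OperatorForm.

(** * The formal equations *)

Section RaySolution.
Variables (R : realType) (n : nat) (D : splitData R n).
Local Notation C := R[i].
Local Notation ws := (wsum (sd_simple D)).
Variables (V : lmodType C) (top : 'rV[C]_n) (l : expo n) (l0 : l != ezero n).
Local Notation al := (ws l).
Local Notation mu_ k := (top - toC (ws k)).
Implicit Types (mu : 'rV[C]_n) (k : expo n).

Definition off_cone mu := forall k, mu <> mu_ k.

Lemma weight_sub k m : ele (emul m l) k ->
  mu_ (esub k (emul m l)) = mu_ k + toC al *+ m.
Proof.
move=> h; rewrite -{2}(esubK h) wsumD wsum_mul toCD toCMn.
by apply/rowP => j; rewrite !mxE; ring.
Qed.

Lemma weight_off k m : ~~ ele (emul m l) k -> off_cone (mu_ k + toC al *+ m).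
Proof.
move=> h p E; have : toC (ws p) + toC al *+ m = toC (ws k).
  have -> : toC (ws p) + toC al *+ m =
      toC (ws k) + ((mu_ k + toC al *+ m) - mu_ p) by zmod.
  by rewrite E subrr addr0.
rewrite -toCMn -toCD -wsum_mul -wsumD => /toC_inj/wsum_inj E'.
by move: h; rewrite -E' eaddC ele_addr.
Qed.

(** A family on all weights that vanishes off the cone turns the condition that [m l] lies below [k]
    into a plain bound on [m], which is the form the ray recursion produces. *)
Lemma fmul_fseries_weight u (F : 'rV[C]_n -> V) k : (forall mu, off_cone mu -> F mu = 0) ->
  fmul (fseries D al u) (fun k => F (mu_ k)) k =
  \sum_(m < (edeg k).+1) u m *: F (mu_ k + toC al *+ m).
Proof.
move=> F0; rewrite fmul_fseries // big_mkcond; apply: eq_bigr => m _.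
case: ifP => h; first by rewrite weight_sub.
by rewrite F0 ?scaler0 //; apply: weight_off; rewrite h.
Qed.

Variables Jp Jm A B : 'rV[C]_n -> V.
Hypothesis JA : forall mu, Jp mu - Jm mu = A mu.
Hypothesis JB : forall mu, Jp (mu - toC al) - Jm (mu + toC al) = B mu.
Hypothesis Jm0 : forall mu, off_cone mu -> Jm mu = 0.
Hypothesis Jp0 : forall mu, off_cone (mu + toC al) -> Jp mu = 0.

(* Alternating [JA] and [JB] climbs the ray [mu + m al], which leaves the cone
   of weights after finitely many steps. *)
Lemma ray_solution k : Jm (mu_ k) =
  \sum_(m < (edeg k).+1)
    ((odd m)%:R *: B (mu_ k + toC al *+ m) - (~~ odd m)%:R *: A (mu_ k + toC al *+ m)).
Proof.
set mu := mu_ k.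
(* The unknown left after [m] steps: an even number of steps ends at a [Jm], an odd number at a [Jp]
   one root lower. *)
pose rest (m : nat) := if odd m then Jp (mu + toC al *+ m - toC al)
                       else Jm (mu + toC al *+ m).
have step m : Jm mu = \sum_(i < m) ((odd i)%:R *: B (mu + toC al *+ i)
    - (~~ odd i)%:R *: A (mu + toC al *+ i)) + rest m.
  elim: m => [|m ->]; first by rewrite big_ord0 add0r /rest mulr0n addr0.
  rewrite big_ord_recr /= -addrA; congr (_ + _); rewrite /rest /=.
  have aS : mu + toC al *+ m.+1 = mu + toC al *+ m + toC al by rewrite mulrSr addrA.
  case: (odd m) => /=; rewrite aS scale1r scale0r.
    by rewrite -JB; zmod.
  by rewrite addrK -JA; zmod.
have off : off_cone (mu + toC al *+ (edeg k).+1).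
  apply: weight_off; apply/negP => /ele_edeg; rewrite edeg_mul.
  by rewrite leqNgt leq_pmulr ?edeg_gt0.
rewrite {1}(step (edeg k).+1) /rest.
by case: (odd _); rewrite ?Jm0 ?Jp0 ?addrNK ?addr0.
Qed.

End RaySolution.

(** * The Casimir difference and the insertions of root vectors *)

Section FormalEquations.
Variables (R : realType) (n : nat) (D : splitData R n).
Variables (N : nat) (U : 'I_N -> lieRep (@in_g R n D)).
Variables Vl Vr : lieRep (in_k D).
Local Notation C := R[i].
Local Notation g := (cplx D).
Local Notation roots := (sd_roots D).
Local Notation ws := (wsum (sd_simple D)).
Local Notation x_ j := (cinj (sd_x D)`_j : g).
Local Notation e_ al := (cinj (sd_e D al) : g).
Local Notation y_ al := (y_vec D al).
Variable lam : N.+1.-tuple 'rV[C]_n.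
Local Notation M k := (verma D (lam`_k - toC (rho D))).
Variable phi_l : {linear M 0%N -> 'cV[C]_(rep_dim Vl)}.
Hypothesis phi_lP : hom_k_from_verma phi_l.
Variable phi_r : 'rV[C]_n -> {linear 'cV[C]_(rep_dim Vr) -> M N}.
Hypothesis phi_rP : hom_k_to_compl phi_r.
Variable Psi : forall i : 'I_N, {linear M i.+1 -> {ffun 'I_(rep_dim (U i)) -> M i}}.
Hypothesis PsiP : forall i, hom_g_tensor (Psi i).
Local Notation ix := (tens_ix U).
Local Notation TT := (tens U Vl Vr).
Local Notation T := (@T _ _ _ _ _ Vl Vr _ phi_l Psi).
Local Notation TI := (@TI _ _ _ _ _ Vl Vr _ phi_l Psi).
Local Notation TI2 := (@TI2 _ _ _ _ _ Vl Vr _ phi_l Psi).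
Local Notation top := (lam`_N - toC (rho D)).
Local Notation mu_ k := (top - toC (ws k)).
Let ss : is_semisimple D := @sd_semisimple R n D.

(** Subtracts the Casimir insertions at levels [i.+1] and [i]. The two cross terms of the coproduct
    agree after replacing [al] by [- al], whence the factor 2. *)
Lemma casimir_step (i : 'I_N) v :
  (dotw lam`_i.+1 lam`_i.+1 - dotw lam`_i lam`_i) *: T v =
  \sum_(j < n) act_U i (x_ j) (act_U i (x_ j) (T v))
  + \sum_(al <- roots) act_U i (e_ (- al)) (act_U i (e_ al) (T v))
  + (\sum_(j < n) act_U i (x_ j) (TI i (x_ j) v)
     + \sum_(al <- roots) act_U i (e_ al) (TI i (e_ (- al)) v)) *+ 2.
Proof.
have H1 := TI2_casimir phi_l Psi v (ltn_ord i).
have H0 := TI2_casimir phi_l Psi v (ltnW (ltn_ord i)).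
have -> : (dotw lam`_i.+1 lam`_i.+1 - dotw lam`_i lam`_i) =
  (dotw lam`_i.+1 lam`_i.+1 - dotw (toC (rho D)) (toC (rho D)))
  - (dotw lam`_i lam`_i - dotw (toC (rho D)) (toC (rho D))) by ring.
rewrite scalerBl -H1 -H0.
rewrite (eq_bigr _ (fun (j : 'I_n) _ => TI2_step phi_l PsiP i (x_ j) (x_ j) v)).
rewrite [X in _ + X - _](eq_bigr _ (fun al _ => TI2_step phi_l PsiP i (e_ (- al)) (e_ al) v)).
rewrite !big_split /=.
have -> : \sum_(al <- roots) act_U i (e_ (- al)) (TI i (e_ al) v) =
          \sum_(al <- roots) act_U i (e_ al) (TI i (e_ (- al)) v).
  by rewrite (sum_roots_opp D); apply: eq_bigr => al _; rewrite opprK.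
by rewrite mulr2n; zmod.
Qed.

Definition Phi mu (q : 'I_(rep_dim Vr)) : M N := phi_r mu (delta_mx q 0).
(** Indexed by all weights and not only by exponents, so that a shift by a root carries no side
    condition; off the cone the value is zero. *)
Definition G mu : TT := T (Phi mu).
Definition J z mu : TT := T (fun q => verma_act z (Phi mu q)).

Lemma spherical_coefE k : spherical_coef phi_l Psi phi_r k = G (mu_ k).
Proof. by []. Qed.

Lemma in_wspaceP (la mu : 'rV[C]_n) (m : verma D la) :
  (forall j : 'I_n, verma_act (x_ j) m = mu 0 j *: m) -> in_wspace mu m.
Proof.
move=> h z [z1 z2].
have -> : z = \sum_(j < n)
    (coord (sd_x D) j z.1 +i* coord (sd_x D) j z.2)%C *: x_ j.
  rewrite {1}(cplxE z) {1}(h0_coord z1) {1}(h0_coord z2) !cinj_sum scaler_sumr -big_split.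
  apply: eq_bigr => j _ /=; rewrite !cinjZ scalerA -scalerDl; congr (_ *: _).
  by apply/eqP; rewrite eq_complex /=; apply/andP; split; apply/eqP; ring.
have evwE : evw mu (\sum_(j < n)
    (coord (sd_x D) j z.1 +i* coord (sd_x D) j z.2)%C *: x_ j) =
    \sum_(j < n) (coord (sd_x D) j z.1 +i* coord (sd_x D) j z.2)%C * mu 0 j.
  have evwD c (a b : g) : evw mu (c *: a + b) = c * evw mu a + evw mu b.
    have cE (j : 'I_n) :
        (coord (sd_x D) j (c *: a + b).1 +i* coord (sd_x D) j (c *: a + b).2)%C =
        c * (coord (sd_x D) j a.1 +i* coord (sd_x D) j a.2)%C
        + (coord (sd_x D) j b.1 +i* coord (sd_x D) j b.2)%C.
      case: c => c1 c2.
      have -> : ((c1 +i* c2)%C *: a + b).1 = c1 *: a.1 - c2 *: a.2 + b.1 by [].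
      have -> : ((c1 +i* c2)%C *: a + b).2 = c1 *: a.2 + c2 *: a.1 + b.2 by [].
      rewrite !linearD linearN !linearZ.
      have scE (t : R) (y : R^o) : t *: y = t * y by [].
      by apply/eqP; rewrite eq_complex /= ?scE; apply/andP; split; apply/eqP; ring.
    rewrite /evw mulr_sumr -big_split; apply: eq_bigr => j _.
    by rewrite cE mulrDl mulrA.
  elim/big_rec2: _ => [|j a b _ <-]; last by rewrite evwD evw_x.
  have := evwD 1 0 0; rewrite scale1r addr0 mul1r -[X in X = _]addr0 => /addrI <-.
  by [].
rewrite evwE verma_act_suml scaler_suml; apply: eq_bigr => j _.
by rewrite verma_actZl h scalerA.
Qed.

Lemma Phi_wspace mu q : in_wspace mu (Phi mu q).
Proof. by have [h _] := phi_rP; exact: h. Qed.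

Lemma Phi_off mu q : off_cone D top mu -> Phi mu q = 0.
Proof. by move=> h; apply: (wspace_support (@Phi_wspace mu q)). Qed.

Lemma J_off z mu : off_cone D top mu -> J z mu = 0.
Proof.
move=> h; rewrite /J (@T_ext _ _ _ _ _ _ _ _ _ _ _ (fun=> 0)) ?T0 // => q.
by rewrite Phi_off // linear0.
Qed.

Lemma G_off mu : off_cone D top mu -> G mu = 0.
Proof.
move=> h; rewrite /G (@T_ext _ _ _ _ _ _ _ _ _ _ _ (fun=> 0)) ?T0 // => q.
by rewrite Phi_off.
Qed.

Lemma e_Phi_wspace al mu q : al \in roots ->
  in_wspace (mu + toC al) (verma_act (e_ al) (Phi mu q)).
Proof.
move=> ral; apply: in_wspaceP => j; rewrite act_x_e // (act_x_wspace _ (@Phi_wspace mu q)).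
by rewrite verma_act_scale -scalerDl; congr (_ *: _); rewrite [RHS]mxE.
Qed.

Lemma J_e_off al mu : al \in roots -> off_cone D top (mu + toC al) -> J (e_ al) mu = 0.
Proof.
move=> ral h; rewrite /J (@T_ext _ _ _ _ _ _ _ _ _ _ _ (fun=> 0)) ?T0 // => q.
exact: (wspace_support (e_Phi_wspace mu q ral)).
Qed.

Lemma J_x (j : 'I_n) mu : J (x_ j) mu = mu 0 j *: G mu.
Proof.
rewrite -[RHS]addr0 -(@T0 _ _ D N U Vl Vr lam phi_l Psi) -T_linear; apply: T_ext => q.
by rewrite (act_x_wspace _ (@Phi_wspace mu q)) addr0.
Qed.

Lemma T_Vr (f : 'cV[C]_(rep_dim Vr) -> M N) z : linear f ->
  T (fun q => f (Vr z *m delta_mx q 0)) = - act_r z (T (fun q => f (delta_mx q 0))).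
Proof.
move=> lf; apply/ffunP => w; rewrite !ffunE opprK; apply/matrixP => p q; rewrite !mxE.
have -> : Vr z *m delta_mx q 0 = \sum_r Vr z r q *: delta_mx r 0 :> 'cV_(rep_dim Vr).
  apply/colP => r; rewrite !mxE summxE (bigD1 q) //= !mxE !eqxx mulr1 big1 ?addr0.
    rewrite (bigD1 r) //= !mxE !eqxx mulr1 big1 ?addr0 // => r' nr.
    by rewrite !mxE eq_sym (negPf nr) mulr0.
  by move=> r' nr; rewrite !mxE (negPf nr) mulr0.
rewrite (linf_sum lf); under eq_bigr do rewrite (linfZ lf).
rewrite Psi_comp_sum linear_sum summxE; apply: eq_bigr => r _.
by rewrite linearZ !mxE mulrC.
Qed.

Lemma phi_r_linear mu : linear (phi_r mu). Proof. by move=> c u v; rewrite linearP. Qed.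

(** Equivariance of [phi_r] under [y_al]. In the completion the two root components reach the weight
    [mu] from opposite sides, which separates the weights of the two insertions. *)
Lemma J_right al mu : al \in roots ->
  J (e_ al) (mu - toC al) - J (e_ (- al)) (mu + toC al) = - act_r (y_ al) (G mu).
Proof.
move=> ral; rewrite -(T_Vr _ (phi_r_linear mu)) /J -TB; apply: T_ext => q.
have [_ h] := phi_rP; rewrite (h _ _ _ (y_vec_in_k ral)).
by rewrite compl_act_y.
Qed.

Lemma J_left al mu : al \in roots ->
  J (e_ al) mu - J (e_ (- al)) mu = k_act (y_ al) (G mu).
Proof.
move=> ral; rewrite -T_k //; last exact: y_vec_in_k.
by rewrite /J -TB; apply: T_ext => q; rewrite verma_actBl.
Qed.

(** For a positive root this is [ray_solution], whose odd and even steps assemble into the two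
    series. A negative root reduces through [J_left] to its opposite, and [fgeomD] accounts for the
    change of expansion. *)
Lemma J_solution al k : al \in roots -> J (e_ (- al)) (mu_ k) =
  fmul (fcsch D al) (fun k => - act_r (y_ al) (G (mu_ k))) k
  - fmul (fgeom D al) (fun k => k_act (y_ al) (G (mu_ k))) k.
Proof.
have main be : be \in roots -> positive D be -> J (e_ (- be)) (mu_ k) =
    fmul (fcsch D be) (fun k => - act_r (y_ be) (G (mu_ k))) k
    - fmul (fgeom D be) (fun k => k_act (y_ be) (G (mu_ k))) k.
  move=> rbe pbe; have [l lE l0] := positive_expo rbe pbe.
  rewrite fcsch_pos // fgeom_pos //.
  have B0 mu : off_cone D top mu -> - act_r (y_ be) (G mu) = 0.
    by move=> /G_off->; rewrite act_r0 oppr0.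
  have A0 mu : off_cone D top mu -> k_act (y_ be) (G mu) = 0.
    by move=> /[dup] /J_off h1 /J_off h2; rewrite -J_left // h1 h2 subrr.
  have := @ray_solution _ _ D _ top l l0 (J (e_ be)) (J (e_ (- be)))
    (fun mu => k_act (y_ be) (G mu)) (fun mu => - act_r (y_ be) (G mu)).
  rewrite -lE => ->; rewrite ?lE.
  - rewrite (@fmul_fseries_weight _ _ D _ top l l0 _ (fun mu => - act_r (y_ (ws l)) (G mu))); last by rewrite -lE.
    rewrite (@fmul_fseries_weight _ _ D _ top l l0 _ (fun mu => k_act (y_ (ws l)) (G mu))); last by rewrite -lE.
    by rewrite -sumrB.
  - by move=> mu; rewrite -lE J_left.
  - by move=> mu; rewrite -lE J_right.
  - by move=> mu; apply: J_off.
  - by move=> mu; rewrite -lE; apply: J_e_off.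
move=> ral; case: (boolP (positive D al)) => [|npal]; first exact: main.
pose be := - al; have alE : al = - be by rewrite opprK.
have rbe : be \in roots by rewrite root_opp.
have pbe : positive D be by rewrite positiveN.
have yN (mu : 'rV[C]_n) : act_r (y_ al) (G mu) = - act_r (y_ be) (G mu).
  apply: oppr_inj; rewrite opprK -J_right // -[act_r _ _]opprK -J_right //.
  by rewrite /be toCN !opprK; zmod.
have kN (mu : 'rV[C]_n) : k_act (y_ al) (G mu) = - k_act (y_ be) (G mu).
  by rewrite -!J_left // /be opprK; zmod.
have -> : J (e_ (- al)) (mu_ k) = J (e_ (- be)) (mu_ k) + k_act (y_ be) (G (mu_ k)).
  by rewrite -J_left // /be opprK; zmod.
rewrite main //.
have -> : fmul (fcsch D al) (fun k => - act_r (y_ al) (G (mu_ k))) k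
    = fmul (fcsch D be) (fun k => - act_r (y_ be) (G (mu_ k))) k.
  transitivity (- fmul (fcsch D al) (fun k => - act_r (y_ be) (G (mu_ k))) k).
    by rewrite -fmulNr; apply: fmul_ext => // p; rewrite yN.
  rewrite alE fcsch_neg // fcsch_pos //; have [l lE l0] := positive_expo rbe pbe.
  rewrite lE !fmul_fseries // -sumrN; apply: eq_bigr => m _.
  by rewrite scaleNr opprK.
have -> : fmul (fgeom D al) (fun k => k_act (y_ al) (G (mu_ k))) k
    = - fmul (fgeom D (- be)) (fun k => k_act (y_ be) (G (mu_ k))) k.
  by rewrite -fmulNr alE; apply: fmul_ext => // p; rewrite -alE kN.
rewrite -addrA; congr (_ + _); rewrite opprK.
by rewrite -(fgeomD (fun k => k_act (y_ be) (G (mu_ k))) k rbe); zmod.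
Qed.

End FormalEquations.

(* The computation is carried out in an abstract module: on the tensor space
   itself comparing the various forms of the scaling operation is too slow. *)
Section KzbAlgebra.
Variables (R : realType) (n : nat) (D : splitData R n) (N : nat).
Local Notation C := R[i].
Local Notation g := (cplx D).
Local Notation roots := (sd_roots D).
Local Notation x_ j := (cinj (sd_x D)`_j : g).
Local Notation e_ al := (cinj (sd_e D al) : g).
Local Notation y_ al := (y_vec D al).
Variables (V : lmodType C) (a : 'I_N -> g -> V -> V) (l r : g -> V -> V).
Hypothesis a_lin : forall j z, linear (a j z).
Hypothesis aDl : forall j z y v, a j (z + y) v = a j z v + a j y v.
Hypothesis aBl : forall j z y v, a j (z - y) v = a j z v - a j y v.
Hypothesis a_t_vec : forall j al v, a j (cinj (t_vec (sd_x D) al)) v =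
  \sum_(k < n) toC al 0 k *: a j (x_ k) v.
Hypothesis a_cbr : forall j z y v, a j (cbr z y) v = a j z (a j y v) - a j y (a j z v).
Hypothesis a_comm : forall j k z y v, j != k -> a j z (a k y v) = a k y (a j z v).
Hypothesis la_comm : forall j z y v, l z (a j y v) = a j y (l z v).

(** These stand for quantities at one fixed exponent: [F] is the coefficient of the normalised
    function, [gF] and [cF] its products with the two series of a root, [dF] its derivatives, [X]
    and [Y] the insertions of the [x_j] and of the [e_(- al)] at the top level, multiplied by
    [delta]. *)
Variables (i : 'I_N) (F : V) (gF cF : 'rV[R]_n -> V) (dF X : 'I_n -> V).
Variables (Y : 'rV[R]_n -> V) (ev2 : C).

Hypothesis gFN : forall al, al \in roots -> gF (- al) = F - gF al.
Hypothesis XE : forall j, X j =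
  dF j - \sum_(al <- roots | positive D al) toC al 0 j *: (gF al - 2^-1 *: F).
Hypothesis YE : forall al, al \in roots ->
  Y al = - r (y_ al) (cF al) - (l (y_ al) (gF al) + \sum_(j < N) a j (y_ al) (gF al)).
Hypothesis evE : ev2 *: F =
  \sum_(j < n) a i (x_ j) (a i (x_ j) F)
  + \sum_(al <- roots) a i (e_ (- al)) (a i (e_ al) F)
  + (\sum_(j < n) a i (x_ j) (X j - \sum_(j' < N | (i <= j')%N) a j' (x_ j) F)
     + \sum_(al <- roots) a i (e_ al)
         (Y al - \sum_(j' < N | (i <= j')%N) a j' (e_ (- al)) F)) *+ 2.

Let aD j z u v : a j z (u + v) = a j z u + a j z v. Proof. exact: (linfD (a_lin j z)). Qed.
Let aB j z u v : a j z (u - v) = a j z u - a j z v. Proof. exact: (linfB (a_lin j z)). Qed.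
Let aN j z u : a j z (- u) = - a j z u. Proof. exact: (linfN (a_lin j z)). Qed.
Let aZ j z c u : a j z (c *: u) = c *: a j z u. Proof. exact: (linfZ (a_lin j z)). Qed.
Let as_ j z I (s : seq I) P (f : I -> V) :
  a j z (\sum_(k <- s | P k) f k) = \sum_(k <- s | P k) a j z (f k).
Proof. exact: (linf_sum (a_lin j z)). Qed.

Let sum_ge (f : 'I_N -> V) :
  \sum_(j < N | (i <= j)%N) f j = f i + \sum_(j < N | (i < j)%N) f j.
Proof.
rewrite (bigD1 i) //=; congr (_ + _); apply: eq_bigl => j.
by rewrite ltn_neqAle andbC -val_eqE eq_sym.
Qed.

Let sum_lt (f : 'I_N -> V) : \sum_(j < N) f j =
  \sum_(j < N | (j < i)%N) f j + (f i + \sum_(j < N | (i < j)%N) f j).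
Proof.
rewrite (bigID (fun j : 'I_N => (j < i)%N)) /= -sum_ge; congr (_ + _).
by apply: eq_bigl => j; rewrite -leqNgt.
Qed.

Let Tt := \sum_(al <- roots | positive D al)
  a i (cinj (t_vec (sd_x D) al)) (gF al - 2^-1 *: F).
Let XX := \sum_(j < n) a i (x_ j) (a i (x_ j) F).
Let EE := \sum_(al <- roots) a i (e_ (- al)) (a i (e_ al) F).
Let P2 := \sum_(al <- roots) a i (e_ al) (a i (e_ (- al)) (gF al)).

(** Pairing [al] with [- al], the commutator [[e_al, e_(- al)] = t_al] leaves [t_al] applied to
    [gF al - F / 2]. These are the terms that the derivative of [delta] contributes through [XE]
    with the opposite sign. *)
Let P2E : P2 = 2^-1 *: EE + Tt.
Proof.
rewrite /P2 /EE /Tt !(sum_roots_pos D) scaler_sumr -big_split.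
rewrite big_seq_cond [RHS]big_seq_cond; apply: eq_bigr => al /andP[ral pal] /=.
have tE v : a i (cinj (t_vec (sd_x D) al)) v =
    a i (e_ al) (a i (e_ (- al)) v) - a i (e_ (- al)) (a i (e_ al) v).
  by rewrite -a_cbr cbr_cinj sd_e_br.
rewrite tE gFN // opprK !(aB, aZ) scalerDr.
have half (v : V) : v = 2^-1 *: v + 2^-1 *: v.
  by rewrite -scalerDl -[2^-1]mul1r -splitr scale1r.
set u := a i (e_ (- al)) (a i (e_ al) F).
by rewrite {1}(half u); zmod.
Qed.

Lemma kzb_algebra :
  \sum_(j < n) a i (x_ j) (dF j)
  - \sum_(j < N | (j < i)%N)
      \sum_(al <- roots) a j (y_ al) (a i (e_ al) (gF al))
  - (\sum_(al <- roots) l (y_ al) (a i (e_ al) (gF al))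
     + (2^-1 *: \sum_(j < n) a i (x_ j) (a i (x_ j) F)
        + \sum_(al <- roots) a i (e_ al) (a i (e_ al) (gF al)))
     + \sum_(al <- roots) a i (e_ al) (r (y_ al) (cF al)))
  - \sum_(j < N | (i < j)%N)
      (\sum_(k < n) a i (x_ k) (a j (x_ k) F)
       + \sum_(al <- roots) a i (e_ al + e_ (- al)) (a j (e_ al) (gF al)))
  = (ev2 / 2) *: F.
Proof.
pose E := \sum_(j < n) a i (x_ j) (dF j).
pose S2 := \sum_(j' < N | (i < j')%N) \sum_(j < n) a i (x_ j) (a j' (x_ j) F).
pose Rp := \sum_(j < N | (j < i)%N) \sum_(al <- roots) a j (y_ al) (a i (e_ al) (gF al)).
pose K1 := \sum_(al <- roots) l (y_ al) (a i (e_ al) (gF al)).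
pose K2 := \sum_(al <- roots) a i (e_ al) (a i (e_ al) (gF al)).
pose K3 := \sum_(al <- roots) a i (e_ al) (r (y_ al) (cF al)).
pose Z := \sum_(j < N | (i < j)%N) \sum_(al <- roots)
  a i (e_ al + e_ (- al)) (a j (e_ al) (gF al)).
pose Q := \sum_(j < N | (i < j)%N) \sum_(al <- roots) a i (e_ al) (a j (y_ al) (gF al)).
pose W := \sum_(j < N | (i < j)%N) \sum_(al <- roots) a i (e_ al) (a j (e_ (- al)) F).
have S1E : \sum_(j < n) a i (x_ j) (X j - \sum_(j' < N | (i <= j')%N) a j' (x_ j) F)
    = E - Tt - XX - S2.
  rewrite (eq_bigr (fun j : 'I_n => a i (x_ j) (dF j)
    - \sum_(al <- roots | positive D al) a i (x_ j) (toC al 0 j *: (gF al - 2^-1 *: F))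
    - a i (x_ j) (a i (x_ j) F)
    - \sum_(j' < N | (i < j')%N) a i (x_ j) (a j' (x_ j) F))); last first.
    by move=> j _; rewrite aB XE aB !as_ sum_ge; zmod.
  rewrite !sumrB.
  have -> : \sum_(j < n) \sum_(j' < N | (i < j')%N) a i (x_ j) (a j' (x_ j) F) = S2.
    by rewrite exchange_big.
  have -> : \sum_(j < n) \sum_(al <- roots | positive D al)
      a i (x_ j) (toC al 0 j *: (gF al - 2^-1 *: F)) = Tt.
    rewrite exchange_big /Tt; apply: eq_bigr => al _.
    by rewrite a_t_vec; apply: eq_bigr => j _; rewrite aZ.
  by rewrite -/E -/XX; zmod.
have EEr : \sum_(al <- roots) a i (e_ al) (a i (e_ (- al)) F) = EE.
  by rewrite /EE [RHS](sum_roots_opp D); apply: eq_bigr => al _; rewrite opprK.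
have P_E : \sum_(al <- roots) a i (e_ al) (a i (y_ al) (gF al)) = K2 - P2.
  rewrite /K2 /P2 -sumrB; apply: eq_bigr => al _.
  by rewrite /y_vec aBl aB.
(* The action of [y_al] inside [Y] is sorted by position: the left end gives [K1], factors before
   [i] give [Rp], the factor [i] itself gives [K2 - P2], and factors after [i] give [Q]. *)
have S3E : \sum_(al <- roots) a i (e_ al)
    (Y al - \sum_(j' < N | (i <= j')%N) a j' (e_ (- al)) F)
    = - K3 - K1 - Rp - (K2 - P2) - Q - EE - W.
  rewrite -P_E -EEr /K3 /K1 /Rp /Q /W exchange_big [X in _ - X - _ - _]exchange_big.
  rewrite [X in _ - X]exchange_big -!sumrN -!big_split.
  rewrite big_seq [RHS]big_seq; apply: eq_bigr => al ral /=.
  rewrite aB YE // sum_ge sum_lt !(aB, aN, aD, as_).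
  have -> : a i (e_ al) (l (y_ al) (gF al)) = l (y_ al) (a i (e_ al) (gF al)).
    by rewrite la_comm.
  have -> : \sum_(j < N | (j < i)%N) a i (e_ al) (a j (y_ al) (gF al)) =
            \sum_(j < N | (j < i)%N) a j (y_ al) (a i (e_ al) (gF al)).
    apply: eq_bigr => j ji; rewrite a_comm // -val_eqE /=.
    by rewrite gtn_eqF.
  zmod.
(* The unequal shapes of the two [r] operators are reconciled here: in the part with [e_(- al)] the
   sign of the root is changed and [gFN] applied. *)
have ZE : Z = Q + W.
  rewrite /Z /Q /W -big_split; apply: eq_bigr => j ij /=.
  under eq_bigr do rewrite aDl.
  rewrite big_split /=.
  have -> : \sum_(al <- roots) a i (e_ (- al)) (a j (e_ al) (gF al)) =
     \sum_(al <- roots) (a i (e_ al) (a j (e_ (- al)) F)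
                         - a i (e_ al) (a j (e_ (- al)) (gF al))).
    rewrite (sum_roots_opp D) big_seq [RHS]big_seq; apply: eq_bigr => al ral.
    by rewrite opprK gFN // !aB.
  rewrite -!big_split; apply: eq_bigr => al _ /=.
  by rewrite /y_vec aBl aB; zmod.
have half (v : V) : v = 2^-1 *: v + 2^-1 *: v.
  by rewrite -scalerDl -[2^-1]mul1r -splitr scale1r.
have -> : (ev2 / 2) *: F = 2^-1 *: XX + 2^-1 *: EE
    + ((E - Tt - XX - S2) + (- K3 - K1 - Rp - (K2 - P2) - Q - EE - W)).
  have twice (v : V) : 2^-1 *: (v *+ 2) = v by rewrite mulr2n scalerDr -half.
  by rewrite -S1E -S3E mulrC -scalerA evE scalerDr twice scalerDr.
have -> : \sum_(j < N | (i < j)%N)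
      (\sum_(k < n) a i (x_ k) (a j (x_ k) F)
       + \sum_(al <- roots) a i (e_ al + e_ (- al)) (a j (e_ al) (gF al)))
    = S2 + Z by rewrite big_split.
rewrite -/E -/Rp -/K1 -/K2 -/K3 -/XX ZE P2E.
move: (half XX) (half EE); move: (2^-1 *: XX) (2^-1 *: EE) => hX hE -> ->.
by zmod.
Qed.

End KzbAlgebra.

(** * Multiplication by [delta] and the formal theorem *)

Section FormalTheorem.
Variables (R : realType) (n : nat) (D : splitData R n).
Variables (N : nat) (U : 'I_N -> lieRep (@in_g R n D)).
Variables Vl Vr : lieRep (in_k D).
Local Notation C := R[i].
Local Notation g := (cplx D).
Local Notation roots := (sd_roots D).
Local Notation ws := (wsum (sd_simple D)).
Local Notation x_ j := (cinj (sd_x D)`_j : g).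
Local Notation e_ al := (cinj (sd_e D al) : g).
Local Notation y_ al := (y_vec D al).
Variable lam : N.+1.-tuple 'rV[C]_n.
Local Notation M k := (verma D (lam`_k - toC (rho D))).
Variable phi_l : {linear M 0%N -> 'cV[C]_(rep_dim Vl)}.
Hypothesis phi_lP : hom_k_from_verma phi_l.
Variable phi_r : 'rV[C]_n -> {linear 'cV[C]_(rep_dim Vr) -> M N}.
Hypothesis phi_rP : hom_k_to_compl phi_r.
Variable Psi : forall i : 'I_N, {linear M i.+1 -> {ffun 'I_(rep_dim (U i)) -> M i}}.
Hypothesis PsiP : forall i, hom_g_tensor (Psi i).
Local Notation TT := (tens U Vl Vr).
Local Notation G := (G phi_l phi_r Psi).
Local Notation J := (J phi_l phi_r Psi).
Local Notation top := (lam`_N - toC (rho D)).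
Local Notation mu_ k := (top - toC (ws k)).
Local Notation F := (spherical phi_l Psi phi_r).
Local Notation d := (fdelta D).
Local Notation Gs := (fun k => G (mu_ k)).

Lemma fmul_act_U (f : expo n -> C) i z (H : expo n -> TT) k :
  fmul f (fun p => act_U i z (H p)) k = act_U i z (fmul f H k).
Proof. exact: fmul_linear (act_U_is_linear i z). Qed.

Lemma fmul_act_l (f : expo n -> C) z (H : expo n -> TT) k :
  fmul f (fun p => act_l z (H p)) k = act_l z (fmul f H k).
Proof. exact: fmul_linear (act_l_is_linear z). Qed.

Lemma fmul_act_r (f : expo n -> C) z (H : expo n -> TT) k :
  fmul f (fun p => act_r z (H p)) k = act_r z (fmul f H k).
Proof. exact: fmul_linear (act_r_is_linear z). Qed.

Lemma fmul_k_act (f : expo n -> C) z (H : expo n -> TT) k :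
  fmul f (fun p => k_act z (H p)) k = k_act z (fmul f H k).
Proof.
rewrite /k_act fmulDr fmul_act_l fmul_sumr; congr (_ + _).
by apply: eq_bigr => j _; rewrite fmul_act_U.
Qed.

Lemma spherical_Y al k : al \in roots ->
  fmul d (fun p => J (e_ (- al)) (mu_ p)) k =
  - act_r (y_ al) (fmul (fcsch D al) F k) - k_act (y_ al) (fmul (fgeom D al) F k).
Proof.
move=> ral.
rewrite (fmul_ext (g := d) (G := fun p =>
   fmul (fcsch D al) (fun k => - act_r (y_ al) (G (mu_ k))) p
  - fmul (fgeom D al) (fun k => k_act (y_ al) (G (mu_ k))) p) k (fun=> erefl)); last first.
  by move=> p; rewrite (J_solution phi_lP phi_rP PsiP).
rewrite fmulBr; congr (_ - _); rewrite fmul_comm.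
  transitivity (fmul (fcsch D al) (fun p => - act_r (y_ al) (F p)) k).
    by apply: fmul_ext => // p; rewrite fmulNr fmul_act_r.
  by rewrite fmulNr fmul_act_r.
transitivity (fmul (fgeom D al) (fun p => k_act (y_ al) (F p)) k).
  by apply: fmul_ext => // p; rewrite fmul_k_act.
by rewrite fmul_k_act.
Qed.

(** The leading exponent changes from [lam_N - rho] to [lam_N]. With [rho] as half the sum of the
    positive roots, this turns the subtracted [F k] of [fderiv_fdelta] into half of it. *)
Lemma spherical_X (j : 'I_n) k : fmul d (fun p => J (x_ j) (mu_ p)) k =
  fderiv D lam`_N j F k
  - \sum_(al <- roots | positive D al)
      toC al 0 j *: (fmul (fgeom D al) F k - 2^-1 *: F k).
Proof.
rewrite (fmul_ext (g := d) (G := fderiv D top j Gs) k (fun=> erefl)); last first.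
  by move=> p; rewrite (J_x phi_l phi_rP).
have h := fderiv_fdelta D top j Gs k; rewrite -[X in X = _]addr0.
have E1 : fderiv D top j (fmul d Gs) k = fderiv D lam`_N j F k - toC (rho D) 0 j *: F k.
  by rewrite /fderiv -scalerBl; congr (_ *: _); rewrite !mxE; ring.
have E2 : toC (rho D) 0 j = \sum_(al <- roots | positive D al) 2^-1 * toC al 0 j.
  have := congr1 (fun m : 'rV[C]_n => m 0 j) (toC_rho D).
  rewrite mulmxnE summxE -mulr_sumr => <-.
  by rewrite mulr2n mulrDr ![2^-1 * _]mulrC -splitr.
have E3 : \sum_(al <- roots | positive D al)
    toC al 0 j *: (fmul (fgeom D al) F k - 2^-1 *: F k) =
  \sum_(al <- roots | positive D al) toC al 0 j *: (fmul (fgeom D al) F k - F k)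
  + toC (rho D) 0 j *: F k.
  rewrite E2 scaler_suml -big_split; apply: eq_bigr => al _ /=.
  rewrite [2^-1 * _]mulrC -scalerA -scalerDr; congr (_ *: _).
  rewrite -addrA; congr (_ + _); move: (F k) => f.
  have {2}-> : f = 2^-1 *: f + 2^-1 *: f.
    by rewrite -scalerDl -[2^-1]mul1r -splitr scale1r.
  by rewrite opprD addrNK.
rewrite addr0 E3 opprD addrCA addrC -E1 h.
by rewrite addrK.
Qed.

Lemma spherical_casimir (i : 'I_N) k :
  (dotw lam`_i.+1 lam`_i.+1 - dotw lam`_i lam`_i) *: F k =
  \sum_(j < n) act_U i (x_ j) (act_U i (x_ j) (F k))
  + \sum_(al <- roots) act_U i (e_ (- al)) (act_U i (e_ al) (F k))
  + (\sum_(j < n) act_U i (x_ j) (fmul d (fun p => J (x_ j) (mu_ p)) k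
        - \sum_(j' < N | (i <= j')%N) act_U j' (x_ j) (F k))
     + \sum_(al <- roots) act_U i (e_ al) (fmul d (fun p => J (e_ (- al)) (mu_ p)) k
        - \sum_(j' < N | (i <= j')%N) act_U j' (e_ (- al)) (F k))) *+ 2.
Proof.
rewrite -fmulZr.
pose H z p := J z (mu_ p) - \sum_(j' < N | (i <= j')%N) act_U j' z (Gs p).
have HE z : fmul d (fun p => J z (mu_ p)) k
    - \sum_(j' < N | (i <= j')%N) act_U j' z (F k) = fmul d (H z) k.
  rewrite fmulBr fmul_sumr; congr (_ - _); apply: eq_bigr => j' _.
  by rewrite fmul_act_U.
transitivity (fmul d (fun p =>
  \sum_(j < n) act_U i (x_ j) (act_U i (x_ j) (Gs p))
  + \sum_(al <- roots) act_U i (e_ (- al)) (act_U i (e_ al) (Gs p))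
  + ((\sum_(j < n) act_U i (x_ j) (H (x_ j) p)
      + \sum_(al <- roots) act_U i (e_ al) (H (e_ (- al)) p))
     + (\sum_(j < n) act_U i (x_ j) (H (x_ j) p)
      + \sum_(al <- roots) act_U i (e_ al) (H (e_ (- al)) p)))) k).
  apply: fmul_ext => // p; rewrite (casimir_step phi_l PsiP) mulr2n.
  have tiE z : TI phi_l Psi i z (Phi phi_r (mu_ p)) = H z p.
    by rewrite /H /J (TI_high phi_l PsiP z _ (ltnW (ltn_ord i))) addrK.
  have E1 : \sum_(j < n) act_U i (x_ j) (TI phi_l Psi i (x_ j) (Phi phi_r (mu_ p)))
      = \sum_(j < n) act_U i (x_ j) (H (x_ j) p).
    by apply: eq_bigr => j _; rewrite tiE.
  have E2 : \sum_(al <- roots) act_U i (e_ al) (TI phi_l Psi i (e_ (- al)) (Phi phi_r (mu_ p)))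
      = \sum_(al <- roots) act_U i (e_ al) (H (e_ (- al)) p).
    by apply: eq_bigr => al _; rewrite tiE.
  by rewrite E1 E2.
have S1 : fmul d (fun p => \sum_(j < n) act_U i (x_ j) (act_U i (x_ j) (Gs p))) k
    = \sum_(j < n) act_U i (x_ j) (act_U i (x_ j) (F k)).
  by rewrite fmul_sumr; apply: eq_bigr => j _; rewrite !fmul_act_U.
have S2 : fmul d (fun p => \sum_(al <- roots) act_U i (e_ (- al)) (act_U i (e_ al) (Gs p))) k
    = \sum_(al <- roots) act_U i (e_ (- al)) (act_U i (e_ al) (F k)).
  by rewrite fmul_sumr; apply: eq_bigr => j _; rewrite !fmul_act_U.
have S3 : fmul d (fun p => \sum_(j < n) act_U i (x_ j) (H (x_ j) p)) k
    = \sum_(j < n) act_U i (x_ j) (fmul d (fun p => J (x_ j) (mu_ p)) k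
        - \sum_(j' < N | (i <= j')%N) act_U j' (x_ j) (F k)).
  by rewrite fmul_sumr; apply: eq_bigr => j _; rewrite fmul_act_U HE.
have S4 : fmul d (fun p => \sum_(al <- roots) act_U i (e_ al) (H (e_ (- al)) p)) k
    = \sum_(al <- roots) act_U i (e_ al) (fmul d (fun p => J (e_ (- al)) (mu_ p)) k
        - \sum_(j' < N | (i <= j')%N) act_U j' (e_ (- al)) (F k)).
  by rewrite fmul_sumr; apply: eq_bigr => j _; rewrite fmul_act_U HE.
by rewrite !fmulDr S1 S2 S3 S4 mulr2n.
Qed.

Lemma kzb_formal_spherical (i : 'I_N) k :
  kzb_formal lam`_N i F k
  = (dotw lam`_i.+1 lam`_i.+1 / 2 - dotw lam`_i lam`_i / 2) *: F k.
Proof.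
rewrite -mulrBl.
have tU j al (v : TT) : act_U j (cinj (t_vec (sd_x D) al)) v =
    \sum_(k < n) toC al 0 k *: act_U j (x_ k) v.
  rewrite cinj_sum act_U_suml; apply: eq_bigr => m _.
  by rewrite cinjZ act_UZl toCE.
apply: (@kzb_algebra _ _ D N TT (@act_U _ _ D N U Vl Vr) (@act_l _ _ D N U Vl Vr)
  (@act_r _ _ D N U Vl Vr) (@act_U_is_linear _ _ _ _ _ _ _)
  (@act_UDl _ _ _ _ _ _ _) (@act_UBl _ _ _ _ _ _ _) tU
  (@act_U_cbr _ _ _ _ _ _ _) (@act_U_comm _ _ _ _ _ _ _)
  (fun j z y v => act_lU j z y v) i (F k)
  (fun al => fmul (fgeom D al) F k) (fun al => fmul (fcsch D al) F k)
  (fun j => fderiv D lam`_N j F k) (fun j => fmul d (fun p => J (x_ j) (mu_ p)) k)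
  (fun al => fmul d (fun p => J (e_ (- al)) (mu_ p)) k)).
- by move=> al ral; rewrite -(fgeomD F k ral) addrC addKr.
- by move=> j; rewrite spherical_X.
- by move=> al ral; rewrite spherical_Y.
- exact: spherical_casimir.
Qed.

End FormalTheorem.

(** * Growth of the coefficients *)

Section ComplexNorm.
Variable R : realType.
Local Notation C := R[i].
Implicit Types x y z : C.

(** The modulus as an element of [R], since the order of [R[i]] is only partial. *)
Definition cn z : R := complex.Re `|z|.

Lemma cnE z : `|z| = (cn z)%:C%C.
Proof. by rewrite /cn normc_def. Qed.

Lemma cn_ge0 z : 0 <= cn z.
Proof. by have := normr_ge0 z; rewrite cnE ler0c. Qed.

Lemma cn0 : cn 0 = 0. Proof. by rewrite /cn normr0. Qed.
Lemma cn1 : cn 1 = 1. Proof. by rewrite /cn normr1. Qed.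

Lemma cnM x y : cn (x * y) = cn x * cn y.
Proof. by apply: (@complexI R); rewrite -cnE normrM !cnE -rmorphM. Qed.

Lemma cnD x y : cn (x + y) <= cn x + cn y.
Proof. by have := ler_normD x y; rewrite !cnE -rmorphD lecR. Qed.

Lemma cnN x : cn (- x) = cn x. Proof. by rewrite /cn normrN. Qed.

Lemma cnB x y : cn (x - y) <= cn x + cn y.
Proof. by apply: le_trans (cnD _ _) _; rewrite cnN. Qed.

Lemma cnV x : cn x^-1 = (cn x)^-1.
Proof. by apply: (@complexI R); rewrite -cnE normfV cnE fmorphV. Qed.

Lemma cn_real (a : R) : cn a%:C%C = `|a|.
Proof. by apply: (@complexI R); rewrite -cnE normc_def /= expr0n /= addr0 sqrtr_sqr. Qed.

Lemma cn_nat (m : nat) : cn m%:R = m%:R.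
Proof. by rewrite -(rmorph_nat (real_complex R)) cn_real ger0_norm. Qed.

Lemma cnX x m : cn (x ^+ m) = cn x ^+ m.
Proof. by elim: m => [|m IH]; rewrite ?expr0 ?cn1 // !exprS cnM IH. Qed.

Lemma cn_sum I (s : seq I) P (F : I -> C) :
  cn (\sum_(i <- s | P i) F i) <= \sum_(i <- s | P i) cn (F i).
Proof.
elim/big_rec2: _ => [|i a b _ h]; first by rewrite cn0.
by apply: le_trans (cnD _ _) _; rewrite lerD2l.
Qed.

Lemma cn_prod I (s : seq I) P (F : I -> C) :
  cn (\prod_(i <- s | P i) F i) = \prod_(i <- s | P i) cn (F i).
Proof. by elim/big_rec2: _ => [|i a b _ <-]; rewrite ?cn1 // cnM. Qed.

Lemma cn_Re z : `|complex.Re z| <= cn z.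
Proof.
rewrite /cn normc_def; case: z => a b /=.
by rewrite -sqrtr_sqr ler_sqrt ?lerDl ?sqr_ge0 // addr_ge0 ?sqr_ge0.
Qed.

Lemma cn_Im z : `|complex.Im z| <= cn z.
Proof.
rewrite /cn normc_def; case: z => a b /=.
by rewrite -sqrtr_sqr ler_sqrt ?lerDr ?sqr_ge0 // addr_ge0 ?sqr_ge0.
Qed.

End ComplexNorm.

Lemma le_sum1 (R : realType) (I : finType) (f : I -> R) i :
  (forall j, 0 <= f j) -> f i <= \sum_j f j.
Proof. by move=> f0; rewrite (bigD1 i) //= lerDl sumr_ge0. Qed.

Section TensorNorm.
Variables (R : realType) (n : nat) (D : splitData R n).
Variables (N : nat) (U : 'I_N -> lieRep (@in_g R n D)).
Variables Vl Vr : lieRep (in_k D).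
Local Notation TT := (tens U Vl Vr).
Implicit Types t u : TT.

Definition tnorm t : R := \sum_w \sum_p \sum_q cn (t w p q).

Lemma tnorm_ge0 t : 0 <= tnorm t.
Proof. by do 3 apply: sumr_ge0 => ? _; exact: cn_ge0. Qed.

Lemma tnorm0 : tnorm 0 = 0.
Proof. by do 3 apply: big1 => ? _; rewrite ffunE mxE cn0. Qed.

Lemma tnormD t u : tnorm (t + u) <= tnorm t + tnorm u.
Proof.
rewrite /tnorm -big_split; apply: ler_sum => w _ /=.
rewrite -big_split; apply: ler_sum => p _ /=.
rewrite -big_split; apply: ler_sum => q _ /=.
by rewrite ffunE mxE cnD.
Qed.

Lemma tnormZ c t : tnorm (c *: t) = cn c * tnorm t.
Proof.
rewrite /tnorm mulr_sumr; apply: eq_bigr => w _; rewrite mulr_sumr.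
apply: eq_bigr => p _; rewrite mulr_sumr; apply: eq_bigr => q _.
by rewrite ffunE mxE cnM.
Qed.

Lemma tnormN t : tnorm (- t) = tnorm t.
Proof. by rewrite -scaleN1r tnormZ cnN cn1 mul1r. Qed.

Lemma tnormB t u : tnorm (t - u) <= tnorm t + tnorm u.
Proof. by apply: le_trans (tnormD _ _) _; rewrite tnormN. Qed.

Lemma tnorm_sum I (s : seq I) P (F : I -> TT) :
  tnorm (\sum_(i <- s | P i) F i) <= \sum_(i <- s | P i) tnorm (F i).
Proof.
elim/big_rec2: _ => [|i a b _ h]; first by rewrite tnorm0.
by apply: le_trans (tnormD _ _) _; rewrite lerD2l.
Qed.

Lemma tnorm_entry t w p q : cn (t w p q) <= tnorm t.
Proof.
apply: le_trans (le_sum1 (f := fun q => cn (t w p q)) q _) _ => [?|]; first exact: cn_ge0.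
apply: le_trans (le_sum1 (f := fun p => \sum_q cn (t w p q)) p _) _ => [?|].
  by apply: sumr_ge0 => ? _; exact: cn_ge0.
apply: (le_sum1 (f := fun w => \sum_p \sum_q cn (t w p q))) => ?.
by do 2 apply: sumr_ge0 => ? _; exact: cn_ge0.
Qed.

Definition tunit w p q : TT :=
  [ffun w' => if w' == w then delta_mx p q else 0].

Lemma tens_decomp t : t = \sum_w \sum_p \sum_q t w p q *: tunit w p q.
Proof.
apply/ffunP => w; rewrite sum_ffunE (bigD1 w) //= [X in _ = _ + X]big1 => [|w' nw].
  rewrite addr0 sum_ffunE [LHS]matrix_sum_delta; apply: eq_bigr => p _.
  by rewrite sum_ffunE; apply: eq_bigr => q _; rewrite !ffunE eqxx.
rewrite sum_ffunE big1 // => p _; rewrite sum_ffunE big1 // => q _.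
by rewrite !ffunE eq_sym (negPf nw) scaler0.
Qed.

Lemma tnorm_bounded (f : TT -> TT) : linear f ->
  exists2 K : R, 0 <= K & forall t, tnorm (f t) <= K * tnorm t.
Proof.
move=> lf; pose K := \sum_w \sum_p \sum_q tnorm (f (tunit w p q)).
have K0 : 0 <= K by do 3 apply: sumr_ge0 => ? _; exact: tnorm_ge0.
have KE w p q : tnorm (f (tunit w p q)) <= K.
  apply: le_trans (le_sum1 (f := fun q => tnorm (f (tunit w p q))) q _) _ => [?|].
    exact: tnorm_ge0.
  apply: le_trans (le_sum1 (f := fun p => \sum_q tnorm (f (tunit w p q))) p _) _ => [?|].
    by apply: sumr_ge0 => ? _; exact: tnorm_ge0.
  apply: (le_sum1 (f := fun w => \sum_p \sum_q tnorm (f (tunit w p q)))) => ?.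
  by do 2 apply: sumr_ge0 => ? _; exact: tnorm_ge0.
exists K => // t; rewrite {1}(tens_decomp t) (linf_sum lf) /tnorm mulr_sumr.
apply: le_trans (tnorm_sum _ _ _) _; apply: ler_sum => w _.
rewrite (linf_sum lf) mulr_sumr; apply: le_trans (tnorm_sum _ _ _) _.
apply: ler_sum => p _; rewrite (linf_sum lf) mulr_sumr.
apply: le_trans (tnorm_sum _ _ _) _; apply: ler_sum => q _.
by rewrite (linfZ lf) tnormZ mulrC ler_wpM2r ?cn_ge0.
Qed.

End TensorNorm.

Lemma dotw_toC (R : realType) n (a b : 'rV[R]_n) : dotw (toC a) (toC b) = (dotw a b)%:C%C.
Proof. by rewrite /dotw rmorph_sum; apply: eq_bigr => j _; rewrite !toCE rmorphM. Qed.

Lemma dotwMnr (K : comNzRingType) n (a b : 'rV[K]_n) m : dotw a (b *+ m) = dotw a b *+ m.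
Proof. by rewrite -scaler_nat dotwZr mulr_natl. Qed.

Lemma shift_sum (R : realType) (h : nat -> R) t m m' : (forall i, 0 <= h i) ->
  (t + m <= m')%N -> \sum_(s < m) h (t + s)%N <= \sum_(s < m') h s.
Proof.
move=> h0 le; rewrite -(big_mkord xpredT h) (@big_cat_nat _ _ _ (t + m)%N) //=.
rewrite (@big_cat_nat _ _ _ t) ?leq_addr //=.
have -> : \sum_(t <= i < t + m) h i = \sum_(s < m) h (t + s)%N.
  rewrite -[X in \sum_(X <= _ < _) _]add0n big_addn addKn big_mkord.
  by apply: eq_bigr => s _; rewrite addnC.
by rewrite addrAC lerDr addr_ge0 // sumr_ge0.
Qed.

Lemma pair_sum (R : realType) (h : nat -> R) m :
  \sum_(s < m) (h s.*2 + h s.*2.+1) = \sum_(s < 2 * m) h s.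
Proof.
elim: m => [|m IH]; first by rewrite !big_ord0.
by rewrite big_ord_recr /= IH mulnS !big_ord_recr /= mul2n addrA.
Qed.

(** * Double insertions bounded by sums over rays *)

Section Growth.
Variables (R : realType) (n : nat) (D : splitData R n).
Variables (N : nat) (U : 'I_N -> lieRep (@in_g R n D)).
Variables Vl Vr : lieRep (in_k D).
Local Notation C := R[i].
Local Notation g := (cplx D).
Local Notation roots := (sd_roots D).
Local Notation ws := (wsum (sd_simple D)).
Local Notation x_ j := (cinj (sd_x D)`_j : g).
Local Notation e_ al := (cinj (sd_e D al) : g).
Local Notation y_ al := (y_vec D al).
Variable lam : N.+1.-tuple 'rV[C]_n.
Local Notation M k := (verma D (lam`_k - toC (rho D))).
Variable phi_l : {linear M 0%N -> 'cV[C]_(rep_dim Vl)}.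
Hypothesis phi_lP : hom_k_from_verma phi_l.
Variable phi_r : 'rV[C]_n -> {linear 'cV[C]_(rep_dim Vr) -> M N}.
Hypothesis phi_rP : hom_k_to_compl phi_r.
Variable Psi : forall i : 'I_N, {linear M i.+1 -> {ffun 'I_(rep_dim (U i)) -> M i}}.
Hypothesis PsiP : forall i, hom_g_tensor (Psi i).
Local Notation TT := (tens U Vl Vr).
Local Notation T := (@T _ _ _ _ _ Vl Vr _ phi_l Psi).
Local Notation G := (G phi_l phi_r Psi).
Local Notation J := (J phi_l phi_r Psi).
Local Notation Phi := (Phi phi_r).
Local Notation top := (lam`_N - toC (rho D)).
Local Notation mu_ k := (top - toC (ws k)).

Definition J2 z y mu : TT := T (fun q => verma_act z (verma_act y (Phi mu q))).

Lemma T_sum I (s : seq I) (v : I -> 'I_(rep_dim Vr) -> M N) :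
  T (fun q => \sum_(i <- s) v i q) = \sum_(i <- s) T (v i).
Proof.
elim: s => [|i s IH].
  by rewrite big_nil -(@T0 _ _ D N U Vl Vr lam phi_l Psi); apply: T_ext => q; rewrite big_nil.
rewrite big_cons -IH -[T (v i)]scale1r -T_linear; apply: T_ext => q.
by rewrite big_cons scale1r.
Qed.

Lemma TD v v' : T (fun q => v q + v' q) = T v + T v'.
Proof.
by rewrite -[T v]scale1r -T_linear; apply: T_ext => q; rewrite scale1r.
Qed.

Lemma TZ c v : T (fun q => c *: v q) = c *: T v.
Proof.
rewrite -[RHS]addr0 -(@T0 _ _ D N U Vl Vr lam phi_l Psi) -T_linear.
by apply: T_ext => q; rewrite addr0.
Qed.

Lemma k_act_is_linear z : linear (@k_act _ _ D _ U Vl Vr z).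
Proof.
move=> c t u; rewrite /k_act act_l_is_linear scalerDr addrACA; congr (_ + _).
rewrite scaler_sumr -big_split; apply: eq_bigr => j _.
exact: act_U_is_linear.
Qed.

Lemma J2_ladder al mu : al \in roots ->
  J2 (e_ al) (e_ (- al)) mu = J2 (e_ (- al)) (e_ al) mu + dotw (toC al) mu *: G mu.
Proof.
move=> ral; rewrite /J2 /G -TZ -TD; apply: T_ext => q.
rewrite verma_act_swap cbr_cinj sd_e_br // act_t_vec; congr (_ + _).
rewrite /dotw scaler_suml; apply: eq_bigr => j _.
by rewrite (act_x_wspace _ (Phi_wspace phi_rP mu q)) scalerA.
Qed.

(** The Casimir eigenvalue belonging to highest weight [mu_ k] minus the one on [M N]. *)
Definition gap k : C := dotw (toC (ws k)) (toC (ws k)) - 2%:R * dotw lam`_N (toC (ws k)).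

(* The eigenvalue equation of the Casimir element on the [mu_ k] weight space. *)
Lemma gap_recursion k : gap k *: G (mu_ k) =
  - (\sum_(al <- roots | positive D al) J2 (e_ (- al)) (e_ al) (mu_ k) *+ 2).
Proof.
set mu := mu_ k.
have cas : \sum_(j < n) J2 (x_ j) (x_ j) mu + \sum_(al <- roots) J2 (e_ (- al)) (e_ al) mu
    = (dotw lam`_N lam`_N - dotw (toC (rho D)) (toC (rho D))) *: G mu.
  rewrite -!T_sum -TD /G -TZ; apply: T_ext => q; rewrite -/(casimir (Phi mu q)).
  rewrite casimir_verma; congr (_ *: _).
  by rewrite !(dotwBl, dotwBr) (dotwC (toC (rho D)) lam`_N); ring.
have xx : \sum_(j < n) J2 (x_ j) (x_ j) mu = dotw mu mu *: G mu.
  rewrite /dotw scaler_suml; apply: eq_bigr => j _; rewrite /G -TZ; apply: T_ext => q.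
  by rewrite !(act_x_wspace _ (Phi_wspace phi_rP mu q), verma_act_scale) scalerA.
have ee : \sum_(al <- roots) J2 (e_ (- al)) (e_ al) mu =
    \sum_(al <- roots | positive D al) J2 (e_ (- al)) (e_ al) mu *+ 2
    + (2%:R * dotw (toC (rho D)) mu) *: G mu.
  have -> : 2%:R * dotw (toC (rho D)) mu = \sum_(al <- roots | positive D al) dotw (toC al) mu.
    by rewrite mulr_natl dotwC mulr2n -dotwDr -mulr2n toC_rho dotw_sumr; apply: eq_bigr => al _; rewrite dotwC.
  rewrite (sum_roots_pos D) scaler_suml -big_split big_seq_cond [RHS]big_seq_cond.
  apply: eq_bigr => al /andP[ral _] /=; rewrite opprK J2_ladder // mulr2n.
  by rewrite addrA.
have -> : \sum_(al <- roots | positive D al) J2 (e_ (- al)) (e_ al) mu *+ 2 =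
    (dotw lam`_N lam`_N - dotw (toC (rho D)) (toC (rho D)) - dotw mu mu
     - 2%:R * dotw (toC (rho D)) mu) *: G mu.
  by rewrite scalerBl -[X in _ - X]addr0 scalerBl -cas xx ee; zmod.
rewrite -scaleNr; congr (_ *: _); rewrite /gap /mu !(dotwBl, dotwBr).
rewrite (dotwC (toC (rho D)) lam`_N) (dotwC (toC (ws k)) lam`_N).
by rewrite (dotwC (toC (ws k)) (toC (rho D))); ring.
Qed.

Section Ray.
Variables (al : 'rV[R]_n) (ral : al \in roots) (pal : positive D al).
Local Notation f k m := (tnorm (G (mu_ k + toC al *+ m.+1))).
Local Notation len k := (edeg k).+1.
(** The length leaves room for two nested climbs: [Q] is needed at the first [2 * len k] points and
    costs [2 * len k] further points each time. As [f] starts one step up the ray, only coefficients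
    of smaller height occur. *)
Definition ray_sum k : R := \sum_(m < 4 * len k) f k m.

Let Q mu := J (e_ al) mu.
Let P mu := J2 (e_ (- al)) (e_ al) mu.

Lemma far_off k m : (edeg k < m)%N -> off_cone D top (mu_ k + toC al *+ m).
Proof.
have [l lE l0] := positive_expo ral pal; rewrite lE => h; apply: weight_off.
apply/negP => /ele_edeg; rewrite edeg_mul leqNgt => /negP; apply.
by apply: leq_trans h _; rewrite leq_pmulr // edeg_gt0.
Qed.

Lemma ray_telescope (V : zmodType) (H X : 'rV[C]_n -> V) :
  (forall mu, H mu = H (mu + toC al *+ 2) + X mu) ->
  forall L mu, H mu = H (mu + toC al *+ L.*2) + \sum_(s < L) X (mu + toC al *+ s.*2).
Proof.
move=> hH; elim=> [|L IH] mu; first by rewrite mulr0n addr0 big_ord0 addr0.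
rewrite big_ord_recr /= IH hH doubleS -[L.*2.+2]addn2 (mulrnDr (toC al) L.*2 2) (addrA mu).
by rewrite -[LHS]addrA [X in _ + X]addrC.
Qed.

Let rayD (mu : 'rV[C]_n) a b : mu + toC al *+ a + toC al *+ b = mu + toC al *+ (a + b).
Proof. by rewrite mulrnDr addrA. Qed.

Let rayS (mu : 'rV[C]_n) a : mu + toC al *+ a + toC al = mu + toC al *+ a.+1.
Proof. by rewrite mulrSr addrA. Qed.

(** Right equivariance at [mu + al] and left equivariance at [mu + 2 al] share one insertion of
    [e_(- al)]; eliminating it leaves a recursion for [e_al] alone. *)
Let Q_rec mu : Q mu = Q (mu + toC al *+ 2)
  + (- act_r (y_ al) (G (mu + toC al)) - k_act (y_ al) (G (mu + toC al *+ 2))).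
Proof.
rewrite -(J_right phi_l phi_rP Psi _ ral) -(J_left phi_lP phi_r PsiP _ ral).
by rewrite addrK -[mu + _ + _]addrA -mulr2n /Q; zmod.
Qed.

(** Here the eliminated quantity is the double insertion of [e_al]. The equivariance relations now
    involve the single insertions [Q], and reordering [e_al e_(- al)] brings in [G]. *)
Let P_rec mu : P mu = P (mu + toC al *+ 2)
  + (dotw (toC al) (mu + toC al *+ 2) *: G (mu + toC al *+ 2)
     - (act_r (y_ al) (Q (mu + toC al)) + k_act (y_ al) (Q mu))).
Proof.
have left : J2 (e_ al) (e_ al) mu - P mu = k_act (y_ al) (Q mu).
  rewrite -(T_k phi_lP PsiP) /J2 /P /J2; last exact: y_vec_in_k.
  by rewrite -TB; apply: T_ext => q; rewrite verma_actBl.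
have right : J2 (e_ al) (e_ al) (mu + toC al - toC al)
    - J2 (e_ al) (e_ (- al)) (mu + toC al + toC al) = - act_r (y_ al) (Q (mu + toC al)).
  have lf : linear (fun v => verma_act (e_ al) (phi_r (mu + toC al) v)).
    by move=> c u v; rewrite phi_r_linear verma_act_is_linear.
  rewrite -(T_Vr phi_l Psi _ lf) /J2 -TB; apply: T_ext => q; rewrite -(linfB (verma_act_is_linear _)).
  have [_ h] := phi_rP; rewrite (h _ _ _ (y_vec_in_k ral)).
  by rewrite compl_act_y.
rewrite addrK -[mu + _ + _]addrA -mulr2n J2_ladder // in right.
by rewrite -left -[act_r _ _]opprK -right /P; zmod.
Qed.

Let ray_shift k t : (t <= 2 * len k)%N ->
  \sum_(s < 2 * len k) f k (t + s)%N <= ray_sum k.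
Proof.
move=> ht; apply: (shift_sum (h := fun m => f k m)) => [i|]; last by lia.
exact: tnorm_ge0.
Qed.

Let Q_bound : exists2 K : R, 0 <= K & forall k t, (t <= 2 * len k)%N ->
  tnorm (Q (mu_ k + toC al *+ t)) <= K * ray_sum k.
Proof.
have [K1 K10 K1P] := tnorm_bounded (@act_r_is_linear _ _ D N U Vl Vr (y_ al)).
have [K2 K20 K2P] := tnorm_bounded (k_act_is_linear (y_ al)).
exists (K1 + K2) => [|k t ht]; first exact: addr_ge0.
rewrite (ray_telescope Q_rec (len k)) rayD.
rewrite [Q _]J_e_off ?add0r //; last first.
  by rewrite rayS; apply: far_off; rewrite -muln2; lia.
apply: le_trans (tnorm_sum _ _ _) _.
apply: le_trans (ler_wpM2l (addr_ge0 K10 K20) (ray_shift ht)).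
rewrite -(pair_sum (fun s => f k (t + s))) mulr_sumr; apply: ler_sum => s _.
rewrite !rayD rayS.
have -> : (t + (s.*2 + 2) = (t + s.*2.+1).+1)%N by lia.
rewrite addnS; apply: le_trans (tnormB _ _) _; rewrite tnormN mulrDl.
apply: lerD; rewrite mulrDr.
  by apply: le_trans (K1P _) _; rewrite lerDl mulr_ge0 ?tnorm_ge0.
by apply: le_trans (K2P _) _; rewrite lerDr mulr_ge0 ?tnorm_ge0.
Qed.

Let dotw_bound : exists2 K : R, 0 <= K & forall k t, (t <= 4 * len k)%N ->
  cn (dotw (toC al) (mu_ k + toC al *+ t)) <= K * (len k)%:R.
Proof.
pose K0 := \sum_(i < n) `|dotw al (sd_simple D)`_i|.
exists (cn (dotw (toC al) top) + K0 + 4 * `|dotw al al|) => [|k t ht].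
  by rewrite !addr_ge0 ?cn_ge0 ?mulr_ge0 ?sumr_ge0.
rewrite dotwDr dotwBr -toCMn !dotw_toC; apply: le_trans (cnD _ _) _.
rewrite 2!mulrDl; apply: lerD.
  apply: le_trans (cnB _ _) _; apply: lerD; first by rewrite ler_peMr ?cn_ge0 ?ler1n.
  rewrite cn_real /wsum dotw_sumr; apply: le_trans (ler_norm_sum _ _ _) _.
  rewrite mulr_suml; apply: ler_sum => i _; rewrite dotwMnr normrMn -[_ *+ k i]mulr_natr.
  rewrite ler_wpM2l // ler_nat; apply: leqW; rewrite /edeg (bigD1 i) //=; exact: leq_addr.
rewrite cn_real dotwMnr normrMn -[_ *+ t]mulr_natr -mulrA mulrCA ler_wpM2l //.
by rewrite -natrM ler_nat.
Qed.

(** The factor [len k] has two sources: it bounds the pairing of [al] with the weight in the sum of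
    the [G], and it counts the terms in the sum of the [Q]. *)
Lemma ray_bound : exists2 K : R, 0 <= K & forall k,
  tnorm (J2 (e_ (- al)) (e_ al) (mu_ k)) <= K * (len k)%:R * ray_sum k.
Proof.
have [K1 K10 K1P] := tnorm_bounded (@act_r_is_linear _ _ D N U Vl Vr (y_ al)).
have [K2 K20 K2P] := tnorm_bounded (k_act_is_linear (y_ al)).
have [K3 K30 K3P] := Q_bound; have [K4 K40 K4P] := dotw_bound.
exists (K4 + (K1 * K3 + K2 * K3)) => [|k]; first by rewrite !addr_ge0 ?mulr_ge0.
rewrite -/(P _) (ray_telescope P_rec (len k)).
have -> : P (mu_ k + toC al *+ (len k).*2) = 0.
  rewrite /P /J2 (@T_ext _ _ _ _ _ _ _ _ _ _ _ (fun=> 0)) ?T0 // => q.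
  rewrite (Phi_off phi_rP) ?(linf0 (verma_act_is_linear _)) //.
  by apply: far_off; rewrite -muln2; lia.
have S0 : 0 <= ray_sum k by apply: sumr_ge0 => ? _; exact: tnorm_ge0.
rewrite add0r big_split; apply: le_trans (tnormD _ _) _; rewrite !mulrDl; apply: lerD.
  apply: le_trans (tnorm_sum _ _ _) _.
  have h0 : 0 <= K4 * (len k)%:R by rewrite mulr_ge0.
  apply: le_trans (ler_wpM2l h0 (ray_shift (leq0n _))).
  rewrite -(pair_sum (fun s => f k s)) mulr_sumr; apply: ler_sum => s _.
  rewrite !rayD addn2 tnormZ mulrDr -[X in X <= _]add0r.
  apply: lerD; first by rewrite mulr_ge0 ?tnorm_ge0.
  apply: ler_wpM2r; first exact: tnorm_ge0.
  by apply: K4P; have := ltn_ord s; lia.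
apply: le_trans (tnorm_sum _ _ _) _.
have -> : K1 * K3 * (len k)%:R * ray_sum k + K2 * K3 * (len k)%:R * ray_sum k =
    (K1 * (K3 * ray_sum k) + K2 * (K3 * ray_sum k)) *+ len k.
  by rewrite -[RHS]mulr_natr; ring.
rewrite -[X in _ *+ X]card_ord -sumr_const; apply: ler_sum => s _.
rewrite rayS tnormN; apply: le_trans (tnormD _ _) _.
apply: lerD; [apply: le_trans (K1P _) _|apply: le_trans (K2P _) _];
  rewrite ler_wpM2l //; apply: K3P; have := ltn_ord s; rewrite -muln2; lia.
Qed.

End Ray.

End Growth.

(** * Subexponential growth from the Casimir recursion *)

Section Subexponential.
Variables (R : realType) (n : nat) (D : splitData R n).
Variables (N : nat) (U : 'I_N -> lieRep (@in_g R n D)).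
Variables Vl Vr : lieRep (in_k D).
Local Notation C := R[i].
Local Notation g := (cplx D).
Local Notation roots := (sd_roots D).
Local Notation ws := (wsum (sd_simple D)).
Local Notation x_ j := (cinj (sd_x D)`_j : g).
Local Notation e_ al := (cinj (sd_e D al) : g).
Local Notation y_ al := (y_vec D al).
Variable lam : N.+1.-tuple 'rV[C]_n.
Local Notation M k := (verma D (lam`_k - toC (rho D))).
Variable phi_l : {linear M 0%N -> 'cV[C]_(rep_dim Vl)}.
Hypothesis phi_lP : hom_k_from_verma phi_l.
Variable phi_r : 'rV[C]_n -> {linear 'cV[C]_(rep_dim Vr) -> M N}.
Hypothesis phi_rP : hom_k_to_compl phi_r.
Variable Psi : forall i : 'I_N, {linear M i.+1 -> {ffun 'I_(rep_dim (U i)) -> M i}}.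
Hypothesis PsiP : forall i, hom_g_tensor (Psi i).
Local Notation TT := (tens U Vl Vr).
Local Notation T := (@T _ _ _ _ _ Vl Vr _ phi_l Psi).
Local Notation G := (G phi_l phi_r Psi).
Local Notation J := (J phi_l phi_r Psi).
Local Notation Phi := (Phi phi_r).
Local Notation top := (lam`_N - toC (rho D)).
Local Notation mu_ k := (top - toC (ws k)).

(** The vector whose pairing with a weight is the height. By Cauchy-Schwarz it bounds
    [dotw (ws k) (ws k)] below by a multiple of the squared height. *)
Definition edeg_form : 'rV[R]_n := \row_j \sum_i coord (sd_simple D) i (delta_mx 0 j).

Lemma edeg_formE k : dotw edeg_form (ws k) = (edeg k)%:R.
Proof.
transitivity (\sum_i coord (sd_simple D) i (ws k)).
  rewrite /dotw; under eq_bigr do rewrite mxE mulr_suml.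
  rewrite exchange_big; apply: eq_bigr => i _ /=.
  rewrite {2}[ws k]row_sum_delta linear_sum; apply: eq_bigr => j _ /=.
  by rewrite linearZ mulrC.
have fr := basis_free (@sd_simple_basis _ _ D).
rewrite /edeg natr_sum; apply: eq_bigr => i _; rewrite /wsum.
under eq_bigr do rewrite -scaler_nat.
by rewrite coord_sum_free.
Qed.

Lemma gap_lower : exists2 c : R, 0 < c & exists k0, forall k, (k0 <= edeg k)%N ->
  c * (edeg k)%:R ^+ 2 <= cn (gap D lam k).
Proof.
pose v : 'rV[R]_n := \row_j complex.Re (lam`_N 0 j).
(* [B + 1] is positive even for [b = 0]. The factor 4 pays twice: half of [dotw (ws k) (ws k)]
   absorbs the linear part of [gap], and half of what remains absorbs the constant
   [2 * dotw v v]. *)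
pose b := edeg_form; pose B := dotw b b; pose c := (4 * (B + 1))^-1.
have dotw_ge0 (a : 'rV[R]_n) : 0 <= dotw a a by apply: sumr_ge0 => j _; exact: sqr_ge0.
have B1 : 0 < B + 1 by rewrite ltr_wpDl // dotw_ge0.
have c0 : 0 < c by rewrite invr_gt0 mulr_gt0.
have [k0 k0P] : exists k0 : nat, 2 * dotw v v / c <= k0%:R.
  by exists (Num.truncn (2 * dotw v v / c)).+1; exact: ltW (truncnS_gt _).
exists c => //; exists k0.+1 => k hk; set e := (edeg k)%:R.
have e1 : 1 <= e by rewrite ler1n; apply: leq_trans hk.
have h1 : e ^+ 2 / (B + 1) <= dotw (ws k) (ws k).
  have := dotw_ge0 (ws k - (e / (B + 1)) *: b).
  rewrite !(dotwBl, dotwBr, dotwZl, dotwZr) (dotwC (ws k) b) edeg_formE -/B -/e => h.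
  have s0 := sqr_ge0 (e / (B + 1)).
  rewrite -subr_ge0; apply: le_trans s0 _; rewrite -subr_ge0; apply: le_trans h _.
  by rewrite le_eqVlt; apply/orP; left; apply/eqP; field; rewrite gt_eqF.
have h2 : dotw (ws k) (ws k) / 2 - 2 * dotw v v <= complex.Re (gap D lam k).
  have -> : complex.Re (gap D lam k) = dotw (ws k) (ws k) - 2 * dotw v (ws k).
    rewrite /gap; have -> : dotw lam`_N (toC (ws k)) = (dotw v (ws k) +i*
        dotw (\row_j complex.Im (lam`_N 0 j)) (ws k))%C.
      rewrite /dotw; elim/big_rec3: _ => [//|j x y z _ ->]; rewrite toCE !mxE.
      by case: (lam`_N 0 j) => p q; simpc.
    by rewrite dotw_toC -[2%:R](rmorph_nat (real_complex R)) /=; ring.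
  have := dotw_ge0 (ws k - 2 *: v).
  rewrite !(dotwBl, dotwBr, dotwZl, dotwZr) (dotwC (ws k) v); lra.
apply: le_trans (cn_Re _); apply: le_trans (ler_norm _); apply: le_trans h2.
have h3 : 2 * dotw v v <= c * e ^+ 2.
  rewrite -[X in _ <= X]mulrC -ler_pdivrMr //; apply: le_trans k0P _.
  apply: (@le_trans _ _ e); first by rewrite ler_nat ltnW.
  by rewrite expr2 ler_peMl // (le_trans ler01).
have : 4 * (c * e ^+ 2) <= dotw (ws k) (ws k).
  by rewrite (_ : 4 * _ = e ^+ 2 / (B + 1)) // /c; field; rewrite gt_eqF.
by lra.
Qed.

Lemma G_gap : exists2 K : R, 0 <= K & forall k, cn (gap D lam k) * tnorm (G (mu_ k)) <=
  K * (edeg k).+1%:R * \sum_(al <- roots | positive D al) ray_sum phi_l phi_r Psi al k.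
Proof.
have /choice[f fP] : forall al, exists K : R, 0 <= K /\ (al \in roots -> positive D al ->
    forall k, tnorm (J2 phi_l phi_r Psi (e_ (- al)) (e_ al) (mu_ k))
      <= K * (edeg k).+1%:R * ray_sum phi_l phi_r Psi al k).
  move=> al; case: (boolP (al \in roots)) => [ral|]; last by exists 0.
  case: (boolP (positive D al)) => [pal|]; last by exists 0.
  by have [K K0 KP] := ray_bound phi_lP phi_rP PsiP ral pal; exists K.
have f0 al : 0 <= f al by have [] := fP al.
have S0 al k : 0 <= ray_sum phi_l phi_r Psi al k by apply: sumr_ge0 => m _; exact: tnorm_ge0.
pose K := \sum_(al <- roots) f al.
have fK al : al \in roots -> f al <= K.
  by move=> ral; rewrite /K (big_rem al) //= lerDl sumr_ge0.
exists (K *+ 2) => [|k]; first by rewrite mulrn_wge0 // sumr_ge0.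
rewrite -tnormZ (gap_recursion _ phi_rP) // tnormN mulrnAl mulrnAl.
rewrite mulr_sumr -sumrMnl; apply: le_trans (tnorm_sum _ _ _) _.
rewrite big_seq_cond [X in _ <= X]big_seq_cond; apply: ler_sum => al /andP[ral pal].
rewrite !mulr2n; apply: le_trans (tnormD _ _) _.
have [_ /(_ ral pal k) h] := fP al.
have : f al * (edeg k).+1%:R * ray_sum phi_l phi_r Psi al k <=
       K * (edeg k).+1%:R * ray_sum phi_l phi_r Psi al k.
  by rewrite !ler_wpM2r ?fK.
by move=> h'; apply: lerD; apply: le_trans h _.
Qed.

(** Each step up the ray lowers the height by at least one, so the bounds form a series dominated by
    a geometric one of ratio [r^-1]. *)
Lemma ray_sum_small al k (r K : R) : 1 < r -> 0 <= K -> al \in roots -> positive D al ->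
  (forall p, (edeg p < edeg k)%N -> tnorm (G (mu_ p)) <= K * r ^+ edeg p) ->
  ray_sum phi_l phi_r Psi al k <= K * r ^+ edeg k / (r - 1).
Proof.
move=> r1 K0 ral pal IH; have [l lE l0] := positive_expo ral pal.
have r0 : 0 < r by apply: lt_trans r1.
have step m : tnorm (G (mu_ k + toC al *+ m.+1)) <= K * r ^+ edeg k * r^-1 ^+ m.+1.
  case: (boolP (ele (emul m.+1 l) k)) => h; last first.
    rewrite (G_off phi_l phi_rP) ?tnorm0; last by rewrite lE; apply: weight_off.
    by rewrite !mulr_ge0 ?exprn_ge0 ?invr_ge0 // ltW.
  have hm : (m.+1 <= edeg (emul m.+1 l))%N by rewrite edeg_mul leq_pmulr // edeg_gt0.
  have hk := ele_edeg h.
  rewrite lE -weight_sub //; apply: le_trans (IH _ _) _; first by rewrite edeg_sub //; lia.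
  rewrite -mulrA ler_wpM2l // exprVn ler_pdivlMr ?exprn_gt0 // -exprD.
  by rewrite ler_weXn2l ?ltW // edeg_sub //; lia.
apply: (@le_trans _ _ (\sum_(m < 4 * (edeg k).+1) K * r ^+ edeg k * r^-1 ^+ m.+1)).
  by apply: ler_sum => m _; exact: step.
rewrite -mulr_sumr ler_wpM2l //; first by rewrite mulr_ge0 // exprn_ge0 // ltW.
rewrite -[X in _ <= X]mul1r ler_pdivlMr ?subr_gt0 // mulr_suml; set M := (4 * _)%N.
suff -> : \sum_(m < M) r^-1 ^+ m.+1 * (r - 1) = 1 - r^-1 ^+ M.
  by rewrite gerBl exprn_ge0 // invr_ge0 ltW.
elim: M => [|M IHM]; first by rewrite big_ord0 expr0 subrr.
rewrite big_ord_recr /= IHM exprS; field; rewrite gt_eqF //.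
Qed.

(* If all coefficients of smaller height satisfy the bound, then [G_gap] compares
   a multiple of [|k|^2] on the left with [O(|k|)] times the bound on the right. *)
Lemma G_growth (r : R) : 1 < r -> exists2 K : R, 0 <= K &
  forall k, tnorm (G (mu_ k)) <= K * r ^+ edeg k.
Proof.
move=> r1; have [C C0 CP] := G_gap; have [c c0 [k0 gapP]] := gap_lower.
have r0 : 0 < r by apply: lt_trans r1.
pose P : R := \sum_(al <- roots | positive D al) 1.
have P0 : 0 <= P by apply: sumr_ge0.
(* From height [M] on the constant of the recursion is at most [c * edeg k], which closes the
   induction; the finitely many coefficients below are covered by the choice of [K]. *)
pose M := maxn k0.+1 (Num.truncn (2 * C * P / (r - 1) / c)).+1.
pose K := \sum_(p <- below [ffun=> M]) tnorm (G (mu_ p)).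
have K0 : 0 <= K by apply: sumr_ge0 => p _; exact: tnorm_ge0.
exists K => // k; have [m] := ubnP (edeg k); elim: m k => // m IH k km.
have rk : 0 <= r ^+ edeg k by rewrite exprn_ge0 // ltW.
have [hk|hk] := ltnP (edeg k) M.
  have kb : k \in below [ffun=> M].
    rewrite mem_below; apply/eleP => i; rewrite ffunE; apply: leq_trans (ltnW hk).
    by rewrite /edeg (bigD1 i) //= leq_addr.
  apply: (@le_trans _ _ K).
    by rewrite /K (big_rem k) //= lerDl sumr_ge0 // => p _; exact: tnorm_ge0.
  by rewrite ler_peMr // exprn_ege1 // ltW.
set e : R := (edeg k)%:R.
have e1 : 1 <= e by rewrite ler1n; apply: leq_trans hk; rewrite leq_max.
have e0 : 0 < e by apply: lt_le_trans e1.
have eM : 2 * C * P / (r - 1) / c <= e.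
  apply: ltW; apply: lt_le_trans (truncnS_gt _) _.
  by rewrite ler_nat; apply: leq_trans hk; rewrite leq_max leqnn orbT.
have G0 := tnorm_ge0 (G (mu_ k)).
have h1 : c * e ^+ 2 * tnorm (G (mu_ k)) <= C * (2 * e) * (P * (K * r ^+ edeg k / (r - 1))).
  apply: le_trans (_ : cn (gap D lam k) * tnorm (G (mu_ k)) <= _).
    by rewrite ler_wpM2r // gapP //; apply: leq_trans hk; rewrite leq_max leqnSn.
  apply: le_trans (CP k) _.
  have S0 : 0 <= \sum_(al <- roots | positive D al) ray_sum phi_l phi_r Psi al k.
    by do 2 apply: sumr_ge0 => ? _; exact: tnorm_ge0.
  apply: ler_pM; rewrite ?mulr_ge0 //.
    by rewrite ler_wpM2l // -natr1 -/e; lra.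
  rewrite /P mulr_suml big_seq_cond [X in _ <= X]big_seq_cond.
  apply: ler_sum => al /andP[ral pal]; rewrite mul1r; apply: ray_sum_small => // p hp.
  by apply: IH; apply: leq_trans hp _.
have h2 : 2 * C * P / (r - 1) <= c * e by rewrite (mulrC c) -ler_pdivrMr.
have ce : 0 < c * e ^+ 2 by rewrite mulr_gt0 ?exprn_gt0.
rewrite -(ler_pM2l ce); apply: le_trans h1 _.
have -> : C * (2 * e) * (P * (K * r ^+ edeg k / (r - 1))) =
  (2 * C * P / (r - 1)) * (e * (K * r ^+ edeg k)) by ring.
have -> : c * e ^+ 2 * (K * r ^+ edeg k) = (c * e) * (e * (K * r ^+ edeg k)) by ring.
by rewrite ler_wpM2r // !mulr_ge0 // ltW.
Qed.

End Subexponential.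

(** * Unconditional sums *)

Section Sums.
Variable R : realType.
Local Notation C := R[i].

Lemma sum_fsetD (V : nmodType) (I : choiceType) (f : I -> V) (A B : {fset I}) :
  (A `<=` B)%fset ->
  \sum_(i <- B) f i = \sum_(i <- A) f i + \sum_(i <- (B `\` A)%fset) f i.
Proof.
move=> /fsubsetP AB; rewrite -big_cat; apply: perm_big; apply: uniq_perm.
- exact: fset_uniq.
- rewrite cat_uniq !fset_uniq andbT /=; apply/hasPn => i.
  by rewrite in_fsetD => /andP[].
- move=> i; rewrite mem_cat in_fsetD.
  by case: (boolP (i \in A)) => //= /AB.
Qed.

Lemma sum_seq_fset (V : nmodType) (I : choiceType) (f : I -> V) (s : seq I) : uniq s ->
  \sum_(i <- [fset i in s]%fset) f i = \sum_(i <- s) f i.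
Proof.
by move=> us; apply: perm_big; apply: uniq_perm (fset_uniq _) us _ => i; rewrite !inE.
Qed.

Definition usum (I : choiceType) (f : I -> C) (s : C) : Prop :=
  forall e : R, 0 < e -> exists A : {fset I}, forall B : {fset I}, (A `<=` B)%fset ->
    cn (s - \sum_(i <- B) f i) <= e.

Definition abs_le (I : choiceType) (f : I -> C) (b : R) : Prop :=
  forall A : {fset I}, \sum_(i <- A) cn (f i) <= b.

Lemma sums_toP (I : choiceType) (f : I -> C) s : sums_to f s <-> usum f s.
Proof.
have E (A : {fset I}) : summability.partial_sum f A = \sum_(i <- A) f i.
  by rewrite /summability.partial_sum big_seq_fsetE.
have P := @cvgrPdist_le C C^o _ _ (@summability.totally_filter I) (summability.partial_sum f) s.
rewrite /sums_to; split=> [h e e0|h].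
  have ec : 0 < e%:C%C :> C by rewrite ltcR.
  have [A _ AP] := proj1 P h _ ec; exists A => B AB.
  by have := AP B AB; rewrite /= E cnE lecR.
apply: (proj2 P) => e e0.
have [e' e'0 eE] : exists2 e' : R, 0 < e' & e = e'%:C%C.
  by case: e e0 => a b; rewrite ltcE /= => /andP[/eqP-> a0]; exists a.
have [A AP] := h _ e'0; exists A => // B AB /=.
by rewrite E cnE eE lecR; exact: AP.
Qed.

Lemma usum_ext (I : choiceType) (f g : I -> C) s : f =1 g -> usum f s -> usum g s.
Proof.
move=> fg h e e0; have [A AP] := h e e0; exists A => B AB.
by rewrite -(eq_bigr _ (fun i _ => fg i)); exact: AP.
Qed.

Lemma usum_unique (I : choiceType) (f : I -> C) s t : usum f s -> usum f t -> s = t.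
Proof.
move=> hs ht; apply/eqP; rewrite -subr_eq0; apply/negPn/negP => n0.
have c0 : 0 < cn (s - t).
  by have := normr_gt0 (s - t); rewrite n0 cnE ltcR.
have e0 : 0 < cn (s - t) / 3 by rewrite divr_gt0.
have [A AP] := hs _ e0; have [B BP] := ht _ e0.
have := AP (A `|` B)%fset (fsubsetUl _ _); have := BP (A `|` B)%fset (fsubsetUr _ _).
set x := \sum_(i <- _) _ => h1 h2.
have := cnB (s - x) (t - x); rewrite opprB addrA subrK => h3.
by have := le_trans h3 (lerD h2 h1); lra.
Qed.

Lemma usumD (I : choiceType) (f g : I -> C) s t :
  usum f s -> usum g t -> usum (fun i => f i + g i) (s + t).
Proof.
move=> hs ht e e0; have e20 : 0 < e / 2 by rewrite divr_gt0.
have [A AP] := hs _ e20; have [B BP] := ht _ e20.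
exists (A `|` B)%fset => X; rewrite fsubUset => /andP[AX BX].
rewrite big_split opprD addrACA; apply: le_trans (cnD _ _) _.
by rewrite [e]splitr lerD ?AP ?BP.
Qed.

Lemma usumZ (I : choiceType) (f : I -> C) c s :
  usum f s -> usum (fun i => c * f i) (c * s).
Proof.
move=> hs e e0; have c1 : 0 < cn c + 1 by rewrite ltr_wpDl ?cn_ge0.
have [A AP] := hs _ (divr_gt0 e0 c1); exists A => X AX.
rewrite -mulr_sumr -mulrBr cnM; have := AP X AX; rewrite ler_pdivlMr // => h.
by apply: le_trans h; rewrite mulrC ler_wpM2l ?cn_ge0 // lerDl.
Qed.

Lemma usumN (I : choiceType) (f : I -> C) s : usum f s -> usum (fun i => - f i) (- s).
Proof.
by rewrite -mulN1r => /(usumZ (-1)); apply: usum_ext => i; rewrite mulN1r.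
Qed.

Lemma usumB (I : choiceType) (f g : I -> C) s t :
  usum f s -> usum g t -> usum (fun i => f i - g i) (s - t).
Proof. by move=> hf /usumN; exact: usumD. Qed.

Lemma usum_finite (I : choiceType) (f : I -> C) (A : {fset I}) :
  (forall i, i \notin A -> f i = 0) -> usum f (\sum_(i <- A) f i).
Proof.
move=> f0 e e0; exists A => B AB.
by rewrite (big_fset_incl _ AB) ?subrr ?cn0 ?ltW // => i _; exact: f0.
Qed.

Lemma usum0 (I : choiceType) : usum (fun _ : I => 0) 0.
Proof. by have := @usum_finite I (fun=> 0) fset0 (fun _ _ => erefl); rewrite big_seq_fset0. Qed.

Lemma usum_sum (I : choiceType) J (r : seq J) (f : J -> I -> C) (s : J -> C) :
  (forall j, usum (f j) (s j)) -> usum (fun i => \sum_(j <- r) f j i) (\sum_(j <- r) s j).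
Proof.
move=> h; elim: r => [|j r IH].
  by rewrite big_nil; apply: usum_ext (usum0 I) => i; rewrite big_nil.
rewrite big_cons; apply: usum_ext (usumD (h j) IH) => i; exact/esym/big_cons.
Qed.

Lemma usum_bound (I : choiceType) (f : I -> C) s b : usum f s -> abs_le f b -> cn s <= b.
Proof.
move=> hs fb; apply/ler_addgt0Pl => e e0; have [A AP] := hs _ e0.
have := AP A (fsubset_refl A) => h; rewrite -[s](subrK (\sum_(i <- A) f i)).
apply: le_trans (cnD _ _) _; apply: lerD => //.
exact: le_trans (cn_sum _ _ _) (fb A).
Qed.

Lemma abs_le_sub (I : choiceType) (f g : I -> C) b :
  (forall i, cn (g i) <= cn (f i)) -> abs_le f b -> abs_le g b.
Proof. by move=> gf fb A; apply: le_trans (fb A); apply: ler_sum => i _. Qed.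

Lemma abs_leZ (I : choiceType) (f : I -> C) c b :
  abs_le f b -> abs_le (fun i => c * f i) (cn c * b).
Proof.
move=> fb A; under eq_bigr do rewrite cnM.
by rewrite -mulr_sumr ler_wpM2l ?cn_ge0.
Qed.

Lemma abs_le_tail (I : choiceType) (f : I -> C) b : abs_le f b ->
  forall e : R, 0 < e -> exists A : {fset I},
    forall B : {fset I}, [disjoint A & B]%fset -> \sum_(i <- B) cn (f i) <= e.
Proof.
move=> fb e e0; pose S : set R := range (fun A : {fset I} => \sum_(i <- A) cn (f i)).
have hS : has_sup S.
  split; first by exists (\sum_(i <- fset0) cn (f i)); exists fset0.
  by exists b => _ [A _ <-]; exact: fb.
have [_ [A _ <-] hA] := sup_adherent e0 hS; exists A => B AB.
have hB : \sum_(i <- (A `|` B)%fset) cn (f i) <= sup S.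
  by apply: sup_upper_bound => //; exists (A `|` B)%fset.
move: hB; rewrite (sum_fsetD _ (fsubsetUl _ _)) fsetDUl fsetDv fset0U.
rewrite (fsetDidPl _ _ _) 1?fdisjoint_sym // => hB.
by have := ltW hA; lra.
Qed.

Lemma usum_nonneg (I : choiceType) (f : I -> R) b : (forall i, 0 <= f i) ->
  (forall A : {fset I}, \sum_(i <- A) f i <= b) -> exists s, usum (fun i => (f i)%:C%C) s.
Proof.
move=> f0 fb; pose S : set R := range (fun A : {fset I} => \sum_(i <- A) f i).
have hS : has_sup S.
  split; first by exists (\sum_(i <- fset0) f i); exists fset0.
  by exists b => _ [A _ <-]; exact: fb.
have sumP (A B : {fset I}) : (A `<=` B)%fset -> \sum_(i <- A) f i <= \sum_(i <- B) f i.
  by move=> AB; rewrite (sum_fsetD _ AB) lerDl sumr_ge0.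
exists (sup S)%:C%C => e e0; have [_ [A _ <-] hA] := sup_adherent e0 hS.
exists A => B AB; rewrite -rmorph_sum -rmorphB cn_real.
have hB : \sum_(i <- B) f i <= sup S by apply: sup_upper_bound => //; exists B.
rewrite ger0_norm ?subr_ge0 //; have := sumP _ _ AB; have := ltW hA; lra.
Qed.

(** The positive and negative parts of the real and imaginary parts have monotone partial sums,
    whose limits are suprema. *)
Lemma usum_exists (I : choiceType) (f : I -> C) b : abs_le f b -> exists s, usum f s.
Proof.
move=> fb; pose p (x : R) := (x + `|x|) / 2.
have p0 x : 0 <= p x by rewrite /p divr_ge0 // -lerBlDl sub0r -normrN ler_norm.
have pE x : p x - p (- x) = x by rewrite /p normrN; field.
have px x y : `|x| <= y -> p x <= y.
  by rewrite /p => h; have := ler_norm x; lra.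
have sump (g : I -> R) : (forall i, `|g i| <= cn (f i)) ->
    exists s, usum (fun i => (p (g i))%:C%C) s.
  move=> gf; apply: (usum_nonneg (b := b)) => // A; apply: le_trans (fb A).
  by apply: ler_sum => i _; apply/px/gf.
have sumr (g : I -> R) : (forall i, `|g i| <= cn (f i)) -> exists s, usum (fun i => (g i)%:C%C) s.
  move=> gf; have [s hs] := sump _ gf; have [|t ht] := sump (fun i => - g i).
    by move=> i; rewrite normrN.
  exists (s - t); apply: usum_ext (usumB hs ht) => i; by rewrite -rmorphB pE.
have [s hs] := sumr _ (fun i => cn_Re (f i)); have [t ht] := sumr _ (fun i => cn_Im (f i)).
exists (s + 'i%C * t); apply: usum_ext (usumD hs (usumZ 'i%C ht)) => i.
by rewrite -complexE.
Qed.

(** Summation by fibres: once the finitely many fibres meeting [A] are included, the remainder is a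
    part of the absolute tail beyond [A]. Fibre sums run over all of [I] with zeros, which keeps one
    index type. *)
Lemma usum_fiber (I J : choiceType) (pi : I -> J) (f : I -> C) (c : J -> C) s b :
  abs_le f b -> usum f s ->
  (forall j, usum (fun i => if pi i == j then f i else 0) (c j)) -> usum c s.
Proof.
move=> fb hs hc e e0; have [A AP] := abs_le_tail fb e0.
exists (pi @` A)%fset => B AB; pose g i := if pi i \in B then 0 else f i.
have hg : usum g (s - \sum_(j <- B) c j).
  apply: usum_ext (usumB hs (usum_sum B hc)) => i; rewrite /g; case: ifP => iB.
    rewrite (big_fsetD1 (pi i)) //= eqxx big_seq big1 ?addr0 ?subrr // => j.
    by rewrite in_fsetD1 eq_sym => /andP[/negPf->].
  rewrite big_seq big1 ?subr0 // => j jB; case: eqP => // E.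
  by rewrite E jB in iB.
apply: usum_bound hg _ => X; rewrite (bigID (fun i => pi i \in B)) /=.
rewrite big1 ?add0r => [|i iB]; last by rewrite /g iB cn0.
rewrite big_fset_condE; apply: le_trans (AP [fset i in X | pi i \notin B]%fset _).
  rewrite big_seq [X in _ <= X]big_seq; apply: ler_sum => i.
  by rewrite !inE /= => /andP[_ /negPf iB]; rewrite /g iB.
apply/fdisjointP => i iA; rewrite !inE /= negb_and negbK.
by apply/orP; right; apply: (fsubsetP AB); apply/imfsetP; exists i.
Qed.

Lemma usum_embed (I J : choiceType) (h : J -> I) (pi : I -> J) (f : I -> C) s b :
  cancel h pi -> (forall i, h (pi i) != i -> f i = 0) -> abs_le f b ->
  usum (f \o h) s -> usum f s.
Proof.
move=> hK f0 fb hs; have [t ht] := usum_exists fb; suff <- : t = s by [].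
apply: usum_unique hs; apply: (usum_fiber (pi := pi) fb ht) => j.
have := @usum_finite _ (fun i => if pi i == j then f i else 0) [fset h j]%fset.
rewrite big_seq_fset1 hK eqxx; apply=> i; rewrite in_fset1.
by case: (pi i =P j) => // <- ne; apply: f0; rewrite eq_sym.
Qed.

Lemma usum_fst (I J : choiceType) (f : I * J -> C) i s b : abs_le f b ->
  usum (fun j => f (i, j)) s -> usum (fun p => if p.1 == i then f p else 0) s.
Proof.
move=> fb hs; apply: (usum_embed (h := pair i) (pi := snd) (b := b)) => //.
- by move=> [a c] /=; rewrite xpair_eqE eqxx andbT eq_sym => /negPf->.
- by apply: abs_le_sub fb => p; case: ifP => // _; rewrite cn0 cn_ge0.
- by apply: usum_ext hs => j /=; rewrite eqxx.
Qed.

Lemma usum_snd (I J : choiceType) (f : I * J -> C) j s b : abs_le f b ->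
  usum (fun i => f (i, j)) s -> usum (fun p => if p.2 == j then f p else 0) s.
Proof.
move=> fb hs; apply: (usum_embed (h := pair^~ j) (pi := fst) (b := b)) => //.
- by move=> [a c] /=; rewrite xpair_eqE eqxx /= eq_sym => /negPf->.
- by apply: abs_le_sub fb => p; case: ifP => // _; rewrite cn0 cn_ge0.
- by apply: usum_ext hs => i /=; rewrite eqxx.
Qed.

Lemma abs_le_pair (I J : choiceType) (f : I * J -> C) (F : I -> C) b :
  (forall i, abs_le (fun j => f (i, j)) (cn (F i))) -> abs_le F b -> abs_le f b.
Proof.
move=> fF Fb A; pose X := [fset p.1 | p in A]%fset; pose Y := [fset p.2 | p in A]%fset.
pose s := [seq (i, j) | i <- X, j <- Y].
have us : uniq s by rewrite allpairs_uniq ?fset_uniq // => -[? ?] [? ?].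
apply: (@le_trans _ _ (\sum_(p <- [fset p in s]%fset) cn (f p))).
  rewrite (@sum_fsetD _ _ _ A [fset p in s]%fset); first by rewrite lerDl sumr_ge0 // => p _; exact: cn_ge0.
  apply/fsubsetP => -[i j] pA.
  suff : (i, j) \in s by rewrite in_fset.
  apply/allpairsP; exists (i, j); split => //; apply/imfsetP; by exists (i, j).
rewrite sum_seq_fset // big_allpairs; apply: le_trans (Fb X).
by apply: ler_sum => i _; exact: fF.
Qed.

End Sums.

(** * Unconditional sums as limits along exhausting sequences *)

Section Exhaustion.
Variable R : realType.
Local Notation C := R[i].

Definition exhausts (I : choiceType) (s : nat -> seq I) : Prop :=
  (forall M, uniq (s M)) /\
  forall A : {fset I}, exists M0, forall M, (M0 <= M)%N -> {subset A <= s M}.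

Lemma usum_cvg (I : choiceType) (s : nat -> seq I) (f : I -> C) t : exhausts s -> usum f t ->
  ((fun M => \sum_(i <- s M) f i : C^o) @ \oo --> (t : C^o))%classic.
Proof.
move=> [us sA] ht.
have P := @cvgrPdist_le C C^o _ _ eventually_filter (fun M => \sum_(i <- s M) f i) t.
apply: (proj2 P) => e e0.
have [e' e'0 eE] : exists2 e' : R, 0 < e' & e = e'%:C%C.
  by case: e e0 => a b; rewrite ltcE /= => /andP[/eqP-> a0]; exists a.
have [A AP] := ht _ e'0; have [M0 hM] := sA A; exists M0 => // M hM0.
rewrite /= cnE eE lecR -sum_seq_fset //; apply: AP.
by apply/fsubsetP => i iA; rewrite !inE; exact: (hM _ hM0).
Qed.

Lemma abs_le_seq (I : choiceType) (s : nat -> seq I) (f : I -> C) b : exhausts s ->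
  (forall M, \sum_(i <- s M) cn (f i) <= b) -> abs_le f b.
Proof.
move=> [us sA] fb A; have [M0 /(_ _ (leqnn _)) hM] := sA A; apply: le_trans (fb M0).
rewrite -(sum_seq_fset _ (us M0)) (@sum_fsetD _ _ _ A).
  by rewrite lerDl sumr_ge0 // => i _; exact: cn_ge0.
by apply/fsubsetP => i iA; rewrite !inE; exact: hM.
Qed.

Lemma exhausts_nat : exhausts (iota 0).
Proof.
split=> [M|A]; first exact: iota_uniq.
exists (\sum_(i <- A) i).+1 => M hM i iA; rewrite mem_iota add0n; apply: leq_trans hM.
by rewrite ltnS (big_rem i) //= leq_addr.
Qed.

Lemma sum_iota (V : nmodType) (h : nat -> V) M : \sum_(q <- iota 0 M) h q = \sum_(q < M) h q.
Proof. by rewrite -(big_mkord xpredT h) /index_iota subn0. Qed.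

(** Absolute convergence provides some unconditional sum, and initial segments are cofinal, so
    uniqueness of limits identifies it with the ordinary one. *)
Lemma usum_series (f : nat -> C) t b : (forall M, \sum_(q < M) cn (f q) <= b) ->
  ((fun M => \sum_(q < M) f q : C^o) @ \oo --> (t : C^o))%classic -> usum f t.
Proof.
move=> fb; have fb' : abs_le f b.
  by apply: abs_le_seq exhausts_nat _ => M; rewrite sum_iota.
have [s hs] := usum_exists fb' => ht; suff <- : s = t by [].
have := usum_cvg exhausts_nat hs; under eq_fun do rewrite sum_iota.
by move=> h; apply: (cvg_unique _ h ht); exact: norm_hausdorff.
Qed.

Definition box n M : seq (expo n) :=
  [seq [ffun i => p i : nat] | p : {ffun 'I_n -> 'I_M}].

Lemma exhausts_box n : exhausts (@box n).
Proof.
split=> [M|A].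
  rewrite map_inj_uniq ?enum_uniq // => p q /ffunP h; apply/ffunP => i.
  by apply: val_inj; have := h i; rewrite !ffunE.
exists (\sum_(k <- A) edeg k).+1 => M hM k kA.
have kM i : (k i < M)%N.
  apply: leq_trans hM; rewrite ltnS (big_rem k) //=; apply: leq_trans (leq_addr _ _).
  by rewrite /edeg (bigD1 i) //= leq_addr.
apply/mapP; exists [ffun i => Ordinal (kM i)]; first by rewrite mem_enum.
by apply/ffunP => i; rewrite !ffunE.
Qed.

Lemma sum_box (S : comPzSemiRingType) n M (F : 'I_n -> nat -> S) :
  \sum_(k <- box n M) \prod_j F j (k j) = \prod_j \sum_(q < M) F j q.
Proof.
rewrite bigA_distr_bigA big_map big_enum; apply: eq_bigr => p _.
by apply: eq_bigr => j _; rewrite ffunE.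
Qed.

Lemma abs_le_prod n (f : expo n -> C) (F : 'I_n -> nat -> R) b :
  (forall j q, 0 <= F j q) -> (forall k, cn (f k) <= \prod_j F j (k j)) ->
  (forall j M, \sum_(q < M) F j q <= b j) -> abs_le f (\prod_j b j).
Proof.
move=> F0 fF Fb; apply: abs_le_seq (@exhausts_box n) _ => M.
apply: (@le_trans _ _ (\sum_(k <- box n M) \prod_j F j (k j))).
  by apply: ler_sum => k _.
rewrite sum_box; apply: ler_prod => j _; rewrite Fb andbT.
by apply: sumr_ge0.
Qed.

(** Over a box the sum of products factors, and boxes exhaust the exponents. *)
Lemma usum_prod n (f : 'I_n -> nat -> C) s b : (forall j, usum (f j) (s j)) ->
  (forall j M, \sum_(q < M) cn (f j q) <= b j) ->
  usum (fun k : expo n => \prod_j f j (k j)) (\prod_j s j).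
Proof.
move=> fs fb; have ab : abs_le (fun k : expo n => \prod_j f j (k j)) (\prod_j b j).
  apply: (abs_le_prod (F := fun j q => cn (f j q))) => // [j q|k].
    exact: cn_ge0.
  by rewrite cn_prod.
have [t ht] := usum_exists ab; suff <- : t = \prod_j s j by [].
have := usum_cvg (@exhausts_box n) ht; under eq_fun do rewrite sum_box.
move=> h; apply: (cvg_unique _ h); first exact: norm_hausdorff.
have main (r : seq 'I_n) : ((fun M => \prod_(j <- r) \sum_(q < M) f j q : C^o) @ \oo
    --> (\prod_(j <- r) s j : C^o))%classic.
  elim: r => [|j r IH].
    rewrite big_nil (_ : (fun _ => _) = fun=> 1); first exact: cvg_cst.
    by apply/funext => M; rewrite big_nil.
  rewrite big_cons (_ : (fun _ => _) =
    fun M => (\sum_(q <- iota 0 M) f j q) * \prod_(j <- r) \sum_(q < M) f j q).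
    exact: (cvgM (usum_cvg exhausts_nat (fs j)) IH).
  by apply/funext => M; rewrite big_cons sum_iota.
exact: main.
Qed.

End Exhaustion.

(** * The complex exponential series *)

Section Cexp.
Variable R : realType.
Local Notation C := R[i].
Implicit Types z w : C.

Lemma cexpD z w : cexp (z + w) = cexp z * cexp w.
Proof.
case: z w => [a b] [c d]; rewrite /cexp /= expRD cosD sinD.
by apply/eqP; rewrite eq_complex /=; apply/andP; split; apply/eqP; ring.
Qed.

Lemma cexp0 : cexp 0 = 1 :> C.
Proof. by rewrite /cexp /= expR0 cos0 sin0 mul1r. Qed.

Lemma cexp_sum I (r : seq I) (z : I -> C) :
  cexp (\sum_(i <- r) z i) = \prod_(i <- r) cexp (z i).
Proof. by elim/big_rec2: _ => [|i a b _ <-]; rewrite ?cexp0 // cexpD. Qed.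

Lemma cn_cexp z : cn (cexp z) = expR (complex.Re z).
Proof.
rewrite /cexp cnM cn_real ger0_norm ?expR_ge0 // /cn normc_def /=.
by rewrite addrC sin2cos2 subrK sqrtr1 mulr1.
Qed.

Lemma cexp_neq0 z : cexp z != 0.
Proof.
apply/eqP => /(congr1 (@cn R)); rewrite cn_cexp cn0 => /eqP.
by rewrite gt_eqF ?expR_gt0.
Qed.

Lemma expR_partial (x : R) M : 0 <= x -> \sum_(q < M) x ^+ q / q`!%:R <= expR x.
Proof.
move=> x0; rewrite /expR.
have := nondecreasing_cvgn_le (u_ := series (exp_coeff x)).
rewrite /series /= /exp_coeff /=.
move=> /(_ _ (is_cvg_series_exp_coeff x) M); rewrite /series /= big_mkord; apply.
apply: (@nondecreasing_series _ (exp_coeff x) xpredT 0) => q _ _.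
exact: exp_coeff_ge0.
Qed.

Lemma cvg_toC (u : nat -> R) (l : R) : (u @ \oo --> l)%classic ->
  ((fun M => (u M)%:C%C : C^o) @ \oo --> (l%:C%C : C^o))%classic.
Proof.
move=> h; have P := @cvgrPdist_le C C^o _ _ eventually_filter (fun M => (u M)%:C%C) l%:C%C.
apply: (proj2 P) => e e0.
have [e' e'0 eE] : exists2 e' : R, 0 < e' & e = e'%:C%C.
  by case: e e0 => a b; rewrite ltcE /= => /andP[/eqP-> a0]; exists a.
move/cvgrPdist_le: h => /(_ _ e'0); apply: filterS => M hM.
by rewrite /= -rmorphB cnE cn_real eE lecR.
Qed.

Lemma usum_real (u : nat -> R) (x l : R) : (forall q, `|u q| <= `|x| ^+ q / q`!%:R) ->
  (series u @ \oo --> l)%classic -> usum (fun q => (u q)%:C%C) l%:C%C.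
Proof.
move=> ux /cvg_toC h; apply: (usum_series (b := expR `|x|)) => [M|].
  apply: le_trans (expR_partial M (normr_ge0 x)); apply: ler_sum => q _.
  by rewrite cn_real.
suff -> : (fun M => \sum_(q < M) (u q)%:C%C) = (fun M => (series u M)%:C%C) by [].
by apply/funext => M; rewrite /series /= big_mkord rmorph_sum.
Qed.

Let term z q : C := z ^+ q / q`!%:R.

Let cn_term z q : cn (term z q) = cn z ^+ q / q`!%:R.
Proof. by rewrite cnM cnX cnV cn_nat. Qed.

Let term_partial z M : \sum_(q < M) cn (term z q) <= expR (cn z).
Proof.
by under eq_bigr do rewrite cn_term; apply: expR_partial; exact: cn_ge0.
Qed.

Let term_abs z : abs_le (term z) (expR (cn z)).
Proof. by apply: abs_le_seq exhausts_nat _ => M; rewrite sum_iota. Qed.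

Let usum_re (x : R) : usum (term x%:C%C) (expR x)%:C%C.
Proof.
have h : usum (fun q => (exp_coeff x q)%:C%C) (expR x)%:C%C.
  apply: (@usum_real _ x) => [q|]; first by rewrite /exp_coeff /= normrM normrX normfV normr_nat.
  exact: is_cvg_series_exp_coeff.
apply: usum_ext h => q; rewrite /exp_coeff /term /=.
by rewrite rmorphM rmorphXn fmorphV rmorph_nat.
Qed.

Let usum_im (y : R) : usum (term ('i%C * y%:C%C)) (cos y +i* sin y)%C.
Proof.
have bnd (b : bool) (s : nat) q :
    `|b%:R * (-1) ^+ s * y ^+ q / q`!%:R| <= `|y| ^+ q / q`!%:R.
  rewrite -!mulrA !normrM !normrX normrN1 expr1n mul1r normfV !normr_nat.
  by rewrite ler_piMl ?divr_ge0 ?exprn_ge0 //; case: b; rewrite ?ler01.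
have hc : usum (fun q => (cos_coeff y q)%:C%C) (cos y)%:C%C.
  apply: (@usum_real _ y) => [q|]; first by rewrite /cos_coeff /=; exact: bnd.
  by rewrite cos.unlock; exact: is_cvg_series_cos_coeff.
have hs : usum (fun q => (sin_coeff y q)%:C%C) (sin y)%:C%C.
  apply: (@usum_real _ y) => [q|]; first by rewrite /sin_coeff /=; exact: bnd.
  by rewrite sin.unlock; exact: is_cvg_series_sin_coeff.
rewrite [X in usum _ X]complexE /=; apply: usum_ext (usumD hc (usumZ 'i%C hs)) => q.
rewrite /cos_coeff /sin_coeff /term /= exprMn.
have -> : 'i%C ^+ q = (-1) ^+ q./2 * (if odd q then 'i%C else 1) :> C.
  rewrite -{1}(odd_double_half q) exprD -muln2 mulnC exprM sqr_i mulrC.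
  by case: (odd q).
rewrite !rmorphM /= !rmorphXn /= fmorphV !rmorph_nat rmorphN1.
have hE : odd q -> q.-1./2 = q./2.
  by case: q => // q /=; rewrite uphalf_half => /negPf->.
by case: (odd q) hE => [->|_] //=; ring.
Qed.

(** The products of a term for [x] with a term for [i y] are summed in two ways: by rows they give
    the product of the two exponentials, by antidiagonals and the binomial theorem the series at
    [x + i y]. *)
Lemma usum_cexp z : usum (term z) (cexp z).
Proof.
case: z => x y; set z := (x +i* y)%C.
pose f (p : nat * nat) := term x%:C%C p.1 * term ('i%C * y%:C%C) p.2.
have fb : abs_le f (cn (expR (cn ('i%C * y%:C%C)))%:C%C * expR (cn x%:C%C)).
  apply: (abs_le_pair (F := fun p => (expR (cn ('i%C * y%:C%C)))%:C%C * term x%:C%C p)).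
    move=> p; rewrite [X in cn X]mulrC [X in abs_le _ X]cnM [X in _ * X]cn_real.
    rewrite [X in _ * X]ger0_norm ?expR_ge0 //; exact: (abs_leZ (term x%:C%C p) (term_abs _)).
  exact: (abs_leZ _ (term_abs _)).
have [s hs] := usum_exists fb.
have sE : s = cexp z.
  have h : usum (fun q => term x%:C%C q * (cos y +i* sin y)%C) s.
    apply: (usum_fiber (pi := fst) fb hs) => q; apply: usum_fst fb _ => /=.
    exact: usumZ (usum_im y).
  apply: usum_unique h _; rewrite /cexp /= mulrC.
  by apply: usum_ext (usumZ _ (usum_re x)) => q; rewrite mulrC.
rewrite -sE; apply: (usum_fiber (pi := fun p : nat * nat => (p.1 + p.2)%N) fb hs) => N.
pose g (p : nat * nat) := if (p.1 + p.2 == N)%N then f p else 0.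
have -> : term z N = \sum_(p <- [fset p in [seq (p, N - p)%N | p <- iota 0 N.+1]]%fset) g p.
  rewrite sum_seq_fset; last by rewrite map_inj_uniq ?iota_uniq // => ? ? [].
  rewrite big_map sum_iota /g /f /term.
  rewrite {1}[z]complexE /= addrC exprDn mulr_suml; apply: eq_bigr => p _.
  have pN : (p <= N)%N by rewrite -ltnS.
  rewrite /= subnKC // eqxx -(bin_fact pN) !natrM.
  have b0 : 'C(N, p)%:R != 0 :> C by rewrite pnatr_eq0 -lt0n bin_gt0.
  have f0 r : r`!%:R != 0 :> C by rewrite pnatr_eq0 -lt0n fact_gt0.
  by rewrite -mulr_natr; field; rewrite b0 !f0.
apply: usum_finite => -[p q] /=; case: (@eqP _ (p + q)%N N) => // pq /negP[].
suff : (p, q) \in [seq (p, N - p)%N | p <- iota 0 N.+1] by rewrite in_fset.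
apply/mapP; exists p; first by rewrite mem_iota; lia.
by congr (_, _); lia.
Qed.

Lemma usum_cexp_sum n (z : 'I_n -> C) :
  usum (fun k : expo n => \prod_j (z j ^+ k j / (k j)`!%:R)) (cexp (\sum_j z j)).
Proof.
rewrite cexp_sum; apply: usum_prod (fun j => usum_cexp (z j)) _ => j M.
exact: term_partial.
Qed.

End Cexp.

(** * Convergence and differentiation on the chamber *)

Section OnA.
Variables (R : realType) (n : nat) (D : splitData R n).
Local Notation C := R[i].
Local Notation roots := (sd_roots D).
Local Notation ws := (wsum (sd_simple D)).
Variable L : 'rV[C]_n.
Local Notation wt k := (L - toC (ws k)).
Implicit Types (c : expo n -> C) (a t : 'rV[R]_n) (k m : expo n).

Lemma xiD (lam mu : 'rV[C]_n) a : xi (lam + mu) a = xi lam a * xi mu a.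
Proof. by rewrite /xi dotwDl cexpD. Qed.

Lemma xi_add (lam : 'rV[C]_n) a t : xi lam (a + t) = xi lam a * xi lam t.
Proof. by rewrite /xi toCD dotwDr cexpD. Qed.

Lemma cn_xi_toC (be : 'rV[R]_n) a : cn (xi (toC be) a) = expR (dotw be a).
Proof. by rewrite /xi cn_cexp dotw_toC. Qed.

Definition subexp c : Prop := forall r : R, 1 < r -> exists2 K : R, 0 <= K &
  forall k, cn (c k) <= K * r ^+ edeg k.

Definition wt_norm k : R := \sum_j cn (wt k 0 j).

Lemma geometric_bound (q : R) : 0 <= q < 1 ->
  abs_le (fun k : expo n => (q ^+ edeg k)%:C%C) (\prod_(j < n) (1 - q)^-1).
Proof.
move=> /andP[q0 q1]; apply: (@abs_le_prod _ _ _ (fun _ p => q ^+ p) (fun=> (1 - q)^-1)) => [j p|k|j M].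
- exact: exprn_ge0.
- by rewrite cn_real ger0_norm ?exprn_ge0 // /edeg -expr_sum.
- rewrite -[X in _ <= X]mul1r ler_pdivlMr ?subr_gt0 // mulrC.
  by rewrite -opprB mulNr -subrX1 opprB gerBl exprn_ge0.
Qed.

(** On the chamber [xi (wt k) a] decays exponentially in the height, which beats the growth of [c].
    The surplus pays for [expR (r * wt_norm k)], a bound for the Taylor series of [xi (wt k)] on the
    polydisc of radius [r]. *)
Lemma decay c a : subexp c -> A_plus D a -> exists2 r : R, 0 < r & exists b : R,
  abs_le (fun k => c k * xi (wt k) a * (expR (r * wt_norm k))%:C%C) b.
Proof.
move=> hc aP; pose al (i : 'I_n) := dotw (sd_simple D)`_i a.
have al0 i : 0 < al i.
  rewrite -expR_gt1; apply: aP; first by rewrite sd_simple_sub // mem_nth // size_tuple.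
  apply/positiveP; exists [ffun j => (j == i : nat)]; rewrite /wsum (bigD1 i) //= ffunE eqxx.
  by rewrite big1 ?addr0 // => j /negPf ji; rewrite ffunE ji mulr0n.
(* A positive lower bound for all [al i], written so that it also makes sense for [n = 0]. *)
pose eta := (1 + \sum_i (al i)^-1)^-1.
have s0 : 0 <= \sum_i (al i)^-1 by apply: sumr_ge0 => i _; rewrite invr_ge0 ltW.
have eta0 : 0 < eta by rewrite invr_gt0 ltr_wpDr.
have etaP i : eta <= al i.
  rewrite -[al i]invrK lef_pV2 ?posrE ?invr_gt0 ?ltr_wpDr //.
  rewrite (bigD1 i) //= addrCA lerDl addr_ge0 // sumr_ge0 // => j _.
  by rewrite invr_ge0 ltW.
have deg_le k : eta * (edeg k)%:R <= dotw (ws k) a.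
  rewrite dotwC /wsum dotw_sumr /edeg natr_sum mulr_sumr; apply: ler_sum => i _.
  by rewrite dotwMnr mulr_natr ler_wMn2r // dotwC etaP.
pose A := \sum_(i < n) \sum_j `|(sd_simple D)`_i 0 j|.
have A0 : 0 <= A by apply: sumr_ge0 => i _; apply: sumr_ge0.
pose La := \sum_j cn (L 0 j).
have size_le k : wt_norm k <= La + A * (edeg k)%:R.
  rewrite /wt_norm; apply: (@le_trans _ _ (La + \sum_j `|ws k 0 j|)).
    rewrite -big_split; apply: ler_sum => j _ /=.
    have -> : wt k 0 j = L 0 j - (ws k 0 j)%:C%C by rewrite !mxE.
    by rewrite -cn_real cnB.
  rewrite lerD2l /A mulr_suml.
  apply: (@le_trans _ _ (\sum_(j < n) \sum_(i < n) `|(sd_simple D)`_i 0 j| * (k i)%:R)).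
    apply: ler_sum => j _; rewrite /wsum summxE; apply: le_trans (ler_norm_sum _ _ _) _.
    by apply: ler_sum => i _; rewrite mulmxnE normrMn mulr_natr.
  rewrite exchange_big; apply: ler_sum => i _ /=; rewrite -mulr_suml ler_wpM2l ?sumr_ge0 //.
  by rewrite ler_nat /edeg (bigD1 i) //= leq_addr.
(* The decay rate [eta] is shared out: a quarter for the growth of [c], a quarter for [r * wt_norm],
   and half for the convergent series of ratio [q]. *)
pose r := eta / (4 * (A + 1)).
have A1 : 0 < 4 * (A + 1) by rewrite mulr_gt0 // ltr_wpDl.
have r0 : 0 < r by rewrite divr_gt0.
have rA : r * A <= eta / 4.
  rewrite /r mulrAC ler_pdivrMr // [eta / 4 * _]mulrA divfK //.
  by rewrite ler_wpM2l ?ltW // ltrDl.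
have r1 : 1 < expR (eta / 4) by rewrite expR_gt1 divr_gt0.
have [K K0 KP] := hc _ r1.
exists r => //; pose q := expR (- (eta / 2)).
have q01 : 0 <= q < 1 by rewrite expR_ge0 expR_lt1 oppr_lt0 divr_gt0.
pose E := expR (complex.Re (dotw L (toC a))).
exists (cn (K * E * expR (r * La))%:C%C * \prod_(j < n) (1 - q)^-1).
apply: abs_le_sub (abs_leZ _ (geometric_bound q01)) => k.
have xE : cn (xi (wt k) a) = E * expR (- dotw (ws k) a).
  by rewrite xiD -toCN cnM cn_xi_toC dotwNl /xi cn_cexp.
rewrite [X in X <= _]cnM [X in X * _ <= _]cnM xE [X in _ <= X]cnM !cn_real.
rewrite !ger0_norm ?mulr_ge0 ?exprn_ge0 ?expR_ge0 //.
have h := KP k; rewrite -expRM_natl in h.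
rewrite /q -expRM_natl.
apply: (@le_trans _ _ (K * expR ((edeg k)%:R * (eta / 4)) * (E * expR (- dotw (ws k) a))
   * expR (r * wt_norm k))).
  by rewrite !ler_wpM2r ?mulr_ge0 ?expR_ge0.
have -> : K * E * expR (r * La) * expR ((edeg k)%:R * - (eta / 2)) =
    K * E * (expR (r * La + (edeg k)%:R * - (eta / 2))) by rewrite expRD; ring.
have -> : K * expR ((edeg k)%:R * (eta / 4)) * (E * expR (- dotw (ws k) a))
   * expR (r * wt_norm k) = K * E * expR ((edeg k)%:R * (eta / 4) - dotw (ws k) a
      + r * wt_norm k) by rewrite !expRD; ring.
rewrite ler_wpM2l ?mulr_ge0 ?expR_ge0 // ler_expR.
have := deg_le k; have := ler_wpM2l (ltW r0) (size_le k).
have := ler_wpM2r (ler0n R (edeg k)) rA; lra.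
Qed.

End OnA.

(** * Taylor expansion and increments of the sums *)

Section Expansion.
Variables (R : realType) (n : nat) (D : splitData R n).
Local Notation C := R[i].
Local Notation ws := (wsum (sd_simple D)).
Variable L : 'rV[C]_n.
Local Notation wt k := (L - toC (ws k)).
Implicit Types (c : expo n -> C) (a t : 'rV[R]_n) (k m : expo n).

Definition ser c a : C := xget 0 [set s | usum (fun k => c k * xi (wt k) a) s].

Lemma ser_eq c a s : usum (fun k => c k * xi (wt k) a) s -> ser c a = s.
Proof.
move=> h; rewrite /ser; case: xgetP => [s' _ h'|h']; first exact: usum_unique h' h.
by case: (h' s).
Qed.

Lemma abs_ser c a (r b : R) : 0 < r ->
  abs_le (fun k => c k * xi (wt k) a * (expR (r * wt_norm D L k))%:C%C) b ->
  abs_le (fun k => c k * xi (wt k) a) b.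
Proof.
move=> r0; apply: abs_le_sub => k; rewrite [X in _ <= X]cnM cn_real ger0_norm ?expR_ge0 //.
rewrite ler_peMr ?cn_ge0 // -expR0 ler_expR mulr_ge0 ?(ltW r0) // sumr_ge0 // => j _.
exact: cn_ge0.
Qed.

Lemma usum_ser c a : subexp c -> A_plus D a -> usum (fun k => c k * xi (wt k) a) (ser c a).
Proof.
move=> hc aP; have [r r0 [b hb]] := decay L hc aP.
by have [s hs] := usum_exists (abs_ser r0 hb); rewrite (ser_eq hs).
Qed.

Section AtPoint.
Variables (c : expo n -> C) (a : 'rV[R]_n) (r b : R).
Hypothesis (r0 : 0 < r).
Hypothesis hb : abs_le (fun k => c k * xi (wt k) a * (expR (r * wt_norm D L k))%:C%C) b.

(** The terms of [xi (wt k) t] as a product of exponential series in the coordinates of [t]; the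
    double family [f t] collects them for all [k]. *)
Let monom k t m := \prod_j ((wt k 0 j * (t 0 j)%:C%C) ^+ m j / (m j)`!%:R).
Let f t (p : expo n * expo n) := c p.1 * xi (wt p.1) a * monom p.1 t p.2.

Let f_abs t : (forall j, `|t 0 j| <= r) -> abs_le (f t) b.
Proof.
move=> tr; apply: abs_le_pair hb => k.
have hm : abs_le (monom k t) (expR (\sum_j cn (wt k 0 j) * `|t 0 j|)).
  rewrite expR_sum; apply: (@abs_le_prod _ _ _
    (fun j q => (cn (wt k 0 j) * `|t 0 j|) ^+ q / q`!%:R)) => [j q|m|j M].
  - by rewrite divr_ge0 ?exprn_ge0 // mulr_ge0 ?cn_ge0.
  - rewrite cn_prod; apply: ler_prod => j _; rewrite cn_ge0 /=.
    by rewrite cnM cnX cnM cn_real cnV cn_nat.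
  - by apply: expR_partial; rewrite mulr_ge0 ?cn_ge0.
move=> A; apply: le_trans (abs_leZ (c k * xi (wt k) a) hm A) _.
rewrite [X in _ <= X]cnM cn_real ger0_norm ?expR_ge0 // ler_wpM2l ?cn_ge0 // ler_expR.
by rewrite /wt_norm mulr_sumr; apply: ler_sum => j _; rewrite mulrC ler_wpM2r ?cn_ge0.
Qed.

Let usum_f t : (forall j, `|t 0 j| <= r) -> usum (f t) (ser c (a + t)).
Proof.
move=> tr; have fb := f_abs tr; have [s hs] := usum_exists fb.
suff h : usum (fun k => c k * xi (wt k) (a + t)) s by rewrite (ser_eq h).
apply: (usum_fiber (pi := fst) fb hs) => k; apply: usum_fst fb _.
rewrite xi_add mulrA; apply: usumZ.
have -> : xi (wt k) t = cexp (\sum_j wt k 0 j * (t 0 j)%:C%C).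
  by rewrite /xi /dotw; congr cexp; apply: eq_bigr => j _; rewrite toCE.
exact: usum_cexp_sum.
Qed.

(** Summing the double family over [k] first yields a power series in [t]. Its coefficients are read
    off at the corner [t1], where everything still converges, and rescaled by homogeneity. *)
Lemma ser_analytic_at : analytic_at (ser c) a.
Proof.
pose t1 : 'rV[R]_n := \row_j r.
have t1r j : `|t1 0 j| <= r by rewrite mxE ger0_norm // ltW.
have /choice[d dP] : forall m, exists s,
    usum (fun p => if p.2 == m then f t1 p else 0) s.
  move=> m; apply: (@usum_exists _ _ _ b); apply: abs_le_sub (f_abs t1r) => p.
  by case: ifP => // _; rewrite cn0 cn_ge0.
exists (fun m => d m * (\prod_j r ^- m j)%:C%C); exists r => // t tr; apply/sums_toP.
have tr' j : `|t 0 j| <= r by rewrite ltW.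
apply: (usum_fiber (pi := snd) (f_abs tr') (usum_f tr')) => m.
rewrite -mulrA -rmorphM -big_split /= mulrC; apply: usum_ext (usumZ _ (dP m)) => -[k p] /=.
case: eqP => [->|_]; last by rewrite mulr0.
rewrite /f /= mulrCA; congr (_ * _); rewrite rmorph_prod -big_split; apply: eq_bigr => j _ /=.
have rC : r%:C%C != 0 :> C by rewrite fmorph_eq0 gt_eqF.
have -> : t1 0 j = r by rewrite mxE.
rewrite !exprMn rmorphM fmorphV !rmorphXn /=.
by field; rewrite pnatr_eq0 -lt0n fact_gt0 expf_neq0.
Qed.

Let ddx (j : 'I_n) := ser (fun k => wt k 0 j * c k) a.

Let delta (j : 'I_n) : expo n := [ffun i => (i == j : nat)].

(* After removing the terms with [m = 0] and [m = delta j] only terms that are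
   homogeneous in [s] of degree at least two survive. *)
Lemma ser_increment (j : 'I_n) (s : R) : `|s| <= 1 ->
  usum (fun k => wt k 0 j * c k * xi (wt k) a) (ddx j) ->
  cn (ser c (a + (s * r) *: delta_mx 0 j) - ser c a - (s * r)%:C%C * ddx j) <= s ^+ 2 * b.
Proof.
move=> s1 hd; set t := (s * r) *: _; pose t1 : 'rV[R]_n := r *: delta_mx 0 j.
have t1r i : `|t1 0 i| <= r.
  rewrite !mxE eqxx /=; case: (i == j); rewrite ?mulr1 ?mulr0 ?normr0 ?(ltW r0) //.
  by rewrite ger0_norm // ltW.
have tr i : `|t 0 i| <= r.
  rewrite /t -scalerA mxE normrM; apply: le_trans (t1r i).
  by rewrite ler_piMl.
have h0 : usum (fun p => if p.2 == ezero n then f t p else 0) (ser c a).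
  apply: usum_snd (f_abs tr) _.
  have h : usum (fun k => c k * xi (wt k) a) (ser c a).
    by have [s' hs'] := usum_exists (abs_ser r0 hb); rewrite (ser_eq hs').
  apply: usum_ext h => k; rewrite /f /monom /= big1 ?mulr1 // => i _.
  by rewrite ffunE expr0 divr1.
have h1 : usum (fun p => if p.2 == delta j then f t p else 0) ((s * r)%:C%C * ddx j).
  apply: usum_snd (f_abs tr) _; apply: usum_ext (usumZ _ hd) => k.
  rewrite /f /monom /= (bigD1 j) //= big1 => [|i ij].
    by rewrite ffunE eqxx expr1 !mxE !eqxx /= mulr1 divr1; ring.
  by rewrite ffunE (negPf ij) expr0 divr1.
apply: usum_bound (usumB (usumB (usum_f tr) h0) h1) _.
have hb' := abs_leZ (s ^+ 2)%:C%C (f_abs t1r).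
rewrite cn_real ger0_norm ?sqr_ge0 // in hb'.
apply: abs_le_sub hb' => -[k m] /=.
have scale : f t (k, m) = (s ^+ edeg m)%:C%C * f t1 (k, m).
  rewrite /f /= [RHS]mulrCA; congr (_ * _); rewrite /monom /edeg expr_sum rmorph_prod -big_split.
  apply: eq_bigr => i _ /=; have -> : t 0 i = s * t1 0 i by rewrite /t -scalerA mxE.
  by rewrite (rmorphM (real_complex R)) [wt k 0 i * _]mulrCA exprMn rmorphXn mulrA.
have [->|m0] := eqVneq m (ezero n).
  rewrite ifN ?subr0 ?subrr ?cn0 ?cn_ge0 //.
  apply/eqP => /(congr1 (fun q : expo n => q j)); by rewrite !ffunE eqxx.
rewrite subr0; have [->|mj] := eqVneq m (delta j); first by rewrite subrr cn0 cn_ge0.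
rewrite subr0 scale [X in X <= _]cnM [X in _ <= X]cnM !cn_real.
have [m2|m2] := leqP 2 (edeg m).
  by rewrite ler_wpM2r ?cn_ge0 // !normrX ler_wiXn2l.
(* A monomial of degree one other than [delta j] contains a coordinate in which [t1] is zero. *)
have m1 : edeg m = 1%N by apply/eqP; rewrite eqn_leq -ltnS m2 edeg_gt0.
have [i /andP[ij mi]] : exists i, (i != j) && (0 < m i)%N.
  apply/existsP; apply: contraNT mj; rewrite negb_exists => /forallP h.
  have h' i : i != j -> m i = 0%N by move=> ij; have := h i; rewrite ij lt0n negbK => /eqP.
  apply/eqP/ffunP => i; rewrite ffunE; case: eqP => [->|/eqP/h' //].
  by rewrite -[RHS]/1%N -m1 /edeg (bigD1 j) //= big1 ?addn0.
have -> : f t1 (k, m) = 0.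
  rewrite /f /monom /= (bigD1 i) //= !mxE (negPf ij) andbF mulr0 mulr0.
  by rewrite -(prednK mi) exprS !mul0r mulr0.
by rewrite cn0 !mulr0.
Qed.

End AtPoint.
End Expansion.

Lemma derive_of_increment (R : realType) n (f : 'rV[R]_n -> R) (a v : 'rV[R]_n) (d M r : R) :
  0 < r -> 0 <= M ->
  (forall h, `|h| <= r -> `|f (a + h *: v) - f a - h * d| <= M * h ^+ 2) -> 'D_v f a = d.
Proof.
move=> r0 M0 H; apply: cvg_lim => //; apply/cvgrPdist_le => e e0.
have M1 : 0 < M + 1 by rewrite ltr_wpDl.
pose q := Num.min r (e / (M + 1)).
have q0 : 0 < q by rewrite lt_min r0 divr_gt0.
exists q => //= h /=; rewrite sub0r normrN => hq hn0.
have hr : `|h| <= r by apply: le_trans (ltW hq) _; rewrite ge_min lexx.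
have he : `|h| <= e / (M + 1) by apply: le_trans (ltW hq) _; rewrite ge_min lexx orbT.
have h0 : 0 < `|h| by rewrite normr_gt0.
rewrite -(ler_pM2l h0) -normrM mulrBr [h * (h^-1 *: _)](_ : _ = f (a + h *: v) - f a).
  rewrite distrC; apply: le_trans (H _ hr) _.
  rewrite -real_normK ?num_real // expr2 mulrCA ler_wpM2l // ?normr_ge0 //.
  move: he; rewrite ler_pdivlMr // => he; apply: le_trans he.
  by rewrite mulrC ler_wpM2l // lerDl.
by rewrite [_ *: _ in LHS]/GRing.scale /= mulVKf // [X in f X - _]addrC.
Qed.

(** * Termwise differentiation and shifts of exponents *)

Section Rules.
Variables (R : realType) (n : nat) (D : splitData R n).
Local Notation C := R[i].
Local Notation roots := (sd_roots D).
Local Notation ws := (wsum (sd_simple D)).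
Variable L : 'rV[C]_n.
Local Notation wt k := (L - toC (ws k)).
Local Notation ser := (ser D L).
Implicit Types (c : expo n -> C) (a t : 'rV[R]_n) (k p : expo n).

(** A factor linear in the height costs nothing: the bound on [c] is taken with the square root [s]
    of [r], and by Bernoulli's inequality [edeg k + 1] is at most a constant times the remaining
    power of [s]. *)
Lemma subexp_dominated c c' (C0 : R) : subexp c -> 0 <= C0 ->
  (forall r K : R, 1 < r -> 0 <= K -> (forall k, cn (c k) <= K * r ^+ edeg k) ->
    forall k, cn (c' k) <= C0 * (edeg k).+1%:R * (K * r ^+ edeg k)) ->
  subexp c'.
Proof.
move=> hc C00 H r r1; pose s := Num.sqrt r.
have rs : r = s ^+ 2 by rewrite sqr_sqrtr // ltW // (lt_trans _ r1).
have s1 : 1 < s by rewrite -sqrtr1 ltr_sqrt // (lt_trans _ r1).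
have s0 : 0 < s by apply: lt_trans s1.
have [K K0 KP] := hc _ s1.
pose Q := 1 + (s - 1)^-1.
have Q0 : 0 <= Q by rewrite addr_ge0 // invr_ge0 subr_ge0 ltW.
have bern e : e.+1%:R <= Q * s ^+ e.
  have b : 1 + e%:R * (s - 1) <= s ^+ e.
    elim: e => [|e IH]; first by rewrite mul0r addr0 expr0.
    rewrite exprS; apply: le_trans (ler_wpM2l (ltW s0) IH).
    rewrite -natr1; have := mulr_ge0 (ler0n R e) (sqr_ge0 (s - 1)); lra.
  apply: le_trans (ler_wpM2l Q0 b); rewrite /Q -natr1.
  have -> : (1 + (s - 1)^-1) * (1 + e%:R * (s - 1)) =
    1 + e%:R + (s - 1)^-1 + e%:R * (s - 1) by field; rewrite subr_eq0 gt_eqF.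
  have : 0 <= (s - 1)^-1 by rewrite invr_ge0 subr_ge0 ltW.
  have : 0 <= e%:R * (s - 1) by rewrite mulr_ge0 // subr_ge0 ltW.
  lra.
exists (C0 * Q * K) => [|k]; first by rewrite !mulr_ge0.
apply: le_trans (H s K s1 K0 KP k) _.
have -> : C0 * Q * K * r ^+ edeg k = C0 * (Q * s ^+ edeg k) * (K * s ^+ edeg k).
  by rewrite rs -exprM mulnC exprM expr2; ring.
by rewrite ler_wpM2r ?mulr_ge0 ?exprn_ge0 ?(ltW s0) // ler_wpM2l.
Qed.

Lemma subexp_deriv c (j : 'I_n) : subexp c -> subexp (fun k => wt k 0 j * c k).
Proof.
pose A := \sum_(i < n) `|(sd_simple D)`_i 0 j|.
have A0 : 0 <= A by apply: sumr_ge0.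
move=> hc; apply: (subexp_dominated (C0 := cn (L 0 j) + A) hc) => [|r K r1 K0 H k].
  by rewrite addr_ge0 ?cn_ge0.
rewrite cnM; apply: ler_pM; rewrite ?cn_ge0 //.
have -> : wt k 0 j = L 0 j - (ws k 0 j)%:C%C by rewrite !mxE.
apply: le_trans (cnB _ _) _; rewrite cn_real mulrDl; apply: lerD.
  by rewrite ler_peMr ?cn_ge0 // ler1n.
rewrite /wsum summxE /A mulr_suml; apply: le_trans (ler_norm_sum _ _ _) _.
apply: ler_sum => i _; rewrite mulmxnE normrMn -[_ *+ k i]mulr_natr ler_wpM2l // ler_nat.
by apply: leqW; rewrite /edeg (bigD1 i) //= leq_addr.
Qed.

Lemma subexp_fseries (l : expo n) (u : nat -> C) c : l != ezero n ->
  (forall m, cn (u m) <= 1) -> subexp c -> subexp (fmul (V := C^o) (fseries D (ws l) u) c).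
Proof.
move=> l0 u1 hc; apply: (subexp_dominated (C0 := 1) hc) => // r K r1 K0 H k.
rewrite (@fmul_fseries _ _ _ _ l0 C^o); apply: le_trans (cn_sum _ _ _) _.
apply: (@le_trans _ _ (\sum_(m < (edeg k).+1) K * r ^+ edeg k)).
  rewrite big_mkcond; apply: ler_sum => m _; case: ifP => [h|_]; last first.
    by rewrite mulr_ge0 // exprn_ge0 // ltW // (lt_trans _ r1).
  rewrite [cn (_ *: _)]cnM -[X in _ <= X]mul1r; apply: ler_pM; rewrite ?cn_ge0 //.
  apply: le_trans (H _) _; rewrite ler_wpM2l // ler_weXn2l ?ltW //.
  by rewrite edeg_sub // leq_subr.
by rewrite sumr_const card_ord mul1r mulr_natl.
Qed.

Lemma partial_A_ser (j : 'I_n) c a : subexp c -> A_plus D a ->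
  partial_A j (ser c) a = ser (fun k => wt k 0 j * c k) a.
Proof.
move=> hc aP; have [r r0 [b hb]] := decay L hc aP.
have hd := usum_ser L (subexp_deriv j hc) aP; set d := ser _ a in hd *.
have b0 : 0 <= b by have := hb fset0; rewrite big_seq_fset0.
have inc h : `|h| <= r ->
    cn (ser c (a + h *: delta_mx 0 j) - ser c a - h%:C%C * d) <= b / r ^+ 2 * h ^+ 2.
  move=> hr; have s1 : `|h / r| <= 1.
    by rewrite normrM normfV (ger0_norm (ltW r0)) ler_pdivrMr // mul1r.
  have := ser_increment r0 hb s1 hd; rewrite divfK ?gt_eqF // => H.
  apply: le_trans H _; rewrite le_eqVlt; apply/orP; left; apply/eqP.
  by field; rewrite gt_eqF.
have M0 : 0 <= b / r ^+ 2 by rewrite divr_ge0 // sqr_ge0.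
rewrite /partial_A [d]complexE.
rewrite (@derive_of_increment _ _ _ _ _ (complex.Re d) (b / r ^+ 2) r) //; last first.
  move=> h hr; apply: le_trans (inc h hr); apply: le_trans (cn_Re _).
  by case: (ser c _) (ser c a) d {hd inc} => [? ?] [? ?] [? ?] /=; rewrite mul0r subr0.
rewrite (@derive_of_increment _ _ _ _ _ (complex.Im d) (b / r ^+ 2) r) //.
  by rewrite -complexE; case: d {hd inc}.
move=> h hr; apply: le_trans (inc h hr); apply: le_trans (cn_Im _).
by case: (ser c _) (ser c a) d {hd inc} => [? ?] [? ?] [? ?] /=; rewrite mul0r addr0.
Qed.

Definition eshift (l : expo n) c : expo n -> C :=
  fun k => if ele l k then c (esub k l) else 0.

Lemma subexp_eshift l c : subexp c -> subexp (eshift l c).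
Proof.
move=> hc r r1; have [K K0 KP] := hc _ r1; exists K => // k; rewrite /eshift.
case: ifP => [h|_]; last by rewrite cn0 mulr_ge0 // exprn_ge0 // ltW // (lt_trans _ r1).
apply: le_trans (KP _) _; rewrite ler_wpM2l // ler_weXn2l ?ltW //.
by rewrite edeg_sub // leq_subr.
Qed.

Lemma ser_eshift l c a : subexp c -> A_plus D a ->
  ser (eshift l c) a = xi (- toC (ws l)) a * ser c a.
Proof.
move=> hc aP; have [r r0 [b hb]] := decay L (subexp_eshift l hc) aP.
apply: ser_eq; apply: (usum_embed (h := eadd l) (pi := fun k => esub k l) (b := b)).
- exact: eaddK.
- move=> k; rewrite /eshift; case: ifP => [/esubK->|_ _]; first by rewrite eqxx.
  by rewrite mul0r.
- exact: abs_ser r0 hb.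
apply: usum_ext (usumZ _ (usum_ser L hc aP)) => k /=.
have -> : wt (eadd l k) = - toC (ws l) + wt k by rewrite wsumD toCD opprD addrCA.
by rewrite /eshift ele_addr eaddK (xiD (- toC (ws l))) [RHS]mulrCA.
Qed.

Lemma fseries_eshift (l : expo n) u c k : l != ezero n ->
  fmul (V := C^o) (fseries D (ws l) (fun m => if m is m'.+1 then u m' else 0)) c k =
  eshift l (fmul (V := C^o) (fseries D (ws l) u) c) k.
Proof.
move=> l0; rewrite (@fmul_fseries _ _ _ _ l0 C^o) big_mkcond big_ord_recl /= scale0r if_same add0r.
have emulS m : emul m.+1 l = eadd l (emul m l).
  by apply/ffunP => i; rewrite !ffunE mulSn.
under eq_bigr do rewrite /bump /= add1n emulS.
rewrite /eshift; case: ifP => h; last first.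
  apply: big1 => m _; case: ifP => // h'; move: h; rewrite (ele_trans _ h') //.
  exact: ele_addr.
rewrite (@fmul_fseries _ _ _ _ l0 C^o).
have hl : ((edeg (esub k l)).+1 <= edeg k)%N.
  rewrite edeg_sub //; have := ele_edeg h; have := edeg_gt0 l0; lia.
rewrite (big_ord_widen_cond _ (fun m => ele (emul m l) (esub k l))
  (fun m => u m *: (c (esub (esub k l) (emul m l)) : C^o)) hl).
rewrite [RHS]big_mkcond; apply: eq_bigr => m _.
rewrite ele_esub // esub_add; case h' : (ele (eadd l (emul m l)) k) => //=.
rewrite -ele_esub // in h'; rewrite ltnS.
suff -> : (m <= edeg (esub k l))%N by [].
by apply: leq_trans (ele_edeg h'); rewrite edeg_mul leq_pmulr // edeg_gt0.
Qed.

End Rules.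

(** * Multiplication by the two hyperbolic functions of a root *)

Section HyperbolicRules.
Variables (R : realType) (n : nat) (D : splitData R n).
Local Notation C := R[i].
Local Notation roots := (sd_roots D).
Local Notation ws := (wsum (sd_simple D)).
Variable L : 'rV[C]_n.
Local Notation wt k := (L - toC (ws k)).
Local Notation ser := (ser D L).
Implicit Types (c : expo n -> C) (a : 'rV[R]_n) (k p : expo n).

Lemma fseriesN al u p : fseries D al (fun m => - u m) p = -1 * fseries D al u p.
Proof. by rewrite /fseries mulN1r sumrN. Qed.

Lemma fmulNl (f f' c : expo n -> C) k : (forall p, f' p = -1 * f p) ->
  fmul (V := C^o) f' c k = - fmul (V := C^o) f c k.
Proof.
move=> ff'; have -> : - fmul (V := C^o) f c k = -1 *: fmul (V := C^o) f c k.
  by rewrite scaleN1r.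
by rewrite -fmulZl; exact: fmul_ext.
Qed.

Lemma cn_bool (b : bool) : cn (b%:R : C) <= 1.
Proof. by rewrite cn_nat; case: b; rewrite ?ler01. Qed.

Section PositiveRoot.
Variables (c : expo n -> C) (a : 'rV[R]_n).
Hypotheses (hc : subexp c) (aP : A_plus D a).
Variables (al : 'rV[R]_n) (l : expo n).
Hypotheses (ral : al \in roots) (pal : positive D al) (alE : al = ws l) (l0 : l != ezero n).
Let x := xi (- toC al) a.
(** All four products are shifts of this one: with [x = xi (- toC al) a] the sums for [fgeom] at
    [al] and [- al] are [g] and [- x^2 g], those for [fcsch] are [x g] and [- x g]. *)
Let g : expo n -> C := fmul (V := C^o) (fgeom D al) c.

Let hg : subexp g.
Proof.
rewrite /g fgeom_pos // alE; apply: subexp_fseries => // m; exact: cn_bool.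
Qed.

Let g_neg k : fmul (V := C^o) (fgeom D (- al)) c k = - eshift l (eshift l g) k.
Proof.
have E : eshift l g =1 fmul (V := C^o) (fseries D (ws l) (fun m => if m is m'.+1 then (~~ odd m')%:R else 0)) c.
  by move=> p; rewrite fseries_eshift // /g fgeom_pos // alE.
have -> : eshift l (eshift l g) k = eshift l (fmul (V := C^o)
    (fseries D (ws l) (fun m => if m is m'.+1 then (~~ odd m')%:R else 0)) c) k.
  by rewrite {1}/eshift [RHS]/eshift; case: ifP => // _; exact: E.
rewrite -fseries_eshift //; apply: fmulNl => p.
rewrite fgeom_neg // alE -fseriesN; apply: fseries_ext => -[|[|m]] //=.
by rewrite negbK andbT.
Qed.

Let csch_pos k : fmul (V := C^o) (fcsch D al) c k = eshift l g k.
Proof.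
rewrite /g fgeom_pos // alE -fseries_eshift //; apply: fmul_ext => // p.
by rewrite fcsch_pos -?alE // alE; apply: fseries_ext => -[|m] //=.
Qed.

Let csch_neg k : fmul (V := C^o) (fcsch D (- al)) c k = - eshift l g k.
Proof.
rewrite -csch_pos; apply: fmulNl => p.
by rewrite fcsch_neg // fcsch_pos // -fseriesN.
Qed.

Let serS : ser (eshift l g) a = x * ser g a.
Proof. by rewrite (ser_eshift L l hg aP) /x alE. Qed.

Let serSS : ser (eshift l (eshift l g)) a = x * (x * ser g a).
Proof. by rewrite (ser_eshift L l (subexp_eshift l hg) aP) serS /x alE. Qed.

Let hSS := subexp_eshift l (subexp_eshift l hg).

Let x2 : 1 - x ^+ 2 != 0.
Proof.
rewrite subr_eq0; apply/eqP => /(congr1 (@cn R)); rewrite cn1 cnX /x -toCN cn_xi_toC dotwNl.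
have : expR (- dotw al a) < 1 by rewrite expR_lt1 oppr_lt0 -expR_gt1; exact: aP.
by move=> h E; have := exprn_ilt1 2 (expR_ge0 _) h; rewrite -E ltxx.
Qed.

(** Summing [c = g - x^2 g], which is [fgeomD], and dividing afterwards avoids any rearrangement of
    the geometric series itself. *)
Let serE : ser g a = (1 - x ^+ 2)^-1 * ser c a.
Proof.
suff -> : ser c a = ser g a - x * (x * ser g a) by field.
apply: ser_eq; rewrite -serSS; apply: usum_ext (usumB (usum_ser L hg aP) (usum_ser L hSS aP)) => k.
by rewrite -mulrBl -g_neg [_ + _](@fgeomD _ _ _ C^o).
Qed.

Let xi2 : xi (- toC (al *+ 2)) a = x ^+ 2.
Proof. by rewrite toCMn mulr2n opprD xiD expr2. Qed.

Let xiV : xi (toC al) a = x^-1.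
Proof.
have x0 : x != 0 by exact: cexp_neq0.
have xx : x * xi (toC al) a = 1.
  rewrite -xiD addNr /xi /dotw big1 ?cexp0 // => j _; by rewrite mxE mul0r.
by rewrite -[RHS]mulr1 -xx mulKf.
Qed.

Lemma usum_geom_pos : usum (fun k => fmul (V := C^o) (fgeom D al) c k * xi (wt k) a)
  ((1 - xi (- toC (al *+ 2)) a)^-1 * ser c a).
Proof. rewrite xi2 -serE; exact: usum_ser. Qed.

Lemma usum_geom_neg : usum (fun k => fmul (V := C^o) (fgeom D (- al)) c k * xi (wt k) a)
  ((1 - xi (- toC (- al *+ 2)) a)^-1 * ser c a).
Proof.
have x0 : x != 0 by exact: cexp_neq0.
have -> : xi (- toC (- al *+ 2)) a = x ^- 2.
  by rewrite mulNrn toCN opprK toCMn mulr2n xiD xiV -expr2 exprVn.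
have -> : (1 - x ^- 2)^-1 * ser c a = - ser (eshift l (eshift l g)) a.
  rewrite serSS serE; field.
  have -> : x ^+ 2 - 1 = - (1 - x ^+ 2) by rewrite opprB.
  by rewrite oppr_eq0 x0 x2.
apply: usum_ext (usumN (usum_ser L hSS aP)) => k; by rewrite g_neg mulNr.
Qed.

Lemma usum_csch_pos : usum (fun k => fmul (V := C^o) (fcsch D al) c k * xi (wt k) a)
  ((xi (toC al) a - xi (- toC al) a)^-1 * ser c a).
Proof.
have x0 : x != 0 by exact: cexp_neq0.
have -> : (xi (toC al) a - xi (- toC al) a)^-1 * ser c a = ser (eshift l g) a.
  by rewrite xiV -/x serS serE; field; rewrite x0 x2.
apply: usum_ext (usum_ser L (subexp_eshift l hg) aP) => k; by rewrite csch_pos.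
Qed.

Lemma usum_csch_neg : usum (fun k => fmul (V := C^o) (fcsch D (- al)) c k * xi (wt k) a)
  ((xi (toC (- al)) a - xi (- toC (- al)) a)^-1 * ser c a).
Proof.
have x0 : x != 0 by exact: cexp_neq0.
have -> : (xi (toC (- al)) a - xi (- toC (- al)) a)^-1 * ser c a = - ser (eshift l g) a.
  rewrite toCN opprK xiV -/x serS serE; field; rewrite x0 x2.
  by rewrite -oppr_eq0 opprB x2.
apply: usum_ext (usumN (usum_ser L (subexp_eshift l hg) aP)) => k; by rewrite csch_neg mulNr.
Qed.

End PositiveRoot.

Lemma usum_geom c a al : subexp c -> A_plus D a -> al \in roots ->
  usum (fun k => fmul (V := C^o) (fgeom D al) c k * xi (wt k) a)
    ((1 - xi (- toC (al *+ 2)) a)^-1 * ser c a).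
Proof.
move=> hc aP ral; case: (boolP (positive D al)) => [pal|npal].
  have [l lE l0] := positive_expo ral pal; exact: (@usum_geom_pos c a hc aP al l ral pal lE l0).
have r' : - al \in roots by rewrite root_opp.
have p' : positive D (- al) by rewrite positiveN.
have [l lE l0] := positive_expo r' p'.
by have := @usum_geom_neg c a hc aP (- al) l r' p' lE l0; rewrite opprK.
Qed.

Lemma usum_csch c a al : subexp c -> A_plus D a -> al \in roots ->
  usum (fun k => fmul (V := C^o) (fcsch D al) c k * xi (wt k) a)
    ((xi (toC al) a - xi (- toC al) a)^-1 * ser c a).
Proof.
move=> hc aP ral; case: (boolP (positive D al)) => [pal|npal].
  have [l lE l0] := positive_expo ral pal; exact: (@usum_csch_pos c a hc aP al l ral pal lE l0).
have r' : - al \in roots by rewrite root_opp.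
have p' : positive D (- al) by rewrite positiveN.
have [l lE l0] := positive_expo r' p'.
by have := @usum_csch_neg c a hc aP (- al) l r' p' lE l0; rewrite opprK.
Qed.

End HyperbolicRules.

Section Delta.
Variables (R : realType) (n : nat) (D : splitData R n).
Local Notation C := R[i].
Local Notation roots := (sd_roots D).

(** Each factor satisfies [|1/2 - i| <= i + 1], so the product is at most [q!]. *)
Lemma cn_sqrt_coef q : cn (sqrt_coef R q) <= 1.
Proof.
have f0 : 0 < q`!%:R :> R by rewrite ltr0n fact_gt0.
rewrite /sqrt_coef !cnM cnX cnN cn1 expr1n mul1r cnV cn_nat ler_pdivrMr // mul1r cn_prod.
rewrite {f0}; elim: q => [|q IH]; first by rewrite big_ord0.
rewrite big_ord_recr /= factS natrM mulrC; apply: ler_pM => //.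
- exact: cn_ge0.
- by apply: prodr_ge0 => i _; exact: cn_ge0.
- apply: le_trans (cnB _ _) _; rewrite cnV !cn_nat -[q.+1%:R]natr1 addrC lerD2l.
  by rewrite invf_le1 ?ler1n // ltr0n.
Qed.

Lemma subexp_fdelta c : subexp c -> subexp (fmul (V := C^o) (fdelta D) c).
Proof.
move=> hc; rewrite /fdelta.
have : {subset [seq al <- roots | positive D al] <= [pred al | (al \in roots) && positive D al]}.
  by move=> al; rewrite mem_filter inE andbC.
elim: [seq al <- roots | positive D al] => [|al s IH] sub /=.
  by move=> r r1; have [K K0 KP] := hc r r1; exists K => // k; rewrite (@fmul1 _ _ C^o).
have /andP[ral pal] := sub al (mem_head _ _); have [l lE l0] := positive_expo ral pal.
have hs : {subset s <= [pred al | (al \in roots) && positive D al]}.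
  by move=> be bes; apply: sub; rewrite inE bes orbT.
have u1 m : cn (if odd m then 0 else sqrt_coef R m./2) <= 1.
  by case: (odd m); rewrite ?cn0 ?ler01 ?cn_sqrt_coef.
have h := @subexp_fseries _ _ D l (fun m => if odd m then 0 else sqrt_coef R m./2) _ l0 u1 (IH hs).
move=> r r1; have [K K0 KP] := h r r1; exists K => // k.
by rewrite (@fmul_assoc _ _ C^o) lE; exact: KP.
Qed.

End Delta.

(** * Tensor-valued sums and the operators on the chamber *)

Section Analytic.
Variables (R : realType) (n : nat) (D : splitData R n).
Variables (N : nat) (U : 'I_N -> lieRep (@in_g R n D)).
Variables Vl Vr : lieRep (in_k D).
Local Notation C := R[i].
Local Notation roots := (sd_roots D).
Local Notation ws := (wsum (sd_simple D)).
Local Notation TT := (tens U Vl Vr).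
Variable L : 'rV[C]_n.
Local Notation wt k := (L - toC (ws k)).

Section TensorSums.
Variable a : 'rV[R]_n.
Implicit Types (X Y : expo n -> TT) (S T : TT).

Definition usumT X T : Prop :=
  forall w p q, usum (fun k => X k w p q * xi (wt k) a) (T w p q).

Lemma usumT_unique X S T : usumT X S -> usumT X T -> S = T.
Proof.
move=> hS hT; apply/ffunP => w; apply/matrixP => p q.
exact: usum_unique (hS w p q) (hT w p q).
Qed.

Lemma usumT_ext X Y T : X =1 Y -> usumT X T -> usumT Y T.
Proof. by move=> XY h w p q; apply: usum_ext (h w p q) => k; rewrite XY. Qed.

Lemma usumTD X Y S T : usumT X S -> usumT Y T -> usumT (fun k => X k + Y k) (S + T).
Proof.
move=> hX hY w p q; rewrite ffunE mxE.
by apply: usum_ext (usumD (hX w p q) (hY w p q)) => k; rewrite ffunE mxE mulrDl.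
Qed.

Lemma usumT_linear (f : TT -> TT) X T : linear f -> usumT X T ->
  usumT (fun k => f (X k)) (f T).
Proof.
move=> lf h w p q.
have fE t : f t w p q = \sum_w' \sum_p' \sum_q' f (tunit w' p' q') w p q * t w' p' q'.
  rewrite {1}(tens_decomp t) (linf_sum lf) sum_ffunE summxE; apply: eq_bigr => w' _.
  rewrite (linf_sum lf) sum_ffunE summxE; apply: eq_bigr => p' _.
  rewrite (linf_sum lf) sum_ffunE summxE; apply: eq_bigr => q' _.
  by rewrite (linfZ lf) ffunE mxE mulrC.
rewrite fE; apply: usum_ext (usum_sum _ (fun w' => usum_sum _ (fun p' => usum_sum _
  (fun q' => usumZ (f (tunit w' p' q') w p q) (h w' p' q'))))) => k /=.
rewrite fE mulr_suml; apply: eq_bigr => w' _; rewrite mulr_suml; apply: eq_bigr => p' _.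
by rewrite mulr_suml; apply: eq_bigr => q' _; rewrite mulrA.
Qed.

Lemma usumTZ c X T : usumT X T -> usumT (fun k => c *: X k) (c *: T).
Proof.
apply: (@usumT_linear (fun t => c *: t)) => d t u.
by rewrite scalerDr !scalerA mulrC.
Qed.

Lemma usumTB X Y S T : usumT X S -> usumT Y T -> usumT (fun k => X k - Y k) (S - T).
Proof.
move=> hX /(usumTZ (-1)) hY; rewrite -[- T]scaleN1r.
by apply: usumT_ext (usumTD hX hY) => k; rewrite scaleN1r.
Qed.

Lemma usumT_sum (I : eqType) (r : seq I) (P : pred I) (X : I -> expo n -> TT) (T : I -> TT) :
  (forall i, i \in r -> P i -> usumT (X i) (T i)) ->
  usumT (fun k => \sum_(i <- r | P i) X i k) (\sum_(i <- r | P i) T i).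
Proof.
elim: r => [|i r IH] h.
  move=> w p q; rewrite big_nil ffunE mxE; apply: usum_ext (usum0 _) => k.
  by rewrite big_nil ffunE mxE mul0r.
have {}IH : usumT (fun k => \sum_(i <- r | P i) X i k) (\sum_(i <- r | P i) T i).
  by apply: IH => j jr; apply: h; rewrite inE jr orbT.
rewrite big_cons; case: ifP => Pi.
  apply: usumT_ext (usumTD (h i (mem_head _ _) Pi) IH) => k.
  by rewrite big_cons Pi.
by apply: usumT_ext IH => k; rewrite big_cons Pi.
Qed.

End TensorSums.

Variable X : expo n -> TT.
Hypothesis hX : forall w p q, subexp (fun k => X k w p q).

Definition tens_sum (a : 'rV[R]_n) : TT :=
  [ffun w => \matrix_(p, q) ser D L (fun k => X k w p q) a].

Lemma tens_sumE a w p q : tens_sum a w p q = ser D L (fun k => X k w p q) a.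
Proof. by rewrite ffunE mxE. Qed.

Let entry_linear w p q : linear (fun t : TT => t w p q : C^o).
Proof. by move=> c t u; rewrite ffunE mxE ffunE mxE. Qed.

Section Point.
Variable a : 'rV[R]_n.
Hypothesis aP : A_plus D a.

Lemma usumT_tens_sum : usumT a X (tens_sum a).
Proof. by move=> w p q; rewrite tens_sumE; exact: usum_ser. Qed.

Lemma tens_sum_analytic w p q : analytic_at (fun b => tens_sum b w p q) a.
Proof.
rewrite (_ : (fun b => tens_sum b w p q) = ser D L (fun k => X k w p q)).
  have [r r0 [b hb]] := decay L (hX w p q) aP; exact: ser_analytic_at r0 hb.
by apply/funext => b; rewrite tens_sumE.
Qed.

Let usumT_deriv (j : 'I_n) : usumT a (fderiv D L j X)
  [ffun w => \matrix_(p, q) partial_A j (fun b => tens_sum b w p q) a].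
Proof.
move=> w p q; rewrite ffunE mxE.
rewrite (_ : (fun b => tens_sum b w p q) = ser D L (fun k => X k w p q)); last first.
  by apply/funext => b; rewrite tens_sumE.
rewrite (partial_A_ser L j (hX w p q) aP); apply: usum_ext (usum_ser L (subexp_deriv D L j (hX w p q)) aP) => k.
by congr (_ * _); rewrite /fderiv ffunE [RHS]mxE.
Qed.

Let usumT_geom al : al \in roots -> usumT a (fmul (fgeom D al) X)
  ((1 - xi (- toC (al *+ 2)) a)^-1 *: tens_sum a).
Proof.
move=> ral w p q; rewrite ffunE mxE tens_sumE.
apply: usum_ext (usum_geom L (hX w p q) aP ral) => k.
by rewrite (fmul_linear _ _ _ (entry_linear w p q)).
Qed.

Let usumT_csch al : al \in roots -> usumT a (fmul (fcsch D al) X)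
  ((xi (toC al) a - xi (- toC al) a)^-1 *: tens_sum a).
Proof.
move=> ral w p q; rewrite ffunE mxE tens_sumE.
apply: usum_ext (usum_csch L (hX w p q) aP ral) => k.
by rewrite (fmul_linear _ _ _ (entry_linear w p q)).
Qed.

Let lU i z Y T : usumT a Y T ->
  usumT a (fun k => act_U (Vl := Vl) (Vr := Vr) i z (Y k)) (act_U i z T).
Proof. exact: usumT_linear (act_U_is_linear i z). Qed.

Let ll z Y T : usumT a Y T ->
  usumT a (fun k => act_l (U := U) (Vl := Vl) (Vr := Vr) z (Y k)) (act_l z T).
Proof. exact: usumT_linear (act_l_is_linear z). Qed.

Let lr z Y T : usumT a Y T ->
  usumT a (fun k => act_r (U := U) (Vl := Vl) (Vr := Vr) z (Y k)) (act_r z T).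
Proof. exact: usumT_linear (act_r_is_linear z). Qed.

(** Both operators are instances of [kzb], and each of their ingredients commutes with summation, so
    the expression is followed term by term. *)
Lemma usumT_kzb i : usumT a (kzb_formal L i X) (kzb_on_A i tens_sum a).
Proof.
have hT := usumT_tens_sum.
apply: usumTB; [apply: usumTB; [apply: usumTB|]|].
- by apply: usumT_sum => j _ _; apply/lU/usumT_deriv.
- by apply: usumT_sum => j _ _; apply: usumT_sum => al ral _; apply/lU/lU/usumT_geom.
- apply: usumTD; [apply: usumTD; [|apply: usumTD]|].
  + by apply: usumT_sum => al ral _; apply/ll/lU/usumT_geom.
  + by apply: usumTZ; apply: usumT_sum => j _ _; apply/lU/lU.
  + by apply: usumT_sum => al ral _; apply/lU/lU/usumT_geom.
  + by apply: usumT_sum => al ral _; apply/lU/lr/usumT_csch.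
- apply: usumT_sum => j _ _; apply: usumTD.
    by apply: usumT_sum => k _ _; apply/lU/lU.
  by apply: usumT_sum => al ral _; apply/lU/lU/usumT_geom.
Qed.

End Point.
End Analytic.

Lemma subexp_spherical (R : realType) (n : nat) (D : splitData R n)
  (N : nat) (U : 'I_N -> lieRep (@in_g R n D)) (Vl Vr : lieRep (in_k D))
  (lam : N.+1.-tuple 'rV[R[i]]_n)
  (phi_l : {linear verma D (lam`_0 - toC (rho D)) -> 'cV[R[i]]_(rep_dim Vl)})
  (phi_lP : hom_k_from_verma phi_l)
  (phi_r : 'rV[R[i]]_n ->
     {linear 'cV[R[i]]_(rep_dim Vr) -> verma D (lam`_N - toC (rho D))})
  (phi_rP : hom_k_to_compl phi_r)
  (Psi : forall i : 'I_N,
     {linear verma D (lam`_i.+1 - toC (rho D)) ->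
             {ffun 'I_(rep_dim (U i)) -> verma D (lam`_i - toC (rho D))}})
  (PsiP : forall i, hom_g_tensor (Psi i)) w p q :
  subexp (fun k => spherical phi_l Psi phi_r k w p q).
Proof.
have entry_linear : linear (fun t : tens U Vl Vr => t w p q : R[i]^o).
  by move=> c t u; rewrite ffunE mxE ffunE mxE.
have h : subexp (fun k => spherical_coef phi_l Psi phi_r k w p q).
  move=> r r1; have [K K0 KP] := G_growth phi_lP phi_rP PsiP r1.
  exists K => // k; apply: le_trans (KP k); rewrite spherical_coefE; exact: tnorm_entry.
have := subexp_fdelta D h; move=> h' r r1; have [K K0 KP] := h' r r1.
exists K => // k; apply: le_trans (KP k).
by rewrite (fmul_linear _ _ _ entry_linear).
Qed.

Theorem theorem6p20 (R : realType) (n : nat) (D : splitData R n)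
  (N : nat) (N_gt0 : (0 < N)%N)
  (U : 'I_N -> lieRep (@in_g R n D))
  (Vl Vr : lieRep (@in_k R n D))
  (Vl_semisimple : rep_semisimple Vl) (Vr_semisimple : rep_semisimple Vr)
  (lam : N.+1.-tuple 'rV[R[i]]_n)
  (phi_l : {linear verma D (lam`_0 - toC (rho D)) -> 'cV[R[i]]_(rep_dim Vl)})
  (phi_lP : hom_k_from_verma phi_l)
  (phi_r : 'rV[R[i]]_n ->
     {linear 'cV[R[i]]_(rep_dim Vr) -> verma D (lam`_N - toC (rho D))})
  (phi_rP : hom_k_to_compl phi_r)
  (Psi : forall i : 'I_N,
     {linear verma D (lam`_i.+1 - toC (rho D)) ->
             {ffun 'I_(rep_dim (U i)) -> verma D (lam`_i - toC (rho D))}})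
  (PsiP : forall i, hom_g_tensor (Psi i)) :
  let ev (i : 'I_N) :=
    dotw lam`_i.+1 lam`_i.+1 / 2 - dotw lam`_i lam`_i / 2 in
  (forall (i : 'I_N) (k : expo n),
     kzb_formal lam`_N i (spherical phi_l Psi phi_r) k
     = ev i *: spherical phi_l Psi phi_r k)
  /\
  (hc_regular D (lam`_N - toC (rho D)) ->
   exists F : 'rV[R]_n -> tens U Vl Vr,
     [/\ forall a, A_plus D a -> sums_to_spherical phi_l Psi phi_r F a,
         forall a, A_plus D a ->
           forall w p q, analytic_at (fun b => F b w p q) a
       & forall (i : 'I_N) a, A_plus D a -> kzb_on_A i F a = ev i *: F a]).
Proof.
move=> ev; have formal := kzb_formal_spherical phi_lP phi_rP PsiP; split=> // _.
have hX := subexp_spherical phi_lP phi_rP PsiP.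
exists (tens_sum lam`_N (spherical phi_l Psi phi_r)); split=> [a aP w p q|a aP w p q|i a aP].
- exact/sums_toP/(usumT_tens_sum lam`_N hX aP).
- exact: tens_sum_analytic.
(* By the formal equations both sides are sums of the same series at [a]. *)
- apply: usumT_unique (usumT_kzb lam`_N hX aP i) _.
  by apply: usumT_ext (usumTZ (ev i) (usumT_tens_sum lam`_N hX aP)) => k; rewrite formal.
Qed.
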